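(* Let $M_T:=F_T+G_T$, $T>0$, where for every $T>0$ the random variables $F_T$ and $G_T$ belong to the second Wiener chaos $\mathcal H_2$, and suppose that $\mathbb E(F_T^2)\to c>0$ and $\mathbb E(G_T^2)\to 0$ as $T\to\infty$. Then there exists a constant $C>0$, independent of $T$, such that for all $T$ sufficiently large, $$d_{Kol}\left(\frac{M_T}{\sqrt{\mathbb E M_T^2}},\mathcal N(0,1)\right)\le C\, d_{Kol}\left(\frac{F_T}{\sqrt{\mathbb E F_T^2}},\mathcal N(0,1)\right)+C\,\|G_T\|_{L^2(\Omega)}.$$
   Context: $\{W(h),h\in\mathcal H\}$ is an isonormal Gaussian process over a Hilbert space $\mathcal H$: a centered Gaussian family on a probability space with $\mathbb E[W(h_1)W(h_2)]=\langle h_1,h_2\rangle_{\mathcal H}$. The second Wiener chaos $\mathcal H_2$ is the closed linear subspace of $L^2(\Omega)$ generated by $\{H_2(W(h)):h\in\mathcal H,\|h\|_{\mathcal H}=1\}$, $H_2$ being the second Hermite polynomial. $d_{Kol}(U,V)=\sup_{z\in\mathbb R}|P(U\le z)-P(V\le z)|$, and $\mathcal N(0,1)$ stands for a standard normal variable. *)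

(* Defs.v *)
From HB Require Import structures.
From mathcomp Require Import all_boot all_order all_algebra.
From mathcomp Require Import all_classical all_reals all_analysis.

Set Implicit Arguments.
Unset Strict Implicit.
Unset Printing Implicit Defensive.

Import Order.TTheory GRing.Theory Num.Theory.
Import numFieldNormedType.Exports.

Local Open Scope classical_set_scope.
Local Open Scope ring_scope.

(* Equality of measures is only required on measurable sets: the values of
   [normal_prob] and [distribution] elsewhere are meaningless. *)
Definition has_law d (T : measurableType d) (R : realType)
    (P : probability T R) (X : {RV P >-> R}) (nu : set R -> \bar R) : Prop :=
  forall A : set R, measurable A -> distribution P X A = nu A.

Definition standard_normal d (T : measurableType d) (R : realType)
    (P : probability T R) (X : {RV P >-> R}) : Prop :=
  has_law X (normal_prob 0 1).

(* The degenerate law N(0, 0) is treated apart because [normal_prob 0 0] is by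
   convention the uniform law on [0, 1] and not the Dirac mass at 0. *)
Definition centered_gaussian d (T : measurableType d) (R : realType)
    (P : probability T R) (X : {RV P >-> R}) : Prop :=
  has_law X (dirac (0 : R)) \/ exists2 s : R, 0 < s & has_law X (normal_prob 0 s).

Definition centered_gaussian_family d (T : measurableType d) (R : realType)
    (P : probability T R) (I : Type) (W : I -> {RV P >-> R}) : Prop :=
  forall (n : nat) (a : 'I_n -> R) (h : 'I_n -> I),
    centered_gaussian (P := P)
      (\sum_(i < n) a i *: (W (h i) : {mfun T >-> R})).

Definition isonormal_gaussian_process d (T : measurableType d) (R : realType)
    (P : probability T R) (H : lmodType R) (dot : {dot H for idfun})
    (W : H -> {RV P >-> R}) : Prop :=
  centered_gaussian_family W /\
  forall h1 h2 : H, ('E_P[fun w => (W h1 w * W h2 w)%R] = (dot h1 h2)%:E)%E.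

(* Probabilists' normalisation: [hermite R 2] is ['X^2 - 1].  Rescaling the
   polynomials by nonzero constants would not change the Wiener chaoses. *)
Fixpoint hermite (R : nzRingType) (q : nat) : {poly R} :=
  if q is p.+1 then 'X * hermite R p - (hermite R p)^`() else 1.

(* X belongs to the L^2-closure of the linear span of the H_q(W(h)), |h| = 1. *)
Definition wiener_chaos d (T : measurableType d) (R : realType)
    (P : probability T R) (H : normedModType R) (W : H -> {RV P >-> R})
    (q : nat) (X : {RV P >-> R}) : Prop :=
  (X : T -> R) \in Lfun P 2%:E /\
  forall e : R, 0 < e ->
    exists (n : nat) (a : 'I_n -> R) (h : 'I_n -> H),
      (forall i, `|h i| = 1) /\
      ('N[P]_2%:E[(fun w =>
          (X w - \sum_(i < n) a i * (hermite R q).[W (h i) w])%R%:E)] < e%:E)%E.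

Definition kolmogorov_dist d d' (T : measurableType d) (T' : measurableType d')
    (R : realType) (P : probability T R) (Q : probability T' R)
    (U : {RV P >-> R}) (V : {RV Q >-> R}) : \bar R :=
  ereal_sup (range (fun z : R => `|cdf U z - cdf V z|%E)).

Definition normalized d (T : measurableType d) (R : realType)
    (P : probability T R) (X : {RV P >-> R}) : {RV P >-> R} :=
  (Num.sqrt (fine 'E_P[fun w => (X w ^+ 2)%R]%E))^-1 *: (X : {mfun T >-> R}).

(* Main.v *)
Require Import Defs.
From HB Require Import structures.
From mathcomp Require Import all_boot all_order all_algebra.
From mathcomp Require Import all_classical all_reals all_analysis.
From mathcomp Require Import measurable_realfun ring lra.
From mathcomp Require complex.

Set Implicit Arguments.
Unset Strict Implicit.
Unset Printing Implicit Defensive.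

Import Order.TTheory GRing.Theory Num.Theory.
Import numFieldNormedType.Exports.

Local Open Scope classical_set_scope.
Local Open Scope ring_scope.

(** Write [U] and [V] for the normalizations of [F t] and [M t].  Both lie in the second chaos and
    have variance 1, and normalizing costs little: [V - U] has norm at most a constant times
    the norm of [G t].  By the triangle inequality for the distance to the Gaussian law, it is
    enough to bound the Kolmogorov distance between [U] and [V] by a constant times the norm of
    [V - U], and this only when [U] is close to Gaussian: when it is not, the right-hand side
    exceeds 1 for a suitable constant, while the left-hand side never does.

    The bound on the distribution functions comes from a bounded density, made quantitative along
    the segment from [U] to [V].  Smoothing the indicator of a half line at scale [e] turns it
    into an arctangent, whose derivative is the Poisson kernel.  Hence, with [X = U + s (V - U)],
    it is enough to bound the mean of [poisson e (b - X) * (V - U)] uniformly in [b], [e] and [s]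
    ([atan_increment], [cdf_from_atan]).  The Poisson kernel is a superposition of cosines over the half
    line of frequencies, with a density between 0 and 1, so that the task is to bound the mean of [cos (t X + a) * (V - U)] by a function integrable in [t]
    ([Ex_poisson_bound]).

    For finite sums, [X] is a quadratic form in finitely many Gaussian variables.  Diagonalizing
    it gives [X = sum_i l_i (W(e_i)^2 - 1)] with [e] orthonormal ([spectral_frame]), and the
    coordinates [W(e_i)] are independent ([coord_indep]).  Each coordinate contributes a
    factor of modulus [(1 + 4 t^2 l_i^2)^(-1/4)] to the characteristic function of [X]
    ([kappa_modulus], [phase_sqmod_prod]).  Expanding [V - U] in products of coordinates,
    off-diagonal products have mean zero against [cos (t X + a)] ([phase_offdiag]), diagonal ones
    are controlled by Gaussian integration by parts ([phase_diag]), and Bessel's inequality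
    yields the bound [|t| |phi(t)| ||X|| ||V - U||], [phi] being the characteristic function
    ([chaos_spectrum]).

    This bound is integrable as soon as [phi] decays fast enough, which holds when no [l_i^2]
    exceeds a twelfth of the variance: the product of the factors is then at least what it would
    be with six equal eigenvalues ([prod_flat_ge]), and the bound decays like [1 / (1 + t^2)]
    ([near_gaussian_decay]).  Closeness to the Gaussian law enters here: a large eigenvalue would
    make [|phi(1)|] visibly larger than [exp (-1/2)] ([eigenvalues_small]), and [phi(1)] is
    controlled by the Kolmogorov distance ([near_gaussian_of_kolmogorov]).  All these estimates are
    stable in [L^2], so that they pass from finite sums to their limits ([chaos2_atan_increment]).

    The independence of the coordinates is derived from characteristic functions alone: a finite
    measure on the line is determined by its Fourier transform ([fourier_unique_cdf]), which
    again follows from arctangent smoothing.  Throughout, complex exponentials are replaced by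
    cosines with an arbitrary phase: knowing the means of [cos (X + a)] for all [a] is knowing
    the mean of [exp (i X)]. *)

(** * Integrals of real functions *)

(** Real functions are integrated over the whole space, so that the domain and the injection into
    extended reals are left out. *)
Notation "mu .-intg f" := (mu.-integrable [set: _] (EFin \o f)) (at level 2, f at level 3).

Section trigo.
Context {R : realType}.

Lemma cos_norm (u : R) : `|cos u| <= 1. Proof. by rewrite ler_norml cos_geN1 cos_le1. Qed.
Lemma sin_norm (u : R) : `|sin u| <= 1. Proof. by rewrite ler_norml sin_geN1 sin_le1. Qed.

Lemma measurable_cos d (T : measurableType d) (f : T -> R) :
  measurable_fun setT f -> measurable_fun setT (fun x => cos (f x)).
Proof.
move=> mf; apply: (measurableT_comp _ mf); apply: continuous_measurable_fun; exact: continuous_cos.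
Qed.

Lemma measurable_sin d (T : measurableType d) (f : T -> R) :
  measurable_fun setT f -> measurable_fun setT (fun x => sin (f x)).
Proof.
move=> mf; apply: (measurableT_comp _ mf); apply: continuous_measurable_fun; exact: continuous_sin.
Qed.

Lemma continuous_cos_comp (f : R -> R) : continuous f -> continuous (fun x => cos (f x)).
Proof. by move=> cf x; apply: continuous_comp; [exact: cf|exact: continuous_cos]. Qed.

Lemma continuous_sin_comp (f : R -> R) : continuous f -> continuous (fun x => sin (f x)).
Proof. by move=> cf x; apply: continuous_comp; [exact: cf|exact: continuous_sin]. Qed.

Lemma continuousD_comp (f g : R -> R) : continuous f -> continuous g ->
  continuous (fun x => f x + g x).
Proof. by move=> cf cg x; apply: cvgD; [exact: cf|exact: cg]. Qed.

Lemma continuousM_comp (f g : R -> R) : continuous f -> continuous g ->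
  continuous (fun x => f x * g x).
Proof. by move=> cf cg x; apply: cvgM; [exact: cf|exact: cg]. Qed.

End trigo.

Lemma measurable_sum_cond {R : realType} d (T : measurableType d) (I : Type) (s : seq I)
  (Q : pred I) (F : I -> T -> R) : (forall i, measurable_fun setT (F i)) ->
  measurable_fun setT (fun x => \sum_(i <- s | Q i) F i x).
Proof. by move=> mF; under eq_fun do rewrite -big_filter; exact: measurable_sum. Qed.

Ltac meas := repeat first
  [ exact: measurable_cst | assumption | solve [trivial] | apply: measurable_cos | apply: measurable_sin
  | apply: measurable_funD | apply: measurable_funB | apply: measurable_funN | apply: measurable_funM
  | apply: measurable_funX | apply: measurable_sum => ? | apply: measurable_sum_cond => ? | by [] ].
Ltac cont := repeat first
  [ exact: cst_continuous | exact: exprn_continuous | assumption | apply: continuous_cos_comp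
  | apply: continuous_sin_comp | apply: continuousD_comp | apply: continuousM_comp
  | by move=> ?; exact: cvg_id ].

Section integrals.
Context {d} {T : measurableType d} {R : realType}.
Implicit Types (f g : T -> R).

Section measure.
Variable mu : {measure set T -> \bar R}.

Lemma intg_meas f : mu.-intg f -> measurable_fun setT f.
Proof. by move=> /integrableP[/measurable_EFinP]. Qed.

Lemma intgD f g : mu.-intg f -> mu.-intg g -> mu.-intg (fun x => f x + g x).
Proof. by move=> hf hg; have := integrableD measurableT hf hg. Qed.

Lemma intgB f g : mu.-intg f -> mu.-intg g -> mu.-intg (fun x => f x - g x).
Proof. by move=> hf hg; have := integrableB measurableT hf hg. Qed.

Lemma intgZ c f : mu.-intg f -> mu.-intg (fun x => c * f x).
Proof. by move=> hf; have := integrableZl measurableT c hf. Qed.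

Lemma intg_le f g : measurable_fun setT f -> (forall x, `|f x| <= g x) ->
  mu.-intg g -> mu.-intg f.
Proof.
move=> mf fg; apply: le_integrable => //; first exact/measurable_EFinP.
by move=> x _ /=; rewrite lee_fin (le_trans (fg x)) // ler_norm.
Qed.

Lemma intg_norm f : mu.-intg f -> mu.-intg (fun x => `|f x|).
Proof. by move=> hf; have := integrable_norm hf. Qed.

Lemma intg_sum (I : Type) (s : seq I) (F : I -> T -> R) :
  (forall i, mu.-intg (F i)) -> mu.-intg (fun x => \sum_(i <- s) F i x).
Proof.
move=> h; have := @integrable_sum _ _ _ mu _ measurableT _ s xpredT _ (fun i _ => h i).
by apply: eq_integrable => // x _ /=; rewrite sumEFin.
Qed.

Lemma intgMbd (M : R) f g : measurable_fun setT f -> (forall x, `|f x| <= M) ->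
  mu.-intg g -> mu.-intg (fun x => f x * g x).
Proof.
move=> mf fM hg; apply: (@intg_le _ (fun x => M * `|g x|)); last exact/intgZ/intg_norm.
  by apply: measurable_funM => //; exact: intg_meas.
by move=> x; rewrite normrM ler_wpM2r.
Qed.

Lemma ExD f g : mu.-intg f -> mu.-intg g ->
  \int[mu]_x (f x + g x) = \int[mu]_x f x + \int[mu]_x g x.
Proof. exact: RintegralD. Qed.

Lemma ExB f g : mu.-intg f -> mu.-intg g ->
  \int[mu]_x (f x - g x) = \int[mu]_x f x - \int[mu]_x g x.
Proof. exact: RintegralB. Qed.

Lemma ExZ c f : mu.-intg f -> \int[mu]_x (c * f x) = c * \int[mu]_x f x.
Proof. exact: RintegralZl. Qed.

Lemma ExN f : mu.-intg f -> \int[mu]_x (- f x) = - \int[mu]_x f x.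
Proof.
move=> hf; rewrite -mulN1r -ExZ//; by under [RHS]eq_Rintegral do rewrite mulN1r.
Qed.

Lemma Ex_sum (I : Type) (s : seq I) (F : I -> T -> R) :
  (forall i, mu.-intg (F i)) ->
  \int[mu]_x (\sum_(i <- s) F i x) = \sum_(i <- s) \int[mu]_x F i x.
Proof.
move=> h; elim: s => [|i s IH].
  rewrite big_nil; under eq_Rintegral do rewrite big_nil.
  by rewrite /Rintegral integral0.
rewrite big_cons -IH -ExD//; last exact: intg_sum.
by under eq_Rintegral do rewrite big_cons.
Qed.

Lemma Ex_le f g : mu.-intg f -> mu.-intg g -> (forall x, f x <= g x) ->
  \int[mu]_x f x <= \int[mu]_x g x.
Proof. by move=> hf hg fg; apply: le_Rintegral. Qed.

Lemma Ex_norm f : mu.-intg f -> `|\int[mu]_x f x| <= \int[mu]_x `|f x|.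
Proof. exact: le_normr_Rintegral. Qed.

Lemma EFin_Ex f : mu.-intg f -> (\int[mu]_x (f x)%:E = (\int[mu]_x f x)%:E)%E.
Proof. by move=> hf; rewrite fineK//; exact: integrable_fin_num. Qed.

Lemma Ex_eq_ae f g : measurable_fun setT f -> measurable_fun setT g ->
  {ae mu, forall x, f x = g x} -> \int[mu]_x f x = \int[mu]_x g x.
Proof.
move=> mf mg fg; congr fine; apply: ae_eq_integral => //;
  try exact/measurable_EFinP.
by apply: filterS fg => x -> _.
Qed.

Lemma Ex_cvg (f_ : nat -> T -> R) f g :
  (forall n, measurable_fun setT (f_ n)) -> mu.-intg g ->
  (forall x, f_ n x @[n --> \oo] --> f x) ->
  (forall n x, `|f_ n x| <= g x) ->
  mu.-intg f /\ \int[mu]_x f_ n x @[n --> \oo] --> \int[mu]_x f x.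
Proof.
move=> mf_ hg cf fg.
have mf : measurable_fun setT f.
  by apply: measurable_fun_cvg mf_ _ => x _; exact: cf.
have [] := @dominated_convergence _ _ _ mu setT measurableT
   (fun n x => (f_ n x)%:E) (EFin \o f) (EFin \o g).
- by move=> n; exact/measurable_EFinP.
- exact/measurable_EFinP.
- by apply: aeW => x _; apply: cvg_EFin; [exact: nearW|exact: cf].
- by [].
- by apply: aeW => x n _ /=; rewrite lee_fin.
move=> hf _ c; split => //.
apply: fine_cvg; rewrite -EFin_Ex//.
Qed.

Lemma Ex_derive (F dF : R -> T -> R) g :
  (forall t, mu.-intg (F t)) -> mu.-intg g ->
  (forall (t : R) x, is_derive t (1 : R) (F ^~ x) (dF t x)) ->
  (forall t x, `|dF t x| <= g x) ->
  forall t : R, is_derive t (1 : R) (fun t => \int[mu]_x F t x) (\int[mu]_x dF t x).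
Proof.
move=> hF hg dFF dFg t.
have It : `](t - 1), (t + 1)[%classic t by rewrite /= in_itv/=; lra.
have dE u x : (partial1of2 F) u x = dF u x.
  by rewrite partial1of2E; exact: derive_val.
have g0 x : 0 <= g x by rewrite (le_trans _ (dFg 0 x)).
have D := @derivable_under_integral R d T mu F setT measurableT t _ _ It
  (fun u _ => hF u) (fun u x _ _ => @ex_derive _ _ _ _ _ _ _ (dFF u x)) g g0 hg.
have D1 := @differentiation_under_integral R d T mu F setT measurableT t _ _ It
  (fun u _ => hF u) (fun u x _ _ => @ex_derive _ _ _ _ _ _ _ (dFF u x)) g g0 hg.
have b : forall x y, `](t - 1), (t + 1)[%classic x -> setT y -> `|partial1of2 F x y| <= g y.
  by move=> x y _ _; rewrite dE.
apply: DeriveDef; first exact: D b.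
rewrite -derive1E D1//; by under eq_Rintegral do rewrite dE.
Qed.

End measure.

Section finite.
Variable mu : {finite_measure set T -> \bar R}.

Lemma intg_bd (M : R) f : measurable_fun setT f -> (forall x, `|f x| <= M) -> mu.-intg f.
Proof.
move=> mf fM; apply: measurable_bounded_integrable => //.
  by rewrite ltey_eq fin_num_measure.
exists M; split; first exact: num_real.
by move=> y My x _ /=; rewrite (le_trans (fM x))// ltW.
Qed.

Lemma intg_cst c : mu.-intg (fun=> c).
Proof. exact: (@intg_bd `|c|). Qed.

Lemma intg_sqr f : measurable_fun setT f -> mu.-intg (fun x => f x ^+ 2) -> mu.-intg f.
Proof.
move=> mf hf; apply: (@intg_le _ _ (fun x => 1 + f x ^+ 2)) => //.
  move=> x; rewrite -normr_id -(real_normK (num_real (f x))).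
  set a := `|f x|; rewrite /= ger0_norm /a //; have := normr_ge0 (f x); nra.
by apply: intgD => //; exact: intg_cst.
Qed.

End finite.

Lemma intg_mul (mu : {measure set T -> \bar R}) f g : measurable_fun setT f -> measurable_fun setT g ->
  mu.-intg (fun x => f x ^+ 2) -> mu.-intg (fun x => g x ^+ 2) ->
  mu.-intg (fun x => f x * g x).
Proof.
move=> mf mg hf hg; apply: (@intg_le _ _ (fun x => f x ^+ 2 + g x ^+ 2)); last exact: intgD.
  exact: measurable_funM.
move=> x; rewrite normrM -(real_normK (num_real (f x))) -(real_normK (num_real (g x))).
have := normr_ge0 (f x); have := normr_ge0 (g x); nra.
Qed.

Lemma intg_sqrD (mu : {measure set T -> \bar R}) f g : measurable_fun setT f -> measurable_fun setT g ->
  mu.-intg (fun x => f x ^+ 2) -> mu.-intg (fun x => g x ^+ 2) ->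
  mu.-intg (fun x => (f x + g x) ^+ 2).
Proof.
move=> mf mg hf hg; apply: (@intg_le _ _ (fun x => 2 * f x ^+ 2 + 2 * g x ^+ 2)).
- by apply: measurable_funX; exact: measurable_funD.
- by move=> x; rewrite ger0_norm ?sqr_ge0//; have := sqr_ge0 (f x - g x); nra.
- by apply: intgD; exact: intgZ.
Qed.

Lemma cauchy_schwarz (mu : {measure set T -> \bar R}) f g : measurable_fun setT f -> measurable_fun setT g ->
  mu.-intg (fun x => f x ^+ 2) -> mu.-intg (fun x => g x ^+ 2) ->
  (\int[mu]_x (f x * g x)) ^+ 2 <= \int[mu]_x (f x ^+ 2) * \int[mu]_x (g x ^+ 2).
Proof.
move=> mf mg hf hg; have hfg := intg_mul mf mg hf hg.
set a := \int[mu]_x (f x ^+ 2); set b := \int[mu]_x (g x ^+ 2).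
set c := \int[mu]_x (f x * g x).
have a0 : 0 <= a by apply: Rintegral_ge0 => x _; exact: sqr_ge0.
have b0 : 0 <= b by apply: Rintegral_ge0 => x _; exact: sqr_ge0.
(* The square of [s f + t g] has a nonnegative mean; the two uses of this below choose [s] and
   [t] according to whether [f] is null. *)
have key (s t : R) : 0 <= s ^+ 2 * a + 2 * s * t * c + t ^+ 2 * b.
  rewrite -!ExZ// -!ExD; do ?[apply: intgD | apply: intgZ | by []].
  by apply: Rintegral_ge0 => x _; have := sqr_ge0 (s * f x + t * g x); nra.
have [a1|a1] := ltP 0 a; first by have := key c (- a); nra.
have {a1}a_eq : a = 0 by apply/eqP; rewrite eq_le a1.
have := key (- (1 + b)) c; have := key 1 1; rewrite a_eq.
have [->|c0] := eqVneq c 0; first by rewrite mul0r expr0n.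
have : 0 < c ^+ 2 by rewrite exprn_even_gt0.
nra.
Qed.

End integrals.

Import HBNNSimple.

(** * Measures with a density *)

Section density.
Context {d d'} {T : measurableType d} {T' : measurableType d'} {R : realType}.
Variables (mu : {measure set T -> \bar R}) (nu : {measure set T' -> \bar R}).
Variables (X : T -> T') (g : T -> R).
Hypothesis mX : measurable_fun setT X.
Hypothesis mg : measurable_fun setT g.
Hypothesis g0 : forall x, 0 <= g x.
Hypothesis nuE : forall A, measurable A -> nu A = (\int[mu]_(x in X @^-1` A) (g x)%:E)%E.

Let ge0_integral_density_nnsfun (h : {nnsfun T' >-> R}) :
  (\int[nu]_x (h x)%:E = \int[mu]_x ((h (X x))%:E * (g x)%:E))%E.
Proof.
under [LHS]eq_integral do rewrite fimfunE -fsumEFin//.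
rewrite [LHS]ge0_integral_fsum//; last 2 first.
- by move=> r; exact/measurable_EFinP/measurableT_comp.
- by move=> n x _; rewrite EFinM nnfun_muleindic_ge0.
under [RHS]eq_integral.
  move=> x _; rewrite fimfunE -fsumEFin// ge0_mule_fsuml; last first.
    by move=> r; rewrite EFinM nnfun_muleindic_ge0.
  over.
rewrite [RHS]ge0_integral_fsum//; last 2 first.
- move=> r; apply: emeasurable_funM; last exact/measurable_EFinP.
  apply/measurable_EFinP; apply: measurable_funM => //.
  by apply: (measurableT_comp _ mX).
- by move=> n x _; apply: mule_ge0; [rewrite EFinM nnfun_muleindic_ge0|rewrite lee_fin].
apply: eq_fsbigr => r _.
rewrite integralZl_indic_nnsfun// integral_indic// setIT nuE//.
have [r0|r0] := ltP r 0.
  rewrite preimage_nnfun0// integral_set0 mule0.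
  apply/esym/integral0_eq => x _; rewrite indicE memNset ?mulr0 ?mul0e//.
rewrite integral_mkcond -ge0_integralZl//; last 2 first.
- apply/(measurable_restrictT _ _).1 => //.
    by rewrite -[X @^-1` _]setTI; apply: mX => //; exact: measurable_sfunP.
  exact/measurable_funTS/measurable_EFinP.
- by move=> x _; rewrite patchE; case: ifPn => // _; rewrite lee_fin.
apply: eq_integral => x _; rewrite patchE indicE.
rewrite (_ : (X x \in _) = (x \in X @^-1` (h @^-1` [set r]))); last by apply/idP/idP; rewrite !inE.
by case: ifPn => _; rewrite ?mulr1 ?mulr0 ?mul0e ?mule0.
Qed.

(** The hypothesis [nuE] is the case of indicators; simple functions follow by additivity and
    nonnegative ones by monotone convergence. *)
Lemma ge0_integral_density (f : T' -> \bar R) :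
  measurable_fun setT f -> (forall x, 0 <= f x)%E ->
  (\int[nu]_x f x = \int[mu]_x (f (X x) * (g x)%:E))%E.
Proof.
move=> mf f0.
pose f_ := nnsfun_approx measurableT mf.
transitivity (lim (\int[nu]_x (f_ n x)%:E @[n --> \oo])%E).
  rewrite -monotone_convergence//=.
  - apply: eq_integral => ? /[!inE] xD; apply/esym/cvg_lim => //=.
    exact: cvg_nnsfun_approx.
  - by move=> n; exact/measurable_EFinP/measurable_funTS.
  - by move=> n ? _; rewrite lee_fin.
  - by move=> ? _ ? ? mn; rewrite lee_fin; exact/lefP/nd_nnsfun_approx.
under [in LHS]eq_fun do rewrite ge0_integral_density_nnsfun.
rewrite -monotone_convergence//=.
- apply: eq_integral => x /[!inE] xD; apply/cvg_lim => //=.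
  apply: cvgeMr => //; exact: cvg_nnsfun_approx.
- move=> n; apply: emeasurable_funM; last exact/measurable_EFinP.
  by apply/measurable_EFinP; apply: (measurableT_comp _ mX).
- by move=> n x _; rewrite mule_ge0 ?lee_fin.
- move=> x _ a b ab; apply: lee_wpmul2r; rewrite lee_fin//.
  exact/lefP/nd_nnsfun_approx.
Qed.

Lemma intg_density (f : T' -> R) : measurable_fun setT f ->
  mu.-intg (fun x => f (X x) * g x) -> nu.-intg f.
Proof.
move=> mf /integrableP[_ h]; apply/integrableP; split; first exact/measurable_EFinP.
rewrite ge0_integral_density//; last by apply/measurable_EFinP; exact: measurableT_comp.
apply: le_lt_trans h; rewrite le_eqVlt; apply/orP; left; apply/eqP.
by apply: eq_integral => x _ /=; rewrite normrM EFinM (ger0_norm (g0 x)).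
Qed.

Lemma intg_densityN (f : T' -> R) : nu.-intg f -> mu.-intg (fun x => f (X x) * g x).
Proof.
move=> hf; have mf := intg_meas hf; move: hf => /integrableP[_ h]; apply/integrableP; split.
  by apply/measurable_EFinP; apply: measurable_funM => //; exact: measurableT_comp.
rewrite ge0_integral_density// in h; last by apply/measurable_EFinP; exact: measurableT_comp.
apply: le_lt_trans h; rewrite le_eqVlt; apply/orP; left; apply/eqP.
by apply: eq_integral => x _ /=; rewrite normrM EFinM (ger0_norm (g0 x)).
Qed.

Lemma Ex_density (f : T' -> R) : nu.-intg f ->
  \int[nu]_x f x = \int[mu]_x (f (X x) * g x).
Proof.
move=> hf; have mf := intg_meas hf.
rewrite /Rintegral integralE [in RHS]integralE.
have mp : measurable_fun setT (EFin \o f) by exact/measurable_EFinP.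
rewrite !ge0_integral_density//; last 2 first.
- exact: measurable_funeneg.
- exact: measurable_funepos.
congr (fine (_ - _)%E); apply: eq_integral => x _.
- by rewrite !funeposE /= -!EFin_max -EFinM maxr_pMl// mul0r.
- by rewrite !funenegE /= -!EFin_max -EFinM maxr_pMl// mul0r mulNr.
Qed.

End density.

(** * Gaussian integration by parts and Gaussian moments *)

Section ftc_line.
Context {R : realType}.
Local Notation leb := (@lebesgue_measure R).
Implicit Types F f : R -> R.

Lemma is_derive_continuous F f : (forall x : R, is_derive x (1 : R) F (f x)) -> continuous F.
Proof.
move=> h x; apply: differentiable_continuous; apply/derivable1_diffP.
exact: ex_derive.
Qed.

Lemma Rintegral_FTC F f (a b : R) : (forall x : R, is_derive x (1 : R) F (f x)) ->
  continuous f -> a < b -> \int[leb]_(x in `[a, b]) f x = F b - F a.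
Proof.
move=> dF cf ab; have cF := is_derive_continuous dF.
rewrite /Rintegral (@continuous_FTC2 _ f F)//.
- exact: continuous_subspaceT.
- split; first by move=> x _; exact: ex_derive.
  + by apply: cvg_at_right_filter; exact: cF.
  + by apply: cvg_at_left_filter; exact: cF.
- by move=> x _; rewrite derive1E; exact: derive_val.
Qed.

(** Exhaustion of an unbounded domain by segments, to which the fundamental theorem of calculus
    applies; domination by the integrand itself gives the limit. *)
Lemma Rintegral_FTC_limit (D : set R) (a : nat -> R) F f l :
  measurable (D : set (measurableTypeR R)) -> (forall n, `[a n, n.+1%:R] `<=` D) ->
  (forall x, D x -> \forall n \near \oo, a n <= x <= n.+1%:R) ->
  (forall n, a n < n.+1%:R) ->
  (forall x : R, is_derive x (1 : R) F (f x)) -> continuous f ->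
  leb.-integrable D (EFin \o f) ->
  F n.+1%:R - F (a n) @[n --> \oo] --> l ->
  \int[leb]_(x in D) f x = l.
Proof.
move=> mD sD cD an dF cf If Fl.
have mf := continuous_measurable_fun cf.
have IfD : leb.-intg (f \_ D).
  have := (integrable_mkcond _ mD).1 If; apply: eq_integrable => // x _.
  by rewrite /= restrict_EFin.
have [|x|n x|_] := @Ex_cvg _ _ _ leb (fun n => f \_ `[a n, n.+1%:R]) (f \_ D)
  (fun x => `|(f \_ D) x|) _ (intg_norm IfD).
- by move=> n; apply/(measurable_restrictT _ _).1 => //; exact: measurable_funTS.
- rewrite [X in _ --> X]patchE; case: ifPn => xD; last first.
    apply: cvg_near_cst; apply: nearW => n; rewrite patchE ifN//.
    by apply: contra xD; rewrite !inE; exact: sD.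
  apply: cvg_near_cst; move/set_mem: xD => /cD.
  by apply: filterS => n xn; rewrite patchE ifT// inE/= in_itv.
- rewrite !patchE; case: ifPn; last by rewrite normr0.
  by move=> h; rewrite ifT//; move: h; rewrite !inE; exact: sD.
rewrite -Rintegral_mkcond => c.
apply: (cvg_unique _ c) => //.
rewrite [X in X @ _](_ : _ = fun n => F n.+1%:R - F (a n))//.
by apply/funext => n; rewrite -Rintegral_mkcond (Rintegral_FTC dF).
Qed.

Lemma Rintegral_FTC_line F f l : (forall x : R, is_derive x (1 : R) F (f x)) ->
  continuous f -> leb.-intg f -> F n.+1%:R - F (- n.+1%:R) @[n --> \oo] --> l ->
  \int[leb]_x f x = l.
Proof.
move=> dF cf If; apply: Rintegral_FTC_limit => //.
- move=> x _; near=> n; rewrite -ler_norml.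
  by apply: (@le_trans _ _ n%:R); [near: n; exact: nbhs_infty_ger|rewrite ler_nat].
- by move=> n; rewrite gtrN.
Unshelve. all: by end_near. Qed.

Lemma Rintegral_FTC_ray F f l : (forall x : R, is_derive x (1 : R) F (f x)) ->
  continuous f -> leb.-integrable `[0, +oo[ (EFin \o f) -> F n.+1%:R - F 0 @[n --> \oo] --> l ->
  \int[leb]_(x in `[0, +oo[) f x = l.
Proof.
move=> dF cf If; apply: Rintegral_FTC_limit => //.
- by move=> n x /=; rewrite !in_itv/= => /andP[->].
- move=> x /=; rewrite in_itv/= andbT => x0; near=> n; rewrite x0/=.
  apply: (@le_trans _ _ n%:R); last by rewrite ler_nat.
  by apply: le_trans (ler_norm _) _; near: n; exact: nbhs_infty_ger.
Unshelve. all: by end_near. Qed.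

End ftc_line.

Lemma cvg0_le (R : realType) (u v : nat -> R) : (forall n, `|u n| <= v n) ->
  v n @[n --> \oo] --> (0 : R) -> u n @[n --> \oo] --> (0 : R).
Proof.
move=> uv v0; apply: norm_cvg0; apply: (@squeeze_cvgr _ _ _ _ (cst 0) v _ _ 0) => //.
- by apply: nearW => n; rewrite normr_ge0 uv.
- exact: cvg_cst.
Qed.

Lemma normal_pdf_cvg0 (R : realType) (s : R) : s != 0 ->
  normal_pdf 0 s n.+1%:R @[n --> \oo] --> (0 : R).
Proof.
move=> s0; rewrite normal_pdfE// -[X in _ --> X](mulr0 (normal_peak s)).
apply: cvgM; first exact: cvg_cst.
rewrite /normal_fun.
under eq_fun do rewrite subr0 mulNr.
apply: (@cvg_comp _ _ _ (fun n : nat => (n.+1%:R : R) ^+ 2 / (s ^+ 2 *+ 2)) (fun x => expR (- x))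
   _ (pinfty_nbhs R) _ _ (@cvgr_expR R)).
apply/cvgryPge => A; near=> n.
have c0 : 0 < s ^+ 2 *+ 2 by rewrite pmulrn_lgt0// exprn_even_gt0.
rewrite ler_pdivlMr//.
have n0 : A * (s ^+ 2 *+ 2) <= n%:R by near: n; exact: nbhs_infty_ger.
by apply: (le_trans n0); rewrite -natrX ler_nat (leq_trans (leqnSn n))// -mulnn leq_pmulr.
Unshelve. all: by end_near. Qed.

Section normal.
Context {R : realType}.
Local Notation leb := (@lebesgue_measure R).
Variable s : R.
Hypothesis s0 : 0 < s.
Implicit Types f : R -> R.

Let s_neq0 : s != 0. Proof. by rewrite gt_eqF. Qed.

(** Doubling the standard deviation absorbs polynomial factors; degree four is enough for the
    fourth moments of the Gaussian family. *)
Lemma normal_tail : exists2 C : R, 0 < C & forall x : R, (1 + x ^+ 4) * normal_pdf 0 s x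
   <= C * normal_pdf 0 (2 * s) x.
Proof.
have s20 : 2 * s != 0 by rewrite mulf_neq0// pnatr_eq0.
exists ((1 + 16 * s ^+ 4) * (normal_peak s / normal_peak (2 * s))).
  rewrite mulr_gt0// ?divr_gt0 ?normal_peak_gt0//.
  by rewrite ltr_pwDl// mulr_ge0// exprn_ge0// ltW.
have p0 := normal_peak_gt0 s_neq0; have p20 := normal_peak_gt0 s20.
move=> x; rewrite !normal_pdfE//=.
set p := normal_peak s in p0 *; set p2 := normal_peak _ in p20 *.
suff key : (1 + x ^+ 4) * normal_fun 0 s x <= (1 + 16 * s ^+ 4) * normal_fun 0 (2 * s) x.
  have -> : (1 + 16 * s ^+ 4) * (p / p2) * (p2 * normal_fun 0 (2 * s) x) =
     p * ((1 + 16 * s ^+ 4) * normal_fun 0 (2 * s) x) by field; rewrite gt_eqF.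
  by rewrite mulrCA ler_pM2l.
rewrite /normal_fun subr0.
set y := x ^+ 2 / (s ^+ 2 *+ 2).
have y0 : 0 <= y by rewrite divr_ge0 ?sqr_ge0// mulrn_wge0// sqr_ge0.
have -> : - x ^+ 2 / (s ^+ 2 *+ 2) = - y by rewrite mulNr.
have -> : - x ^+ 2 / ((2 * s) ^+ 2 *+ 2) = - (y / 4).
  by rewrite mulNr /y; congr (- _); field.
have -> : x ^+ 4 = 4 * s ^+ 4 * y ^+ 2 by rewrite /y; field.
have -> : - y = - (y / 4) - 3 / 4 * y by field.
rewrite expRD.
have he : 1 + 9 / 32 * y ^+ 2 <= expR (3 / 4 * y).
  have := @expR_ge1Dxn R (3 / 4 * y) 1 ltac:(by rewrite mulr_ge0).
  apply: le_trans; rewrite lerD2l /factorial/=.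
  by rewrite le_eqVlt; apply/orP; left; apply/eqP; field.
rewrite (expRN (3 / 4 * y)); set e := expR (3 / 4 * y) in he *; set q := expR _.
have e0 : 0 < e by rewrite expR_gt0.
rewrite mulrCA [leRHS]mulrC; apply: ler_wpM2l; first exact: expR_ge0.
rewrite ler_pdivrMr//.
have h4 : 0 <= s ^+ 4 by rewrite exprn_ge0 ?ltW.
have hy : 0 <= y ^+ 2 by exact: sqr_ge0.
set S := s ^+ 4 in h4 *; set Y := y ^+ 2 in hy he *.
have : 0 <= S * Y by rewrite mulr_ge0.
have : 0 <= S * (e - 1 - 9/32 * Y) by rewrite mulr_ge0//; lra.
nra.
Qed.

Local Notation g := (normal_pdf 0 s).
Local Notation gam := (normal_prob 0 s).

Let mg : measurable_fun setT g. Proof. exact: measurable_normal_pdf. Qed.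
Let g0 x : 0 <= g x. Proof. exact: normal_pdf_ge0. Qed.

Lemma intg_poly_pdf f C : measurable_fun setT f -> (forall x, `|f x| <= C * (1 + x ^+ 4)) ->
  leb.-intg (fun x => f x * g x).
Proof.
move=> mf fC; have [K K0 tail] := normal_tail.
have C0 : 0 <= C.
  have := le_trans (normr_ge0 _) (fC 0); by rewrite expr0n/= addr0 mulr1.
apply: (@intg_le _ _ _ leb _ (fun x => (C * K) * normal_pdf 0 (2 * s) x)).
- exact: measurable_funM.
- move=> x; rewrite normrM (ger0_norm (g0 x)).
  apply: (@le_trans _ _ (C * (1 + x ^+ 4) * g x)); first by rewrite ler_wpM2r.
  by rewrite -mulrA -[leRHS]mulrA ler_wpM2l.
- apply: intgZ; exact: integrable_normal_pdf.
Qed.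

Lemma intg_normal f C : measurable_fun setT f -> (forall x, `|f x| <= C * (1 + x ^+ 4)) ->
  gam.-intg f.
Proof.
move=> mf fC; apply: (@intg_density _ _ _ _ _ leb gam id g) => //.
exact: intg_poly_pdf fC.
Qed.

Lemma is_derive_normal_pdf x : is_derive x (1 : R) g (- (x / s ^+ 2) * g x).
Proof.
rewrite normal_pdfE//= /normal_fun.
apply: is_derive_eq; rewrite /GRing.scale/= subr0; field.
exact: s_neq0.
Qed.

(** Gaussian integration by parts: [x * pdf] is, up to sign, the derivative of [s^2 * pdf]. *)
Lemma stein f df C : (forall x : R, is_derive x (1 : R) f (df x)) -> continuous df ->
  (forall x, `|f x| <= C * (1 + x ^+ 4)) -> (forall x, `|df x| <= C * (1 + x ^+ 4)) ->
  (forall x, `|x * f x| <= C * (1 + x ^+ 4)) ->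
  \int[gam]_x (x * f x) = s ^+ 2 * \int[gam]_x df x.
Proof.
move=> dF cdf fC dfC xfC.
have cf := is_derive_continuous dF.
have mf := continuous_measurable_fun cf; have mdf := continuous_measurable_fun cdf.
have mxf : measurable_fun setT (fun x : R => x * f x) by exact: measurable_funM.
have Ixf := intg_normal mxf xfC; have Idf := intg_normal mdf dfC.
have Ixfl := intg_poly_pdf mxf xfC; have Idfl := intg_poly_pdf mdf dfC.
rewrite (@Ex_density _ _ _ _ _ leb gam id g)// (@Ex_density _ _ _ _ _ leb gam id g _ _ _ _ df)//.
apply/eqP; rewrite -subr_eq0 -ExZ// -ExB//; last exact: intgZ.
apply/eqP.
apply: (@Rintegral_FTC_line R (fun x => - s ^+ 2 * (f x * g x))
  (fun x => x * f x * g x - s ^+ 2 * (df x * g x)) 0).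
- move=> x; have := dF x; have := is_derive_normal_pdf x => ? ?.
  by apply: is_derive_eq; rewrite /GRing.scale/=; field.
- move=> x; apply: cvgB; [|apply: cvgM; first exact: cvg_cst].
  + apply: cvgM; last exact: continuous_normal_pdf.
    by apply: cvgM; [exact: cvg_id|exact: cf].
  + by apply: cvgM; [exact: cdf|exact: continuous_normal_pdf].
- by apply: intgB => //; exact: intgZ.
have [K K0 tail] := normal_tail.
have s20 : 2 * s != 0 by rewrite mulf_neq0// pnatr_eq0.
have C0 : 0 <= C.
  have := le_trans (normr_ge0 _) (fC 0); by rewrite expr0n/= addr0 mulr1.
have b x : `|- s ^+ 2 * (f x * g x)| <= s ^+ 2 * C * K * normal_pdf 0 (2 * s) x.
  rewrite mulNr normrN normrM ger0_norm ?sqr_ge0//.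
  rewrite -!mulrA; do 2 (apply: ler_wpM2l; first exact: ltW).
  rewrite normrM (ger0_norm (g0 _)).
  apply: (@le_trans _ _ (C * (1 + x ^+ 4) * g x)); first by rewrite ler_wpM2r.
  by rewrite -mulrA ler_wpM2l.
have lim0 : s ^+ 2 * C * K * normal_pdf 0 (2 * s) n.+1%:R @[n --> \oo] --> (0 : R).
  rewrite -[X in _ --> X](mulr0 (s ^+ 2 * C * K)).
  by apply: cvgM; [exact: cvg_cst|exact: normal_pdf_cvg0].
rewrite -[X in _ --> X](subrr (0 : R)); apply: cvgB.
- by apply: cvg0_le lim0 => n; exact: b.
- apply: cvg0_le lim0 => n; apply: (le_trans (b _)).
  by rewrite !normal_pdfE//= /normal_fun !subr0 sqrrN.
Qed.

Lemma x2le (x : R) : `|x| <= 1 + x ^+ 4 /\ x ^+ 2 <= 1 + x ^+ 4 /\ `|x| ^+ 3 <= 1 + x ^+ 4.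
Proof.
have e : x ^+ 4 = `|x| ^+ 4 by rewrite -normrX ger0_norm// exprn_even_ge0.
have e2 : x ^+ 2 = `|x| ^+ 2 by rewrite -normrX ger0_norm// exprn_even_ge0.
rewrite e e2; have := normr_ge0 x; set a := `|x| => a0.
have := sqr_ge0 (a ^+ 2 - 1); have := sqr_ge0 (a - 1); have := sqr_ge0 (a ^+ 2 - a).
by split; [|split]; nra.
Qed.

Lemma normal_moment2 : \int[gam]_x (x ^+ 2) = s ^+ 2.
Proof.
have -> : \int[gam]_x (x ^+ 2) = \int[gam]_x (x * x) by apply: eq_Rintegral => x _; rewrite expr2.
rewrite (@stein id (cst 1) 1).
- rewrite Rintegral_cst// [X in fine X](_ : _ = 1%E) ?mulr1 ?mul1r//; exact: integral_normal_pdf.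
- exact: cst_continuous.
- by move=> x; rewrite mul1r; case: (x2le x).
- by move=> x; rewrite mul1r normr1 lerDl exprn_even_ge0.
- by move=> x; rewrite mul1r -expr2 ger0_norm ?sqr_ge0//; case: (x2le x) => _ [].
Qed.

Lemma normal_moment4 : \int[gam]_x (x ^+ 4) = 3 * s ^+ 4.
Proof.
have -> : \int[gam]_x (x ^+ 4) = \int[gam]_x (x * x ^+ 3) by apply: eq_Rintegral => x _; rewrite -exprS.
have dx (x : R) : is_derive x (1 : R) (fun x => x ^+ 3) (3 * x ^+ 2).
  by apply: is_derive_eq; rewrite /GRing.scale/=; ring.
rewrite (@stein _ (fun x => 3 * x ^+ 2) 3 dx).
- rewrite ExZ ?normal_moment2//; first ring.
  apply: (@intg_normal _ 1); first exact: measurable_funX.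
  by move=> x; rewrite mul1r ger0_norm ?sqr_ge0//; case: (x2le x) => _ [].
- by move=> x; apply: cvgM; [exact: cvg_cst|exact: exprn_continuous].
- move=> x; rewrite normrX; case: (x2le x) => _ [_ h].
  by apply: (le_trans h); rewrite ler_peMl ?addr_ge0 ?exprn_even_ge0// ler1n.
- move=> x; rewrite normrM (ger0_norm (sqr_ge0 _)) ger0_norm// ler_wpM2l//.
  by case: (x2le x) => _ [].
- move=> x; rewrite -exprS ger0_norm ?exprn_even_ge0//.
  have : 0 <= x ^+ 4 by exact: exprn_even_ge0.
  lra.
Qed.

(** By Stein's identity the left-hand side solves [y' = - s^2 u y] as a function of the frequency
    [u]. *)
Lemma normal_cos (t a : R) : \int[gam]_x cos (t * x + a) = expR (- (s ^+ 2 * t ^+ 2 / 2)) * cos a.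
Proof.
have ge1 (x : R) : 1 <= 1 + x ^+ 4 by rewrite lerDl exprn_even_ge0.
have Ic (u : R) : gam.-intg (fun x => cos (u * x + a)).
  by apply: (@intg_normal _ 1) => [|x]; [meas|rewrite mul1r (le_trans (cos_norm _))].
have Ixs (u : R) : gam.-intg (fun x => x * sin (u * x + a)).
  apply: (@intg_normal _ 1) => [|x]; first by meas.
  rewrite mul1r normrM; case: (x2le x) => h _; apply: le_trans h.
  by rewrite ler_piMr// sin_norm.
have st (u : R) : \int[gam]_x (x * sin (u * x + a)) = s ^+ 2 * (u * \int[gam]_x cos (u * x + a)).
  have dx (x : R) : is_derive x (1 : R) (fun x => sin (u * x + a)) (u * cos (u * x + a)).
    by apply: is_derive_eq; rewrite /GRing.scale/=; ring.
  rewrite (@stein _ (fun x => u * cos (u * x + a)) (1 + `|u|) dx) ?ExZ//.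
  - by cont.
  - move=> x; apply: (le_trans (sin_norm _)).
    by rewrite -[leLHS]mul1r ler_pM// lerDl.
  - move=> x; rewrite normrM; apply: (@le_trans _ _ (`|u| * 1)).
      by rewrite ler_wpM2l// cos_norm.
    by rewrite ler_pM// lerDr.
  - move=> x; rewrite normrM; apply: (@le_trans _ _ (`|x| * 1)).
      by rewrite ler_wpM2l// sin_norm.
    by rewrite mulr1 -[leLHS]mul1r ler_pM// ?lerDl//; case: (x2le x).
pose y u := \int[gam]_x cos (u * x + a).
have dy (u : R) : is_derive u (1 : R) y (- (s ^+ 2 * (u * y u))).
  rewrite -st -ExN//.
  apply: (@Ex_derive _ _ _ gam (fun u x => cos (u * x + a)) (fun u x => - (x * sin (u * x + a))) (fun x => `|x|)).
  - exact: Ic.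
  - apply: intg_norm; apply: (@intg_normal _ 1) => // x; rewrite mul1r; by case: (x2le x).
  - by move=> v x; apply: is_derive_eq; rewrite /GRing.scale/=; ring.
  - by move=> v x; rewrite normrN normrM ler_piMr// sin_norm.
pose z (u : R) := y u * expR (s ^+ 2 * u ^+ 2 / 2).
have dz (u : R) : is_derive u (1 : R) z 0.
  by have := dy u => ?; apply: is_derive_eq; rewrite /GRing.scale/=; field.
have zE : z t = z 0 by apply: is_derive_0_is_cst.
have y0 : y 0 = cos a.
  rewrite /y; under eq_Rintegral do rewrite mul0r add0r.
  rewrite Rintegral_cst// [X in fine X](_ : _ = 1%E) ?mulr1//; exact: integral_normal_pdf.
move: zE; rewrite /z y0 expr0n/= mulr0 mul0r expR0 mulr1 => <-.
by rewrite mulrCA -expRD [X in expR X](_ : _ = 0) ?expR0 ?mulr1//; ring.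
Qed.

End normal.

(** * The characteristic function of the square of a Gaussian variable *)

Section quadratic_phase.
Context {R : realType}.
Local Notation gam := (normal_prob (0 : R) 1).
Implicit Types (t x : R) (f : R -> R).

Let one0 : 0 < 1 :> R. Proof. exact: ltr01. Qed.
Let ge1 (x : R) : 1 <= 1 + x ^+ 4. Proof. by rewrite lerDl exprn_even_ge0. Qed.

(** [kc + i ks] is the mean of [exp (i t x^2)] under the standard Gaussian law, and [kc2 + i ks2]
    its derivative divided by [i]. *)
Definition kc t : R := \int[gam]_x cos (t * x ^+ 2).
Definition ks t : R := \int[gam]_x sin (t * x ^+ 2).
Definition kc2 t : R := \int[gam]_x (x ^+ 2 * cos (t * x ^+ 2)).
Definition ks2 t : R := \int[gam]_x (x ^+ 2 * sin (t * x ^+ 2)).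

Lemma intg_gam_bd f : measurable_fun setT f -> (forall x, `|f x| <= 1) -> gam.-intg f.
Proof. by move=> mf f1; apply: (@intg_normal _ 1 one0 _ 1) => // x; rewrite mul1r (le_trans (f1 x)). Qed.

Lemma intg_gam_sqr f : measurable_fun setT f -> (forall x, `|f x| <= 1) -> gam.-intg (fun x => x ^+ 2 * f x).
Proof.
move=> mf f1; apply: (@intg_normal _ 1 one0 _ 1) => [|x]; first by meas.
rewrite mul1r normrM (ger0_norm (sqr_ge0 _)); case: (x2le x) => _ [h _]; apply: le_trans h.
by rewrite ler_piMr// sqr_ge0.
Qed.

(** Stein's identity for [x cos (t x^2)]. *)
Lemma kc2E t : kc2 t = kc t - 2 * t * ks2 t.
Proof.
have dx (x : R) : is_derive x (1 : R) (fun x => x * cos (t * x ^+ 2)) (cos (t * x ^+ 2) - 2 * t * (x ^+ 2 * sin (t * x ^+ 2))).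
  by apply: is_derive_eq; rewrite /GRing.scale/=; ring.
rewrite /kc2 /kc /ks2 -ExZ; last by apply: intg_gam_sqr => [|x]; [meas|exact: sin_norm].
rewrite -ExB; [|by apply: intg_gam_bd => [|x]; [meas|exact: cos_norm]|]; last first.
  by apply: intgZ; apply: intg_gam_sqr => [|x]; [meas|exact: sin_norm].
under eq_Rintegral do rewrite expr2 -mulrA -expr2.
have h (x : R) : `|x * cos (t * x ^+ 2)| <= `|x| by rewrite normrM ler_piMr// cos_norm.
have t0 : 0 <= 2 * `|t| by rewrite mulr_ge0.
rewrite (@stein _ 1 one0 _ _ (1 + 2 * `|t|) dx) ?expr1n ?mul1r//.
- by move=> x; apply: cvgB; [move: x; cont|move: x; cont].
- move=> x; apply: (le_trans (h x)); case: (x2le x) => h1 _.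
  by apply: (le_trans h1); rewrite ler_peMl ?lerDl// (le_trans _ (ge1 x)).
- move=> x; apply: (le_trans (ler_normB _ _)). rewrite [leRHS]mulrDl; apply: lerD.
    by rewrite mul1r (le_trans (cos_norm _)).
  rewrite (normrM (2 * t)) (normrM 2) (normrM (x ^+ 2)) (ger0_norm (ler0n _ 2)) ler_wpM2l//.
  case: (x2le x) => _ [+ _]; apply: le_trans.
  by rewrite (ger0_norm (sqr_ge0 x)) ler_piMr ?sqr_ge0 ?sin_norm.
- move=> x; rewrite mulrA -expr2 normrM (ger0_norm (sqr_ge0 _)).
  case: (x2le x) => _ [h1 _]; apply: (@le_trans _ _ (x ^+ 2)).
    by rewrite ler_piMr ?sqr_ge0// cos_norm.
  by apply: (le_trans h1); rewrite ler_peMl ?lerDl// (le_trans _ (ge1 x)).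
Qed.

Lemma ks2E t : ks2 t = ks t + 2 * t * kc2 t.
Proof.
have dx (x : R) : is_derive x (1 : R) (fun x => x * sin (t * x ^+ 2)) (sin (t * x ^+ 2) + 2 * t * (x ^+ 2 * cos (t * x ^+ 2))).
  by apply: is_derive_eq; rewrite /GRing.scale/=; ring.
rewrite /ks2 /ks /kc2 -ExZ; last by apply: intg_gam_sqr => [|x]; [meas|exact: cos_norm].
rewrite -ExD; [|by apply: intg_gam_bd => [|x]; [meas|exact: sin_norm]|]; last first.
  by apply: intgZ; apply: intg_gam_sqr => [|x]; [meas|exact: cos_norm].
under eq_Rintegral do rewrite expr2 -mulrA -expr2.
have h (x : R) : `|x * sin (t * x ^+ 2)| <= `|x| by rewrite normrM ler_piMr// sin_norm.
have t0 : 0 <= 2 * `|t| by rewrite mulr_ge0.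
rewrite (@stein _ 1 one0 _ _ (1 + 2 * `|t|) dx) ?expr1n ?mul1r//.
- by cont.
- move=> x; apply: (le_trans (h x)); case: (x2le x) => h1 _.
  by apply: (le_trans h1); rewrite ler_peMl ?lerDl// (le_trans _ (ge1 x)).
- move=> x; apply: (le_trans (ler_normD _ _)); rewrite [leRHS]mulrDl; apply: lerD.
    by rewrite mul1r (le_trans (sin_norm _)).
  rewrite (normrM (2 * t)) (normrM 2) (normrM (x ^+ 2)) (ger0_norm (ler0n _ 2)) ler_wpM2l//.
  case: (x2le x) => _ [+ _]; apply: le_trans.
  by rewrite (ger0_norm (sqr_ge0 x)) ler_piMr ?sqr_ge0 ?cos_norm.
- move=> x; rewrite mulrA -expr2 normrM (ger0_norm (sqr_ge0 _)).
  case: (x2le x) => _ [h1 _]; apply: (@le_trans _ _ (x ^+ 2)).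
    by rewrite ler_piMr ?sqr_ge0// sin_norm.
  by apply: (le_trans h1); rewrite ler_peMl ?lerDl// (le_trans _ (ge1 x)).
Qed.

(** The mean of [exp (i t x^2)] is [(1 - 2 i t)^(-1/2)].  Only its modulus matters, and the relations
    [kc2E] and [ks2E] say that the left-hand side has derivative zero in [t]. *)
Lemma kappa_modulus t : (kc t ^+ 2 + ks t ^+ 2) ^+ 2 * (1 + 4 * t ^+ 2) = 1.
Proof.
have Ix2 : gam.-intg (fun x => x ^+ 2).
  have := @intg_gam_sqr (cst 1) (@measurable_cst _ _ _ _ _ _) (fun=> ltac:(by rewrite normr1)).
  by under eq_fun do rewrite mulr1.
have dc (u : R) : is_derive u (1 : R) kc (- ks2 u).
  rewrite /ks2 -ExN; last by apply: intg_gam_sqr => [|x]; [meas|exact: sin_norm].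
  apply: (@Ex_derive _ _ _ gam (fun u x => cos (u * x ^+ 2)) (fun u x => - (x ^+ 2 * sin (u * x ^+ 2))) (fun x => x ^+ 2)) => //.
  - by move=> v; apply: intg_gam_bd => [|x]; [meas|exact: cos_norm].
  - by move=> v x; apply: is_derive_eq; rewrite /GRing.scale/=; ring.
  - by move=> v x; rewrite normrN normrM (ger0_norm (sqr_ge0 _)) ler_piMr ?sqr_ge0 ?sin_norm.
have ds (u : R) : is_derive u (1 : R) ks (kc2 u).
  apply: (@Ex_derive _ _ _ gam (fun u x => sin (u * x ^+ 2)) (fun u x => (x ^+ 2 * cos (u * x ^+ 2))) (fun x => x ^+ 2)) => //.
  - by move=> v; apply: intg_gam_bd => [|x]; [meas|exact: sin_norm].
  - by move=> v x; apply: is_derive_eq; rewrite /GRing.scale/=; ring.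
  - by move=> v x; rewrite normrM (ger0_norm (sqr_ge0 _)) ler_piMr ?sqr_ge0 ?cos_norm.
pose z (u : R) := (kc u ^+ 2 + ks u ^+ 2) ^+ 2 * (1 + 4 * u ^+ 2).
have dz (u : R) : is_derive u (1 : R) z 0.
  have := dc u; have := ds u => ? ?; apply: is_derive_eq; rewrite /GRing.scale/=.
  have := kc2E u; have := ks2E u.
  set A := kc2 u; set B := ks2 u; set C := kc u; set S := ks u => hB hA.
  have -> : C = A + 2 * u * B by lra.
  have -> : S = B - 2 * u * A by lra.
  ring.
have z1 : z 0 = 1.
  rewrite /z /kc /ks.
  under eq_Rintegral do rewrite mul0r cos0.
  under [X in _ + X ^+ 2]eq_Rintegral do rewrite mul0r sin0.
  rewrite !Rintegral_cst// [X in fine X](_ : _ = 1%E); last exact: integral_normal_pdf.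
  by rewrite /= mul0r; ring.
exact: (etrans (@is_derive_0_is_cst _ z t 0 dz) z1).
Qed.

End quadratic_phase.

(** * Arctangent smoothing of distribution functions *)

Section poisson_kernel.
Context {R : realType}.
Local Notation leb := (@lebesgue_measure R).
Implicit Types b e t : R.

(** Up to the factor pi, the Poisson kernel of the upper half plane; it is the density that
    smooths an indicator of a half line into an arctangent. *)
Definition poisson e (x : R) := e / (e ^+ 2 + x ^+ 2).

Lemma poisson_denom_gt0 e x : 0 < e -> 0 < e ^+ 2 + x ^+ 2.
Proof. by move=> e0; rewrite ltr_wpDr ?sqr_ge0// exprn_gt0. Qed.

Lemma poisson_ge0 e x : 0 < e -> 0 <= poisson e x.
Proof. by move=> e0; rewrite divr_ge0 ?ltW// poisson_denom_gt0. Qed.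

Lemma poisson_le e x : 0 < e -> poisson e x <= e^-1.
Proof.
move=> e0; rewrite ler_pdivrMr ?poisson_denom_gt0// mulrDr.
by rewrite expr2 mulrA mulVf ?gt_eqF// mul1r lerDl mulr_ge0 ?invr_ge0 ?sqr_ge0// ltW.
Qed.

Lemma measurable_poisson e d (T : measurableType d) (f : T -> R) : 0 < e ->
  measurable_fun setT f -> measurable_fun setT (fun x => poisson e (f x)).
Proof.
move=> e0 mf; apply: (measurableT_comp _ mf) => //.
apply: continuous_measurable_fun => x; apply: cvgM; first exact: cvg_cst.
apply: cvgV; first by rewrite gt_eqF ?poisson_denom_gt0.
by apply: cvgD; [exact: cvg_cst|exact: exprn_continuous].
Qed.

Local Notation w := (@exponential_pdf R).

Lemma poisson_fourier e x : 0 < e ->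
  \int[leb]_t (cos (t * x) * w e t) = e * poisson e x.
Proof.
move=> e0; have d0 := poisson_denom_gt0 x e0.
have cf : continuous (fun t : R => cos (t * x) * (e * expR (- e * t))).
  apply: continuousM_comp; first by cont.
  apply: continuousM_comp; first by cont.
  by move=> t; apply: continuous_comp; [apply: cvgM; [exact: cvg_cst|exact: cvg_id]|exact: continuous_expR].
have I : leb.-intg (fun t => cos (t * x) * w e t).
  apply: (@intgMbd _ _ _ leb 1); [by meas|by move=> t; exact: cos_norm|].
  exact: integrable_exponential_pdf.
have E : (fun t => cos (t * x) * w e t) = (fun t => cos (t * x) * (e * expR (- e * t))) \_ `[0, +oo[.
  by apply/funext => t; rewrite /exponential_pdf !patchE; case: ifPn; rewrite ?mulr0.
rewrite E -Rintegral_mkcond.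
have dF t : is_derive t (1 : R) (fun t => e * expR (- e * t) * ((x * sin (t * x) - e * cos (t * x)) / (e ^+ 2 + x ^+ 2)))
   (cos (t * x) * (e * expR (- e * t))).
  apply: is_derive_eq; rewrite /GRing.scale/=; field; exact: lt0r_neq0.
apply: (Rintegral_FTC_ray dF cf).
  apply: (integrable_mkcond _ _).2 => //; rewrite E in I.
  by apply: eq_integrable I => // t _; rewrite /= restrict_EFin.
rewrite mul0r sin0 cos0 !mulr0 expR0 !mulr1 sub0r.
rewrite /poisson -[X in _ --> X]add0r; apply: cvgD; last first.
  by rewrite [X in X @ _](_ : _ = cst (e * (e / (e ^+ 2 + x ^+ 2)))); [exact: cvg_cst|
    apply/funext => n; rewrite /= mulNr mulrN opprK].
apply: (@cvg0_le _ _ (fun n : nat => e * ((`|x| + e) / (e ^+ 2 + x ^+ 2)) * expR (- (e * n.+1%:R)))).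
  move=> n; rewrite mulNr; set E' := expR _.
  have E0 : 0 < E' by exact: expR_gt0.
  rewrite normrM normrM (gtr0_norm e0) (gtr0_norm E0) mulrAC.
  apply: ler_wpM2r; first exact: ltW.
  apply: ler_wpM2l; first exact: ltW.
  rewrite normrM (gtr0_norm (_ : 0 < (e ^+ 2 + x ^+ 2)^-1)) ?invr_gt0//.
  apply: ler_wpM2r; first by rewrite invr_ge0 ltW.
  apply: (le_trans (ler_normB _ _)); apply: lerD; rewrite normrM.
    by rewrite ler_piMr// sin_norm.
  by rewrite (gtr0_norm e0) ler_piMr ?cos_norm// ltW.
rewrite -[X in _ --> X](mulr0 (e * ((`|x| + e) / (e ^+ 2 + x ^+ 2)))).
apply: cvgM; first exact: cvg_cst.
apply: (@cvg_comp _ _ _ (fun n : nat => e * (n.+1%:R : R)) (fun x => expR (- x))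
   _ (pinfty_nbhs R) _ _ (@cvgr_expR R)).
apply/cvgryPge => A; near=> n.
rewrite -ler_pdivrMl//; apply: (@le_trans _ _ n%:R); last by rewrite ler_nat.
by near: n; exact: nbhs_infty_ger.
Unshelve. all: by end_near. Qed.

Variables (d : measure_display) (T : measurableType d) (P : {finite_measure set T -> \bar R}).
Implicit Types X u : T -> R.

(** Fubini's theorem, with the Poisson kernel written as the cosine transform of the exponential
    law of rate [e]. *)
Lemma Ex_poisson e b X u : 0 < e -> measurable_fun setT X -> P.-intg u ->
  leb.-intg (fun t => (\int[P]_x (cos (t * (b - X x)) * u x)) * w e t) /\
  e * \int[P]_x (poisson e (b - X x) * u x) =
  \int[leb]_t ((\int[P]_x (cos (t * (b - X x)) * u x)) * w e t).
Proof.
move=> e0 mX Iu; have mu := intg_meas Iu.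
have mw : measurable_fun setT (w e) by exact: measurable_exponential_pdf.
pose f (z : T * measurableTypeR R) := cos (z.2 * (b - X z.1)) * u z.1 * w e z.2.
have mf : measurable_fun setT f.
  apply: measurable_funM; last by apply: measurableT_comp.
  apply: measurable_funM; last by apply: measurableT_comp.
  apply: measurable_cos; apply: measurable_funM => //.
  by apply: measurable_funB => //; apply: measurableT_comp.
have Iw : leb.-intg (w e) by exact: integrable_exponential_pdf.
have mEf : measurable_fun setT (EFin \o f) by exact/measurable_EFinP.
have If : (P \x leb)%E.-integrable setT (EFin \o f).
  apply/integrable12ltyP; first exact/measurable_EFinP.
  have h x : (\int[leb]_t `|(EFin \o f) (x, t)| <= \int[leb]_t (`|u x| * w e t)%:E)%E.
    apply: ge0_le_integral => //.
    - by apply/measurable_EFinP; apply: measurableT_comp => //; apply: measurableT_comp mf _.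
    - by apply/measurable_EFinP; apply: measurable_funM.
    - move=> t _ /=; rewrite lee_fin /f /= !normrM (ger0_norm (exponential_pdf_ge0 (ltW e0) _)).
      apply: ler_wpM2r; first by rewrite exponential_pdf_ge0// ltW.
      by rewrite ler_piMl// cos_norm.
  apply: (@le_lt_trans _ _ (\int[P]_x (`|u x|%:E))%E).
    apply: ge0_le_integral => //.
    + by move=> x _; apply: integral_ge0.
    + apply: (measurable_fun_fubini_tonelli_F (abse \o (EFin \o f))) => [|z].
        exact: (measurableT_comp _ mEf).
      exact: abse_ge0.
    + by apply/measurable_EFinP; exact: measurableT_comp.
    + move=> x _; apply: (le_trans (h x)).
      rewrite EFin_Ex ?ExZ//; last exact: intgZ.
      by rewrite /Rintegral integral_exponential_pdf//= mulr1.
  by case/integrableP: Iu.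
have Iuw x : leb.-intg (fun t => cos (t * (b - X x)) * w e t).
  by apply: (@intgMbd _ _ _ leb 1) => //; [meas|move=> t; exact: cos_norm].
have Icu t : P.-intg (fun x => cos (t * (b - X x)) * u x).
  by apply: (@intgMbd _ _ _ P 1) => //; [meas|move=> x; exact: cos_norm].
have fub := Fubini If.
have E1 : (\int[P]_x \int[leb]_t (f (x, t))%:E = \int[P]_x (e * (poisson e (b - X x) * u x))%:E)%E.
  apply: eq_integral => x _.
  rewrite (_ : (fun t => (f (x, t))%:E) = (fun t => (u x * (cos (t * (b - X x)) * w e t))%:E)); last first.
    by apply/funext => t; rewrite /f/=; congr EFin; ring.
  rewrite EFin_Ex; last exact: intgZ.
  by rewrite ExZ// poisson_fourier//; congr EFin; ring.
have E2 t : (\int[P]_x (f (x, t))%:E = ((\int[P]_x (cos (t * (b - X x)) * u x)) * w e t)%:E)%E.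
  rewrite (_ : (fun x => (f (x, t))%:E) = (fun x => (w e t * (cos (t * (b - X x)) * u x))%:E)); last first.
    by apply/funext => x; rewrite /f/=; congr EFin; ring.
  rewrite EFin_Ex; last exact: intgZ.
  by rewrite ExZ// mulrC.
split.
  have mG := measurable_fubini_G If.
  apply: (@intg_le _ _ _ leb _ (fun t => (\int[P]_x `|u x|) * w e t)); last exact: intgZ.
    apply/measurable_EFinP; apply: eq_measurable_fun mG => t _; exact: E2.
  move=> t; rewrite normrM (ger0_norm (exponential_pdf_ge0 (ltW e0) _)).
  apply: ler_wpM2r; first exact: exponential_pdf_ge0 (ltW e0) _.
  apply: (le_trans (Ex_norm (Icu t))); apply: Ex_le; [exact: intg_norm|exact: intg_norm|].
  by move=> x; rewrite normrM ler_piMl// cos_norm.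
rewrite -ExZ; last first.
  apply: (@intgMbd _ _ _ P e^-1) => //; first by apply: measurable_poisson => //; meas.
  by move=> x; rewrite ger0_norm ?poisson_ge0// poisson_le.
by rewrite /Rintegral -E1 fub; congr fine; apply: eq_integral => t _; exact: E2.
Qed.

(** A uniform bound on the Fourier transform of the signed law of [X] under [u], at all phases,
    bounds its smoothed density by the integral of that bound. *)
Lemma Ex_poisson_bound e b X u (K : R -> R) M : 0 < e -> measurable_fun setT X -> P.-intg u ->
  (forall t a, 0 <= t -> `|\int[P]_x (cos (t * X x + a) * u x)| <= K t) ->
  leb.-integrable `[0, +oo[ (EFin \o K) -> \int[leb]_(t in `[0, +oo[) K t <= M ->
  `|\int[P]_x (poisson e (b - X x) * u x)| <= M.
Proof.
move=> e0 mX Iu Kb IK KM.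
have [I0 E0] := Ex_poisson b e0 mX Iu.
rewrite -(ler_pM2l e0) -[X in X * `|_|](gtr0_norm e0) -normrM E0.
have mw : measurable_fun setT (w e) by exact: measurable_exponential_pdf.
have IKT : leb.-intg (K \_ `[0, +oo[).
  have := (integrable_mkcond _ _).1 IK; move=> /(_ ltac:(by [])).
  by apply: eq_integrable => // x _; rewrite /= restrict_EFin.
have b1 t : `|(\int[P]_x (cos (t * (b - X x)) * u x)) * w e t| <= e * (K \_ `[0, +oo[) t.
  have [t0|t0] := ltP t 0.
    rewrite lt0_exponential_pdf// mulr0 normr0 patchE ifF ?mulr0//.
    by apply/negP; rewrite inE/= in_itv/= andbT leNgt t0.
  rewrite patchE ifT; last by rewrite inE/= in_itv/= andbT.
  rewrite normrM mulrC (ger0_norm (exponential_pdf_ge0 (ltW e0) _)).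
  apply: ler_pM => //; first exact: exponential_pdf_ge0 (ltW e0) _.
    rewrite exponential_pdfE//; apply: ler_piMr; first exact: ltW.
    by rewrite -expR0 ler_expR mulNr oppr_le0 mulr_ge0// ltW.
  have -> : \int[P]_x (cos (t * (b - X x)) * u x) = \int[P]_x (cos (t * X x - t * b) * u x).
    by apply: eq_Rintegral => x _; rewrite -cosN; congr (cos _ * _); ring.
  exact: Kb.
apply: (le_trans (Ex_norm I0)).
apply: (@le_trans _ _ (\int[leb]_t (e * (K \_ `[0, +oo[) t))).
  by apply: Ex_le => //; [exact: intg_norm|exact: intgZ].
by rewrite ExZ// -Rintegral_mkcond ler_pM2l.
Qed.
End poisson_kernel.

Section arctan_smoothing.
Context {R : realType}.
Implicit Types b e t : R.

Lemma atan_norm (x : R) : `|atan x| <= pi / 2.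
Proof. by rewrite ler_norml ltW ?atan_gtNpi2// ltW ?atan_ltpi2. Qed.

Lemma measurable_atan d (T : measurableType d) (f : T -> R) :
  measurable_fun setT f -> measurable_fun setT (fun x => atan (f x)).
Proof.
move=> mf; apply: (measurableT_comp _ mf); apply: continuous_measurable_fun => x.
exact: continuous_atan.
Qed.

Lemma is_derive_atan_scale e (x : R) : 0 < e -> is_derive x (1 : R) (fun y : R => atan (y / e)) (poisson e x).
Proof.
move=> e0; apply: is_derive_eq; rewrite /GRing.scale/= /poisson; field.
by rewrite !gt_eqF//; rewrite ?poisson_denom_gt0//; nra.
Qed.

Section increment.
Context {d} {T : measurableType d} (P : {finite_measure set T -> \bar R}).
Implicit Types X Y U G : T -> R.

Lemma intg_atan e b X : measurable_fun setT X -> P.-intg (fun w => atan ((b - X w) / e)).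
Proof.
by move=> mX; apply: (@intg_bd _ _ _ P (pi / 2)) => [|w]; [apply: measurable_atan; meas|exact: atan_norm].
Qed.

(** Mean value theorem along the segment from [U] to [U + G]. *)
Lemma atan_increment e b U G (M : R) : 0 < e -> measurable_fun setT U -> P.-intg G ->
  (forall s : R, 0 <= s <= 1 -> `|\int[P]_w (poisson e (b - (U w + s * G w)) * G w)| <= M) ->
  `|\int[P]_w atan ((b - (U w + G w)) / e) - \int[P]_w atan ((b - U w) / e)| <= M.
Proof.
move=> e0 mU IG hM; have mG := intg_meas IG.
pose phi (s : R) := \int[P]_w atan ((b - (U w + s * G w)) / e).
have dphi (s : R) : is_derive s (1 : R) phi (\int[P]_w (- (poisson e (b - (U w + s * G w)) * G w))).
  apply: (@Ex_derive _ _ _ P (fun s w => atan ((b - (U w + s * G w)) / e))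
     (fun s w => - (poisson e (b - (U w + s * G w)) * G w)) (fun w => e^-1 * `|G w|)).
  - by move=> u; apply: intg_atan; meas.
  - exact/intgZ/intg_norm.
  - move=> u w; have := @is_derive_atan_scale e (b - (U w + u * G w)) e0 => h.
    have k : is_derive u (1 : R) (fun u => b - (U w + u * G w)) (- G w).
      by apply: is_derive_eq; rewrite /GRing.scale/=; ring.
    by have := @is_derive1_comp R (fun y => atan (y / e)) (fun u => b - (U w + u * G w)) u _ _ h k; rewrite mulrN.
  - move=> u w; rewrite normrN normrM ger0_norm ?poisson_ge0//.
    by apply: ler_wpM2r => //; exact: poisson_le.
have [s s01] := @MVT R phi _ 0 1 ltr01 (fun x _ => dphi x)
  (continuous_subspaceT (is_derive_continuous dphi)).
rewrite subr0 mulr1 => h.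
have -> : \int[P]_w atan ((b - (U w + G w)) / e) = phi 1.
  by apply: eq_Rintegral => w _; rewrite mul1r.
have -> : \int[P]_w atan ((b - U w) / e) = phi 0.
  by apply: eq_Rintegral => w _; rewrite mul0r addr0.
rewrite h ExN ?normrN; last first.
  apply: (@intgMbd _ _ _ P e^-1) => //; first by apply: measurable_poisson => //; meas.
  by move=> w; rewrite ger0_norm ?poisson_ge0// poisson_le.
by apply: hM; move: s01; rewrite in_itv/= => /andP[? ?]; rewrite !ltW.
Qed.

End increment.

(** The shift by [1 / n] to the right, large compared with the scale [1 / n^2], makes the limit include
    the end point [b]. *)
Lemma atan_step_cvg b (x : R) :
  atan ((b + n.+1%:R^-1 - x) / (n.+1%:R ^+ 2)^-1) @[n --> \oo] --> pi * \1_`]-oo, b]%classic x - pi / 2.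
Proof.
have c1 : atan (n.+1%:R : R) @[n --> \oo] --> (pi / 2 : R).
  apply: (@cvg_comp _ _ _ (fun n : nat => n.+1%:R) (@atan R) _ (pinfty_nbhs R) _ _ (@cvgy_atan R)).
  apply/cvgryPge => A; near=> n.
  apply: (@le_trans _ _ n%:R); last by rewrite ler_nat.
  by near: n; exact: nbhs_infty_ger.
rewrite indicE; have [xb|xb] := leP x b.
  rewrite mem_set/=; last by rewrite in_itv/=.
  have -> : pi * 1%:R - pi / 2 = pi / 2 :> R by rewrite mulr1; field.
  apply: squeeze_cvgr c1 (cvg_cst _); apply: nearW => n.
  rewrite (ltW (atan_ltpi2 _)) andbT le_atan// invrK.
  have n0 : 0 < n.+1%:R :> R by rewrite ltr0n.
  have -> : (b + n.+1%:R^-1 - x) * n.+1%:R ^+ 2 = n.+1%:R + (b - x) * n.+1%:R ^+ 2 :> R by field; rewrite gt_eqF.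
  by rewrite lerDl mulr_ge0 ?subr_ge0// sqr_ge0.
rewrite memNset/=; last by rewrite in_itv/= leNgt xb.
have -> : pi * 0%:R - pi / 2 = - (pi / 2) :> R by rewrite mulr0 sub0r.
have c2 : - atan (n.+1%:R : R) @[n --> \oo] --> - (pi / 2 : R) by exact: cvgN c1.
apply: squeeze_cvgr (cvg_cst _) c2; near=> n.
rewrite (ltW (atan_gtNpi2 _)) /= -atanN le_atan// invrK.
have n0 : 0 < n.+1%:R :> R by rewrite ltr0n.
have -> : (b + n.+1%:R^-1 - x) * n.+1%:R ^+ 2 = n.+1%:R * (1 - (x - b) * n.+1%:R) :> R by field; rewrite gt_eqF.
rewrite -[leRHS]mulrN1 ler_pM2l// lerBlDr -lerBlDl opprK.
have xb0 : 0 < x - b by rewrite subr_gt0.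
rewrite -ler_pdivrMl//; apply: (@le_trans _ _ n%:R); last by rewrite ler_nat.
by near: n; exact: nbhs_infty_ger.
Unshelve. all: by end_near. Qed.

Lemma Ex_atan_step d (T : measurableType d) (P : {finite_measure set T -> \bar R}) (X : T -> R) b :
  measurable_fun setT X ->
  \int[P]_w atan ((b + n.+1%:R^-1 - X w) / (n.+1%:R ^+ 2)^-1) @[n --> \oo] -->
  pi * fine (P (X @^-1` `]-oo, b])) - pi / 2 * fine (P setT).
Proof.
move=> mX; have mA : measurable (X @^-1` `]-oo, b]) by rewrite -[X @^-1` _]setTI; exact: mX.
have [|n w|_] := @Ex_cvg _ _ _ P (fun n w => atan ((b + n.+1%:R^-1 - X w) / (n.+1%:R ^+ 2)^-1)) _ (fun=> pi / 2)
   _ (intg_cst _ _) (fun w => @atan_step_cvg b (X w)).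
- by move=> n; apply: measurable_atan; meas.
- exact: atan_norm.
congr (_ --> _).
have I1 : P.-intg (\1_(X @^-1` `]-oo, b])).
  by apply: (@intg_bd _ _ _ P 1) => // w; rewrite indicE; case: (_ \in _); rewrite ?normr1 ?normr0.
rewrite (_ : \int[P]_w _ = \int[P]_w (pi * \1_(X @^-1` `]-oo, b]) w - pi / 2)); last exact: eq_Rintegral.
rewrite ExB; [rewrite ExZ// Rintegral_cst//|exact: intgZ|exact: intg_cst].
by rewrite {1}/Rintegral integral_indic// setIT.
Qed.

(** Smoothed distribution functions converge to the distribution functions, at every point and not
    only at continuity points, by the choice of the shift in [atan_step_cvg]. *)
Lemma cdf_from_atan d1 d2 (T1 : measurableType d1) (T2 : measurableType d2)
  (P : {finite_measure set T1 -> \bar R}) (Q : {finite_measure set T2 -> \bar R})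
  (X : T1 -> R) (Y : T2 -> R) b M :
  measurable_fun setT X -> measurable_fun setT Y -> fine (P setT) = fine (Q setT) ->
  (forall e b, 0 < e -> `|\int[P]_w atan ((b - X w) / e) - \int[Q]_w atan ((b - Y w) / e)| <= pi * M) ->
  `|fine (P (X @^-1` `]-oo, b])) - fine (Q (Y @^-1` `]-oo, b]))| <= M.
Proof.
move=> mX mY mPQ h.
set lX := pi * fine (P (X @^-1` `]-oo, b])) - pi / 2 * fine (P setT).
set lY := pi * fine (Q (Y @^-1` `]-oo, b])) - pi / 2 * fine (Q setT).
have c : `|\int[P]_w atan ((b + n.+1%:R^-1 - X w) / (n.+1%:R ^+ 2)^-1) -
    \int[Q]_w atan ((b + n.+1%:R^-1 - Y w) / (n.+1%:R ^+ 2)^-1)| @[n --> \oo] --> `|lX - lY|.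
  by apply: cvg_norm; apply: cvgB; exact: Ex_atan_step.
rewrite -(ler_pM2l (pi_gt0 R)) -[X in X * `|_|](gtr0_norm (pi_gt0 R)) -normrM.
rewrite (_ : pi * (_ - _) = lX - lY); last by rewrite /lX /lY mPQ; ring.
apply: (cvgr_to_le c); apply: nearW => n; apply: h.
by rewrite invr_gt0 exprn_gt0.
Qed.

(** A finite measure on the line is determined by its Fourier transform: the smoothed
    distribution functions have the same derivative, and the same limit at minus infinity. *)
Lemma fourier_unique_cdf d1 d2 (T1 : measurableType d1) (T2 : measurableType d2)
  (P : {finite_measure set T1 -> \bar R}) (Q : {finite_measure set T2 -> \bar R})
  (X : T1 -> R) (Y : T2 -> R) :
  measurable_fun setT X -> measurable_fun setT Y ->
  (forall t a, \int[P]_w cos (t * X w + a) = \int[Q]_w cos (t * Y w + a)) ->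
  forall b, P (X @^-1` `]-oo, b]) = Q (Y @^-1` `]-oo, b]).
Proof.
move=> mX mY ft b.
have mPQ : fine (P setT) = fine (Q setT).
  have := ft 0 0; under eq_Rintegral do rewrite mul0r addr0 cos0.
  under [RHS]eq_Rintegral do rewrite mul0r addr0 cos0.
  by rewrite !Rintegral_cst// !mul1r.
have mA : measurable (X @^-1` `]-oo, b]) by rewrite -[X @^-1` _]setTI; exact: mX.
have mB : measurable (Y @^-1` `]-oo, b]) by rewrite -[Y @^-1` _]setTI; exact: mY.
suff : `|fine (P (X @^-1` `]-oo, b])) - fine (Q (Y @^-1` `]-oo, b]))| <= 0.
  rewrite normr_le0 subr_eq0 => /eqP h.
  by rewrite -(fineK (fin_num_measure P _ mA)) -(fineK (fin_num_measure Q _ mB)) h.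
apply: cdf_from_atan => // e {mA mB}b e0; rewrite mulr0 normr_le0; apply/eqP.
pose y (v : R) := \int[P]_w atan ((v - X w) / e) - \int[Q]_w atan ((v - Y w) / e).
have pE (v : R) : \int[P]_w (poisson e (v - X w)) = \int[Q]_w (poisson e (v - Y w)).
  apply: (mulfI (lt0r_neq0 e0)).
  have [_] := Ex_poisson v e0 mX (intg_cst P 1).
  under eq_Rintegral do rewrite mulr1.
  move=> ->; have [_] := Ex_poisson v e0 mY (intg_cst Q 1).
  under eq_Rintegral do rewrite mulr1.
  move=> ->; apply: eq_Rintegral => t _; congr (_ * _).
  under eq_Rintegral do rewrite mulr1.
  under [RHS]eq_Rintegral do rewrite mulr1.
  have := ft (- t) (t * v).
  under eq_Rintegral do rewrite mulNr addrC -mulrBr.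
  by under [RHS]eq_Rintegral do rewrite mulNr addrC -mulrBr.
have dI d (T : measurableType d) (m : {finite_measure set T -> \bar R}) (Z : T -> R) (v : R) :
   measurable_fun setT Z -> is_derive v (1 : R) (fun v => \int[m]_w atan ((v - Z w) / e)) (\int[m]_w (poisson e (v - Z w))).
  move=> mZ; apply: (@Ex_derive _ _ _ m (fun b w => atan ((b - Z w) / e))
     (fun b w => poisson e (b - Z w)) (fun w => e^-1)).
  - by move=> u; apply: intg_atan.
  - exact: intg_cst.
  - move=> u w; have h := @is_derive_atan_scale e (u - Z w) e0.
    have k : is_derive u (1 : R) (fun u => u - Z w) 1.
      by apply: is_derive_eq; rewrite subr0.
    by have := @is_derive1_comp R (fun y => atan (y / e)) (fun u => u - Z w) u _ _ h k; rewrite mulr1.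
  - by move=> u w; rewrite ger0_norm ?poisson_ge0// poisson_le.
have dy (v : R) : is_derive v (1 : R) y 0.
  have := dI _ _ P X v mX; have := dI _ _ Q Y v mY => h1 h2.
  have := is_deriveB h2 h1; by rewrite pE subrr.
have lim d (T : measurableType d) (m : {finite_measure set T -> \bar R}) (Z : T -> R) :
   measurable_fun setT Z -> \int[m]_w atan ((- n%:R - Z w) / e) @[n --> \oo] --> - (pi / 2) * fine (m setT).
  move=> mZ.
  have [|w|n w|_] := @Ex_cvg _ _ _ m (fun n w => atan ((- n%:R - Z w) / e)) (fun=> - (pi / 2)) (fun=> pi / 2)
   _ (intg_cst _ _).
  - by move=> n; apply: measurable_atan; meas.
  - have c1 : atan ((n%:R + Z w) / e) @[n --> \oo] --> (pi / 2 : R).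
      apply: (@cvg_comp _ _ _ (fun n : nat => (n%:R + Z w) / e) (@atan R) _ (pinfty_nbhs R) _ _ (@cvgy_atan R)).
      apply/cvgryPge => A; near=> n.
      rewrite ler_pdivlMr// -lerBlDr.
      by near: n; exact: nbhs_infty_ger.
    under eq_fun do rewrite -opprD mulNr atanN.
    exact: cvgN c1.
  - exact: atan_norm.
  by rewrite Rintegral_cst.
have ylim : y (- n%:R) @[n --> \oo] --> (0 : R).
  rewrite -(subrr (- (pi / 2) * fine (P setT))) {2}mPQ.
  by apply: cvgB; exact: lim.
rewrite -[LHS]/(y b).
apply: (cvg_unique _ _ ylim) => //.
by apply: cvg_near_cst; apply: nearW => n; exact: (is_derive_0_is_cst (- n%:R) b dy).
Unshelve. all: by end_near. Qed.

End arctan_smoothing.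

(** * Independence from characteristic functions *)

Section weighted_law.
Context {d d'} {T : measurableType d} {T' : measurableType d'} {R : realType}.
Variables (P : {measure set T -> \bar R}) (X : T -> T') (u : T -> R).
Hypotheses (mX : measurable_fun setT X) (u0 : forall x, 0 <= u x) (iu : P.-intg u).

(** The law of [X] under the measure with density [u].  The proofs are arguments of the definition, so
    that the measure structure can be attached to it. *)
Definition weighted_law of measurable_fun setT X & (forall x, 0 <= u x) & P.-intg u :=
  fun A : set T' => (\int[P]_(x in X @^-1` A) (u x)%:E)%E.

Local Notation wl := (weighted_law mX u0 iu).

Let wl0 : wl set0 = 0%E. Proof. by rewrite /weighted_law preimage_set0 integral_set0. Qed.

Let wl_ge0 A : (0 <= wl A)%E.
Proof. by apply: integral_ge0 => x _; rewrite lee_fin. Qed.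

Let mXA A : measurable A -> measurable (X @^-1` A).
Proof. by move=> mA; rewrite -[X @^-1` A]setTI; exact: mX. Qed.

Let wl_sigma_additive : semi_sigma_additive wl.
Proof.
move=> A mA tA mUA; rewrite /weighted_law preimage_bigcup integral_bigcup//=.
- by apply: is_cvg_ereal_nneg_natsum_cond => n _ _; exact: wl_ge0.
- apply/trivIsetP => i j _ _ ij; rewrite -preimage_setI.
  by move/trivIsetP : tA => /(_ i j Logic.I Logic.I ij) ->; rewrite preimage_set0.
- by move=> n; exact: mXA.
- by apply: (integrableS _ _ (subsetT _)) => //; rewrite -preimage_bigcup; exact: mXA.
Qed.

HB.instance Definition _ := isMeasure.Build _ _ _ wl wl0 wl_ge0 wl_sigma_additive.

Let wl_fin : fin_num_fun wl.
Proof.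
move=> A mA; apply: integrable_fin_num; first exact: mXA.
by apply: (integrableS _ _ (subsetT _)) => //; exact: mXA.
Qed.

HB.instance Definition _ := @Measure_isFinite.Build _ _ _ wl wl_fin.

End weighted_law.

Section unique.
Context {R : realType}.

Lemma measure_eq_of_cdf (m1 m2 : {finite_measure set (measurableTypeR R) -> \bar R}) :
  (forall b, m1 `]-oo, b]%classic = m2 `]-oo, b]%classic) ->
  forall A, measurable A -> m1 A = m2 A.
Proof.
move=> h; apply: (@measure_unique _ _ (measurableTypeR R) (@ocitv R) (fun n => `](- n%:R), n%:R]%classic)) => //.
- exact: ocitvI.
- by move=> n; exact: is_ocitv.
- rewrite -subTset => x _; exists (Num.truncn `|x|).+1 => //=.
  rewrite in_itv/=; have : `|x| < (Num.truncn `|x|).+1%:R by exact: Num.Theory.truncnS_gt.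
  by rewrite ltr_norml => /andP[-> /ltW].
- move=> A /ocitvP[->|[[a b] /= ab ->]]; first by rewrite !measure0.
  have -> : `]a, b]%classic = `]-oo, b]%classic `\` `]-oo, a]%classic :> set R.
    by rewrite -[RHS]setCK setCD setCitvl setUC -[LHS]setCK setCitv.
  have S : `]-oo, b]%classic `&` `]-oo, a]%classic = `]-oo, a]%classic :> set R.
    by rewrite setIidr//; apply: subset_itvl; rewrite bnd_simp ltW.
  have fin (m : {finite_measure set (measurableTypeR R) -> \bar R}) : (m `]-oo, b]%classic < +oo)%E.
    by rewrite -ge0_fin_numE//; exact: fin_num_measure.
  rewrite !measureD// ?S; [|exact: fin|exact: fin].
  exact: (congr2 (fun x y => (x - y)%E) (h b) (h a)).
- by move=> k; rewrite -ge0_fin_numE//; exact: fin_num_measure.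
Qed.

Local Notation gam := (normal_prob (0 : R) 1).

(** The law of [X] under the density [u] and a multiple of the Gaussian law have the same Fourier
    transform, hence are equal. *)
Lemma gauss_factor d (T : measurableType d) (P : {finite_measure set T -> \bar R}) (X u : T -> R) :
  measurable_fun setT X -> (forall x, 0 <= u x) -> P.-intg u ->
  (forall t a, \int[P]_w (cos (t * X w + a) * u w) = expR (- (t ^+ 2 / 2)) * cos a * \int[P]_w u w) ->
  forall f : R -> R, gam.-intg f ->
  P.-intg (fun w => f (X w) * u w) /\ \int[P]_w (f (X w) * u w) = \int[gam]_x f x * \int[P]_w u w.
Proof.
move=> mX u0 iu ft f If; have mf := intg_meas If; have mu := intg_meas iu.
set c := \int[P]_w u w.
have c0 : 0 <= c by apply: Rintegral_ge0.
have Ic : gam.-intg (cst c) by exact: intg_cst.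
have mX' : measurable_fun setT (X : T -> measurableTypeR R) by exact: mX.
have midR : measurable_fun setT (idfun : measurableTypeR R -> measurableTypeR R) by exact: measurable_id.
have c0' (x : measurableTypeR R) : 0 <= (cst c : measurableTypeR R -> R) x by [].
pose m1 : {finite_measure set (measurableTypeR R) -> \bar R} := weighted_law mX' u0 iu.
pose m2 : {finite_measure set (measurableTypeR R) -> \bar R} := weighted_law midR c0' Ic.
have E : forall A, measurable A -> m1 A = m2 A.
  apply: measure_eq_of_cdf.
  apply: (@fourier_unique_cdf _ _ _ _ _ m1 m2 (idfun : measurableTypeR R -> R) (idfun : measurableTypeR R -> R)) => //.
  move=> t a.
  rewrite (@Ex_density _ _ _ _ _ P m1 X u)//; last first.
    by apply: (@intg_bd _ _ _ _ 1) => [|x]; [meas|exact: cos_norm].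
  rewrite (@Ex_density _ _ _ _ _ gam m2 id (cst c))//; last first.
    by apply: (@intg_bd _ _ _ _ 1) => [|x]; [meas|exact: cos_norm].
  rewrite ft; under [RHS]eq_Rintegral do rewrite mulrC.
  rewrite ExZ; last by apply: (@intg_bd _ _ _ _ 1) => [|x]; [meas|exact: cos_norm].
  by rewrite normal_cos// expr1n mul1r mulrC.
have Ifc : gam.-intg (fun x => f x * cst c x).
  by have := intgZ c If; under eq_fun do rewrite mulrC.
have If2 : m2.-intg f by apply: (@intg_density _ _ _ _ _ gam m2 id (cst c)).
have If1 : m1.-intg f.
  move: If2 => /integrableP[mEf h]; apply/integrableP; split => //.
  by rewrite (@eq_measure_integral _ _ _ _ m2)// => A mA _; exact: E.
split; first exact: (@intg_densityN _ _ _ _ _ P m1 X u).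
rewrite -(@Ex_density _ _ _ _ _ P m1 X u)//.
have -> : \int[m1]_x f x = \int[m2]_x f x.
  by rewrite /Rintegral (@eq_measure_integral _ _ _ _ m2)// => A mA _; exact: E.
rewrite (@Ex_density _ _ _ _ _ gam m2 id (cst c))// mulrC -ExZ//.
by apply: eq_Rintegral => x _; rewrite mulrC.
Qed.

End unique.

(** * Isonormal Gaussian processes *)

Section inner_product.
Variables (R : realType) (H : lmodType R) (dot : {dot H for idfun}).
Implicit Types x y z : H.

Lemma dotC x y : dot x y = dot y x. Proof. by rewrite hermC expr0 mul1r. Qed.
Lemma dotDl x y z : dot (x + y) z = dot x z + dot y z. Proof. exact: linearDl. Qed.
Lemma dotZl (c : R) x z : dot (c *: x) z = c * dot x z. Proof. exact: linearZl. Qed.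
Lemma dotDr x y z : dot z (x + y) = dot z x + dot z y. Proof. by rewrite dotC dotDl !(dotC z). Qed.
Lemma dotZr (c : R) x z : dot z (c *: x) = c * dot z x. Proof. by rewrite dotC dotZl dotC. Qed.
Lemma dot0l z : dot 0 z = 0. Proof. exact: linear0l. Qed.
Lemma dot_suml (I : Type) (s : seq I) (Q : pred I) (F : I -> H) z :
  dot (\sum_(i <- s | Q i) F i) z = \sum_(i <- s | Q i) dot (F i) z.
Proof.
by elim/big_rec2: _ => [|i x y _ <-]; [exact: dot0l|exact: dotDl].
Qed.

End inner_product.

Section laws.
Context {R : realType} d {T : measurableType d} (P : probability T R).

Lemma Ex_sqr_eq0 (X : T -> R) : measurable_fun setT X -> P.-intg (fun w => X w ^+ 2) ->
  \int[P]_w (X w ^+ 2) = 0 -> {ae P, forall w, X w = 0}.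
Proof.
move=> mX IX X0.
have : (\int[P]_w `|(X w ^+ 2)%:E| = 0)%E.
  transitivity (\int[P]_w (X w ^+ 2)%:E)%E.
    by apply: eq_integral => w _; rewrite gee0_abs// lee_fin sqr_ge0.
  by rewrite EFin_Ex// X0.
move/(ae_eq_integral_abs P measurableT _).1 => /(_ ltac:(by apply/measurable_EFinP; meas)).
by apply: filterS => w /(_ Logic.I)[] /eqP; rewrite sqrf_eq0 => /eqP.
Qed.

Lemma Ex_law (X : {RV P >-> R}) (nu : {measure set (measurableTypeR R) -> \bar R}) (f : R -> R) :
  has_law X nu -> nu.-intg f -> P.-intg (fun w => f (X w)) /\ \int[P]_w f (X w) = \int[nu]_x f x.
Proof.
move=> hX If.
have mX0 : measurable_fun setT X by exact: measurable_funPT.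
have mX : measurable_fun setT (X : T -> measurableTypeR R) by exact: mX0.
have nuE : forall A : set (measurableTypeR R), measurable A -> nu A = (\int[P]_(x in (X : T -> measurableTypeR R) @^-1` A) ((cst 1 : T -> R) x)%:E)%E.
  move=> A mA; rewrite -hX// -[RHS]/((\int[P]_(x in (X : T -> measurableTypeR R) @^-1` A) cst 1%E x)%E).
  rewrite integral_cst ?mul1e//.
  by rewrite -[_ @^-1` A]setTI; exact: mX.
have I1 := @intg_densityN _ _ _ _ _ P nu X (cst 1) mX (@measurable_cst _ _ _ _ _ _) (fun=> ler01) nuE f If.
split; first by under eq_fun do rewrite -[f _]mulr1.
rewrite (@Ex_density _ _ _ _ _ P nu X (cst 1) mX (@measurable_cst _ _ _ _ _ _) (fun=> ler01) nuE f If).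
by apply: eq_Rintegral => w _; rewrite mulr1.
Qed.

End laws.

Section isonormal.
Context {R : realType} d {T : measurableType d} (P : probability T R).
Variables (H : lmodType R) (dot : {dot H for idfun}) (W : H -> {RV P >-> R}).
Hypothesis isoW : isonormal_gaussian_process dot W.
Implicit Types g h : H.

Lemma measurable_W h : measurable_fun setT (W h).
Proof. exact: measurable_funPT. Qed.
Hint Resolve measurable_W : core.

Lemma gaussian_W h : has_law (W h) (dirac (0 : R)) \/
  exists2 s : R, 0 < s & has_law (W h) (normal_prob 0 s).
Proof.
have := isoW.1 1%N (fun=> 1) (fun=> h).
by rewrite /centered_gaussian big_ord1 scale1r.
Qed.

Let covE g h : fine ('E_P[fun w => (W g w * W h w)%R])%E = \int[P]_w (W g w * W h w).
Proof. by rewrite unlock. Qed.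

(** The degenerate case, a Dirac law, has to be treated along with the Gaussian one. *)
Lemma W_law h : [/\ P.-intg (fun w => W h w ^+ 2), P.-intg (fun w => W h w ^+ 4),
  \int[P]_w (W h w ^+ 4) = 3 * dot h h ^+ 2 &
  forall t a, \int[P]_w cos (t * W h w + a) = expR (- (t ^+ 2 * dot h h / 2)) * cos a].
Proof.
have c2 : \int[P]_w (W h w ^+ 2) = dot h h.
  rewrite -[RHS]/(fine (dot h h)%:E) -isoW.2 covE.
  by apply: eq_Rintegral => w _; rewrite expr2.
case: (gaussian_W h) => [law0|[s s0 laws]].
  pose nu : {measure set (measurableTypeR R) -> \bar R} := \d_(0 : measurableTypeR R).
  have In (f : R -> R) : measurable_fun setT f -> nu.-intg f.
    move=> mf; apply/integrableP; split; first exact/measurable_EFinP.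
    rewrite integral_dirac//; first by rewrite diracT mul1e ltry.
    by apply: measurableT_comp => //; exact/measurable_EFinP.
  have E (f : R -> R) : measurable_fun setT f -> P.-intg (fun w => f (W h w)) /\ \int[P]_w f (W h w) = f 0.
    move=> mf; have [I ->] := Ex_law (law0 : has_law (W h) nu) (In f mf); split => //.
    by rewrite /Rintegral integral_dirac//; [rewrite diracT mul1e|exact/measurable_EFinP].
  have [I2 E2] := E (fun x => x ^+ 2) ltac:(meas).
  have [I4 E4] := E (fun x => x ^+ 4) ltac:(meas).
  have h0 : dot h h = 0 by rewrite -c2 E2 expr0n.
  split => //; first by rewrite E4 h0 !expr0n/= mulr0.
  move=> t a; rewrite (E (fun x => cos (t * x + a)) ltac:(meas)).2.
  by rewrite h0 !mulr0 add0r mul0r oppr0 expR0 mul1r.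
have B2 (x : R) : `|x ^+ 2| <= 1 * (1 + x ^+ 4).
  by rewrite mul1r ger0_norm ?sqr_ge0//; case: (x2le x) => _ [].
have B4 (x : R) : `|x ^+ 4| <= 1 * (1 + x ^+ 4).
  by rewrite mul1r ger0_norm ?exprn_even_ge0// lerDr.
have Bc (t a x : R) : `|cos (t * x + a)| <= 1 * (1 + x ^+ 4).
  by rewrite mul1r (le_trans (cos_norm _))// lerDl exprn_even_ge0.
have [I2 E2] := Ex_law laws (@intg_normal _ _ s0 (fun x => x ^+ 2) _ ltac:(meas) B2).
have [I4 E4] := Ex_law laws (@intg_normal _ _ s0 (fun x => x ^+ 4) _ ltac:(meas) B4).
have hs : dot h h = s ^+ 2 by rewrite -c2 E2 normal_moment2.
split => //; first by rewrite E4 normal_moment4// hs; ring.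
move=> t a; have [_ ->] := Ex_law laws (@intg_normal _ _ s0 (fun x => cos (t * x + a)) _ ltac:(meas) (Bc t a)).
by rewrite normal_cos// hs (mulrC (s ^+ 2)).
Qed.

Lemma W2_intg h : P.-intg (fun w => W h w ^+ 2). Proof. by case: (W_law h). Qed.
Lemma W4_intg h : P.-intg (fun w => W h w ^+ 4). Proof. by case: (W_law h). Qed.
Lemma W4_Ex h : \int[P]_w (W h w ^+ 4) = 3 * dot h h ^+ 2. Proof. by case: (W_law h). Qed.
Lemma W_cos h t a : \int[P]_w cos (t * W h w + a) = expR (- (t ^+ 2 * dot h h / 2)) * cos a.
Proof. by case: (W_law h). Qed.

Lemma W_cov g h : \int[P]_w (W g w * W h w) = dot g h.
Proof. by rewrite -covE isoW.2. Qed.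

Lemma WM_intg g h : P.-intg (fun w => W g w * W h w).
Proof. by apply: intg_mul => //; exact: W2_intg. Qed.

(** The square of the difference of the two sides has mean zero, by bilinearity of [dot]. *)
Lemma W_comb (g h k : H) (a b : R) : k = a *: g + b *: h ->
  {ae P, forall w, W k w = a * W g w + b * W h w}.
Proof.
move=> ->; set k' := a *: g + b *: h.
have E w : (W k' w - (a * W g w + b * W h w)) ^+ 2 = W k' w * W k' w +
   (- (2 * a)) * (W k' w * W g w) + (- (2 * b)) * (W k' w * W h w) + a ^+ 2 * (W g w * W g w)
   + (2 * a * b) * (W g w * W h w) + b ^+ 2 * (W h w * W h w) by ring.
have I := WM_intg.
have IS : P.-intg (fun w => (W k' w - (a * W g w + b * W h w)) ^+ 2).
  by under eq_fun do rewrite E; repeat first [apply: intgD | exact: I | apply: intgZ].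
have := Ex_sqr_eq0 (_ : measurable_fun setT (fun w => W k' w - (a * W g w + b * W h w))) IS.
have -> : \int[P]_w ((W k' w - (a * W g w + b * W h w)) ^+ 2) = 0.
  under eq_Rintegral do rewrite E.
  rewrite !ExD; try by repeat first [apply: intgD | exact: I | apply: intgZ].
  rewrite !ExZ// !W_cov /k' !(dotDl, dotZl, dotDr, dotZr) (dotC _ h g); ring.
move=> /(_ ltac:(meas) erefl); apply: filterS => w /eqP.
by rewrite subr_eq0 => /eqP.
Qed.

Lemma W_sum (I : Type) (s : seq I) (a : I -> R) (e : I -> H) :
  {ae P, forall w, W (\sum_(i <- s) a i *: e i) w = \sum_(i <- s) a i * W (e i) w}.
Proof.
elim: s => [|i s IH].
  have := @W_comb 0 0 0 0 0; rewrite !scale0r addr0 => /(_ erefl).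
  by apply: filterS => w; rewrite !big_nil !mul0r addr0.
have := @W_comb (e i) (\sum_(i <- s) a i *: e i) _ (a i) 1 erefl.
apply: filterS2 IH => w IH; rewrite scale1r mul1r IH => h.
by rewrite !big_cons.
Qed.

(** Fourth moments by polarization from those of a single Gaussian. *)
Lemma W22_Ex g h : P.-intg (fun w => W g w ^+ 2 * W h w ^+ 2) /\
  \int[P]_w (W g w ^+ 2 * W h w ^+ 2) = dot g g * dot h h + 2 * dot g h ^+ 2.
Proof.
have I : P.-intg (fun w => W g w ^+ 2 * W h w ^+ 2).
  apply: intg_mul; try (by meas).
  - by under eq_fun do rewrite -exprM; exact: W4_intg.
  - by under eq_fun do rewrite -exprM; exact: W4_intg.
split => //.
have hp := @W_comb g h _ 1 1 erefl; have hm := @W_comb g h _ 1 (-1) erefl.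
have E : \int[P]_w (W (1 *: g + 1 *: h) w ^+ 4 + W (1 *: g + (-1) *: h) w ^+ 4) =
   \int[P]_w (2 * W g w ^+ 4 + 12 * (W g w ^+ 2 * W h w ^+ 2) + 2 * W h w ^+ 4).
  apply: Ex_eq_ae; try by meas.
  by apply: filterS2 hp hm => w -> ->; ring.
have := E; rewrite ExD; try exact: W4_intg.
rewrite ExD; [|by apply: intgD; apply: intgZ => //; exact: W4_intg|by apply: intgZ; exact: W4_intg].
rewrite ExD; [|by apply: intgZ; exact: W4_intg|by apply: intgZ].
rewrite !ExZ; try by [exact: W4_intg|exact: I].
rewrite !W4_Ex !(dotDl, dotZl, dotDr, dotZr) (dotC _ h g).
set x := \int[P]_w _; lra.
Qed.

End isonormal.

(** * Independence of orthonormal coordinates *)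

Section factor.
Context {R : realType} d {T : measurableType d} (P : probability T R).
Local Notation gam := (normal_prob (0 : R) 1).
Implicit Types X Y : T -> R.

Lemma intg_cos X : measurable_fun setT X -> P.-intg (fun w => cos (X w)).
Proof. by move=> mX; apply: (@intg_bd _ _ _ P 1) => [|w]; [meas|exact: cos_norm]. Qed.

Lemma intg_cosD X a : measurable_fun setT X -> P.-intg (fun w => cos (X w + a)).
Proof. by move=> mX; apply: intg_cos; meas. Qed.

(** Independence of a standard Gaussian [X] from [Y], phrased with phases: it is enough that
    the cosines of [t X + Y + a] have the expected means at every phase [a]. *)
Definition gauss_indep X Y := forall t a,
  \int[P]_w cos (t * X w + Y w + a) = expR (- (t ^+ 2 / 2)) * \int[P]_w cos (Y w + a).

(** The weight [1 + cos (Y + a)] is nonnegative, so [gauss_factor] applies to it, and product-to-sum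
    formulas reduce the required Fourier transform to [gauss_indep] at shifted phases. *)
Lemma gauss_indep_cos X Y (f : R -> R) a :
  measurable_fun setT X -> measurable_fun setT Y ->
  gauss_indep X Y -> gauss_indep X (cst 0) -> gam.-intg f ->
  P.-intg (fun w => f (X w) * cos (Y w + a)) /\
  \int[P]_w (f (X w) * cos (Y w + a)) = \int[gam]_x f x * \int[P]_w cos (Y w + a).
Proof.
move=> mX mY hXY hX If.
have hX1 t b : \int[P]_w cos (t * X w + b) = expR (- (t ^+ 2 / 2)) * cos b.
  have := hX t b; under eq_Rintegral do rewrite addr0.
  under [X in _ * X]eq_Rintegral do rewrite /= add0r.
  by rewrite Rintegral_cst// [X in fine X]probability_setT mulr1.
have I1 : P.-intg (cst 1) := intg_cst _ _.
have Ic := intg_cosD a mY.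
have i1 : \int[P]_w (cst 1 w) = 1.
  by rewrite Rintegral_cst// [X in fine X]probability_setT mulr1.
have [J1 F1] : P.-intg (fun w => f (X w) * cst 1 w) /\ \int[P]_w (f (X w) * cst 1 w) = \int[gam]_x f x * \int[P]_w (cst 1 w).
  apply: gauss_factor => // t b; rewrite i1 mulr1 -hX1.
  by apply: eq_Rintegral => w _; rewrite mulr1.
have u0 w : 0 <= 1 + cos (Y w + a) by rewrite -lerBlDl sub0r cos_geN1.
have Iu : P.-intg (fun w => 1 + cos (Y w + a)) by exact: intgD.
have [J2 F2] : P.-intg (fun w => f (X w) * (1 + cos (Y w + a))) /\
    \int[P]_w (f (X w) * (1 + cos (Y w + a))) = \int[gam]_x f x * \int[P]_w (1 + cos (Y w + a)).
  apply: gauss_factor => // t b; rewrite ExD// i1.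
  have E w : cos (t * X w + b) * (1 + cos (Y w + a)) = cos (t * X w + b) +
     (2^-1 * cos (t * X w + Y w + (a + b)) + 2^-1 * cos ((- t) * X w + Y w + (a - b))).
    have -> : t * X w + Y w + (a + b) = (t * X w + b) + (Y w + a) by ring.
    have -> : (- t) * X w + Y w + (a - b) = (Y w + a) - (t * X w + b) by ring.
    by rewrite (cosD (t * X w + b) (Y w + a)) (cosB (Y w + a) (t * X w + b)); field.
  under eq_Rintegral do rewrite E.
  rewrite ExD; [|by apply: intg_cos; meas|by apply: intgD; apply: intgZ; apply: intg_cos; meas].
  rewrite ExD; [|by apply: intgZ; apply: intg_cos; meas|by apply: intgZ; apply: intg_cos; meas].
  rewrite !ExZ; [|by apply: intg_cos; meas|by apply: intg_cos; meas].
  rewrite hX1 !hXY sqrrN.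
  have E2 : \int[P]_w cos (Y w + (a + b)) + \int[P]_w cos (Y w + (a - b)) = 2 * cos b * \int[P]_w cos (Y w + a).
    rewrite -ExZ// -ExD; [|exact: intg_cosD|exact: intg_cosD].
    apply: eq_Rintegral => w _; rewrite !addrA (cosD (Y w + a) b) (cosB (Y w + a) b); ring.
  have -> : \int[P]_w cos (Y w + (a - b)) = 2 * cos b * \int[P]_w cos (Y w + a) - \int[P]_w cos (Y w + (a + b)) by rewrite -E2; ring.
  by field.
have E3 w : f (X w) * cos (Y w + a) = f (X w) * (1 + cos (Y w + a)) - f (X w) * cst 1 w by rewrite /=; ring.
split.
  under eq_fun do rewrite E3.
  exact: intgB.
under eq_Rintegral do rewrite E3.
rewrite ExB// F1 F2 ExD// i1; ring.
Qed.

Lemma gauss_indep_sin X Y (f : R -> R) a :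
  measurable_fun setT X -> measurable_fun setT Y ->
  gauss_indep X Y -> gauss_indep X (cst 0) -> gam.-intg f ->
  P.-intg (fun w => f (X w) * sin (Y w + a)) /\
  \int[P]_w (f (X w) * sin (Y w + a)) = \int[gam]_x f x * \int[P]_w sin (Y w + a).
Proof.
move=> mX mY hXY hX If.
have E w : sin (Y w + a) = cos (Y w + (a - pi / 2)).
  by rewrite addrA cosBpihalf.
have [I J] := gauss_indep_cos (a - pi / 2) mX mY hXY hX If.
split; first by under eq_fun do rewrite E.
rewrite (_ : \int[P]_w sin (Y w + a) = \int[P]_w cos (Y w + (a - pi / 2))) -?J.
  by apply: eq_Rintegral => w _; rewrite E.
by apply: eq_Rintegral => w _; exact: E.
Qed.

End factor.

Section orthonormal_factorization.
Context {R : realType} d {T : measurableType d} (P : probability T R).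
Variables (H : lmodType R) (dot : {dot H for idfun}) (W : H -> {RV P >-> R}).
Hypothesis isoW : isonormal_gaussian_process dot W.
Variables (I : finType) (e : I -> H).
Hypothesis e_orth : forall i j, dot (e i) (e j) = (i == j)%:R.
Variables (p : I -> R -> R).
Hypothesis mp : forall i, measurable_fun setT (p i).
Local Notation gam := (normal_prob (0 : R) 1).

Let mW h : measurable_fun setT (W h). Proof. exact: measurable_W. Qed.
Let S (r : seq I) w := \sum_(j <- r) p j (W (e j) w).

Let mS r : measurable_fun setT (S r).
Proof. by apply: measurable_sum => j; apply: (measurableT_comp (mp j)). Qed.
Hint Resolve mW mS : core.

Let e1 i : gauss_indep P (W (e i)) (cst 0).
Proof.
move=> t a; under eq_Rintegral do rewrite addr0.
rewrite (W_cos isoW) e_orth eqxx mulr1; congr (_ * _).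
under eq_Rintegral do rewrite /= add0r.
by rewrite Rintegral_cst// [X in fine X]probability_setT mulr1.
Qed.

Let gam_bd (f : R -> R) : measurable_fun setT f -> (forall x, `|f x| <= 1) -> gam.-intg f.
Proof. exact: intg_gam_bd. Qed.

(** Induction on the family.  The induction hypothesis, applied to combinations of [h] and the new
    direction, makes the latter independent of the other terms, and [gauss_indep_cos] then
    integrates it out. *)
Let orth_split r : uniq r -> forall h a, (forall j, j \in r -> dot (e j) h = 0) ->
  \int[P]_w cos (S r w + W h w + a) = expR (- (dot h h / 2)) * \int[P]_w cos (S r w + a).
Proof.
elim: r => [|j r IH] /=.
  move=> _ h a _; have E w : S [::] w = 0 by rewrite /S big_nil.
  under eq_Rintegral do rewrite E add0r -[W h _]mul1r.
  rewrite (W_cos isoW) expr1n mul1r; congr (_ * _).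
  under eq_Rintegral do rewrite E add0r.
  by rewrite Rintegral_cst// [X in fine X]probability_setT mulr1.
case/andP=> jr ur h a hr.
have {}IH := IH ur.
have ind k : (forall i, i \in j :: r -> dot (e i) k = 0) -> gauss_indep P (W (e j)) (fun w => S r w + W k w).
  move=> hk t b.
  have hk' i : i \in r -> dot (e i) k = 0 by move=> ir; apply: hk; rewrite inE ir orbT.
  have hjr i : i \in r -> dot (e i) (e j) = 0.
    by move=> ir; rewrite e_orth; case: eqP => // ij; rewrite -ij ir in jr.
  transitivity (\int[P]_w cos (S r w + W (t *: e j + 1 *: k) w + b)).
    apply: Ex_eq_ae; [by meas|by meas|].
    have := W_comb isoW (erefl (t *: e j + 1 *: k)).
    by apply: filterS => w ->; congr cos; ring.
  rewrite IH; last first.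
    by move=> i ir; rewrite dotDr !dotZr hk'// hjr// !mulr0 addr0.
  rewrite (IH _ _ hk') mulrA -expRD; congr (expR _ * _).
  have jk : dot (e j) k = 0 by apply: hk; rewrite mem_head.
  rewrite !(dotDl, dotZl, dotDr, dotZr) (dotC _ k) jk e_orth eqxx/= ?mulr0 ?mul1r; by field.
have E w : S (j :: r) w = p j (W (e j) w) + S r w by rewrite /S big_cons.
have Gc : gam.-intg (fun x => cos (p j x)) by apply: gam_bd => [|x]; [meas|exact: cos_norm].
have Gs : gam.-intg (fun x => sin (p j x)) by apply: gam_bd => [|x]; [meas|exact: sin_norm].
have step k b : (forall i, i \in j :: r -> dot (e i) k = 0) ->
    \int[P]_w cos (S (j :: r) w + W k w + b) =
    \int[gam]_x cos (p j x) * \int[P]_w cos (S r w + W k w + b) -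
    \int[gam]_x sin (p j x) * \int[P]_w sin (S r w + W k w + b).
  move=> hk; have hi := ind k hk.
  have mY : measurable_fun setT (fun w => S r w + W k w) by meas.
  have [I1 <-] := gauss_indep_cos b (mW (e j)) mY hi (e1 j) Gc.
  have [I2 <-] := gauss_indep_sin b (mW (e j)) mY hi (e1 j) Gs.
  rewrite -ExB//; apply: eq_Rintegral => w _.
  by rewrite E -!addrA cosD.
have hr0 : forall i, i \in j :: r -> dot (e i) (0 : H) = 0 by move=> i _; rewrite dotC dot0l.
have W0 : {ae P, forall w, W 0 w = 0}.
  have := @W_comb _ _ _ _ _ _ _ isoW 0 0 0 0 0; rewrite !scale0r addr0 => /(_ erefl).
  by apply: filterS => w ->; rewrite !mul0r addr0.
have S0 r' b : \int[P]_w cos (S r' w + W 0 w + b) = \int[P]_w cos (S r' w + b).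
  by apply: Ex_eq_ae; [meas|meas|]; apply: filterS W0 => w ->; rewrite addr0.
rewrite step// -(S0 (j :: r)) step//.
have IHs k b : (forall i, i \in j :: r -> dot (e i) k = 0) ->
   \int[P]_w sin (S r w + W k w + b) = expR (- (dot k k / 2)) * \int[P]_w sin (S r w + b).
  move=> hk.
  under eq_Rintegral do rewrite -cosBpihalf -addrA.
  rewrite IH; last by move=> i ir; apply: hk; rewrite inE ir orbT.
  by congr (_ * _); apply: eq_Rintegral => w _; rewrite addrA cosBpihalf.
rewrite !IHs// !IH.
- by rewrite dot0l mul0r oppr0 expR0; ring.
- by move=> i ir; apply: hr0; rewrite inE ir orbT.
- by move=> i ir; apply: hr; rewrite inE ir orbT.
Qed.

Lemma coord_indep i : gauss_indep P (W (e i)) (fun w => \sum_(j | j != i) p j (W (e j) w)).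
Proof.
move=> t a; pose r := [seq j <- index_enum I | j != i].
have ur : uniq r by rewrite filter_uniq// index_enum_uniq.
have E w : \sum_(j | j != i) p j (W (e j) w) = S r w by rewrite /S big_filter.
under eq_Rintegral do rewrite E.
under [RHS in _ = _ * RHS]eq_Rintegral do rewrite E.
have hr j : j \in r -> dot (e j) (t *: e i) = 0.
  by rewrite mem_filter => /andP[ji _]; rewrite dotZr e_orth (negbTE ji) mulr0.
have := orth_split ur a hr.
rewrite dotZl dotZr e_orth eqxx mulr1 -expr2 => <-.
apply: Ex_eq_ae; [by meas|by meas|].
have := @W_comb _ _ _ _ _ _ _ isoW (e i) (e i) (t *: e i) t 0.
rewrite scale0r addr0 => /(_ erefl); apply: filterS => w ->.
by congr cos; ring.
Qed.

Lemma coord_factor_cos i (f : R -> R) a : gam.-intg f ->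
  P.-intg (fun w => f (W (e i) w) * cos (\sum_(j | j != i) p j (W (e j) w) + a)) /\
  \int[P]_w (f (W (e i) w) * cos (\sum_(j | j != i) p j (W (e j) w) + a)) =
  \int[gam]_x f x * \int[P]_w cos (\sum_(j | j != i) p j (W (e j) w) + a).
Proof.
apply: gauss_indep_cos => //; last exact: coord_indep.
by apply: measurable_sum_cond => j; apply: (measurableT_comp (mp j)).
Qed.

Lemma coord_factor_sin i (f : R -> R) a : gam.-intg f ->
  P.-intg (fun w => f (W (e i) w) * sin (\sum_(j | j != i) p j (W (e j) w) + a)) /\
  \int[P]_w (f (W (e i) w) * sin (\sum_(j | j != i) p j (W (e j) w) + a)) =
  \int[gam]_x f x * \int[P]_w sin (\sum_(j | j != i) p j (W (e j) w) + a).
Proof.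
apply: gauss_indep_sin => //; last exact: coord_indep.
by apply: measurable_sum_cond => j; apply: (measurableT_comp (mp j)).
Qed.

Lemma coord_law i (f : R -> R) : gam.-intg f ->
  P.-intg (fun w => f (W (e i) w)) /\ \int[P]_w f (W (e i) w) = \int[gam]_x f x.
Proof.
move=> If.
have [J1 J2] := @gauss_indep_cos _ _ _ P (W (e i)) (cst 0) f 0 (mW _) ltac:(meas) (@e1 i) (@e1 i) If.
have E w : f (W (e i) w) * cos ((cst 0 : T -> R) w + 0) = f (W (e i) w) by rewrite /= addr0 cos0 mulr1.
split; first by move: J1; under eq_fun do rewrite E.
rewrite (eq_Rintegral _ (fun w _ => esym (E w))) J2 -[RHS]mulr1; congr (_ * _).
under eq_Rintegral do rewrite /= addr0 cos0.
by rewrite Rintegral_cst// [X in fine X]probability_setT mulr1.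
Qed.

End orthonormal_factorization.

(** * Diagonalization of quadratic forms *)

Section real_spectral.
Import complex.
Context {R : realType}.

(** A real symmetric matrix is hermitian over the complex numbers, where the spectral theorem gives
    a real eigenvalue; having it as eigenvalue depends on the characteristic polynomial only,
    hence not on the field. *)
Lemma symmetric_real_eigenvalue n (S : 'M[R]_n.+1) : S^T = S -> exists x, eigenvalue S x.
Proof.
move=> symS; pose C : numClosedFieldType := complex.complex R.
pose f : {rmorphism R -> C} := (@complex.real_complex_def R (Phant R)).
pose SC : 'M[C]_n.+1 := map_mx f S.
have hS : SC \is hermsymmx.
  apply/is_hermitianmxP; rewrite expr0 scale1r; apply/matrixP => i j.
  rewrite !mxE -[in LHS]symS mxE.
  by rewrite [RHS]complex.conjc_real.
have /orthomx_spectralP SE := hermitian_normalmx hS.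
have /mxOverP/(_ 0 0) rl := hermitian_spectral_diag_real hS.
move: SE rl; set D := spectral_diag SC; set U := spectralmx SC => SE rl.
have Uu : U \in unitmx by exact: spectral_unit.
have [x xE] : exists x : R, D 0 0 = f x.
  exists (complex.Re (D 0 0)).
  by move: rl => /complex.complex_realP[x ->].
exists x; rewrite eigenvalue_root_char -(fmorph_root f) map_char_poly -eigenvalue_root_char.
apply/eigenvalueP; exists (row 0 U).
  rewrite -/SC -row_mul SE -mulmxA mulKVmx// row_mul row_diag_mx -scalemxAl -rowE xE//.
apply/eqP => r0; have : row 0 (U *m invmx U) = 0 by rewrite row_mul r0 mul0mx.
by rewrite mulmxV// => /matrixP/(_ 0 0)/eqP; rewrite !mxE eqxx oner_eq0.
Qed.

End real_spectral.

Section spectral_theorem.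
Context {R : realType}.

(** The reflection exchanging the first basis vector and a given unit vector; the formula also
    covers the case of equality, where it is the identity because 0 is its own inverse. *)
Let householder n (u : 'rV[R]_(1 + n)) (e0 := delta_mx 0 0 : 'rV[R]_(1 + n)) : u *m u^T = 1%:M ->
  exists Q : 'M[R]_(1 + n), [/\ Q^T = Q, Q *m Q = 1%:M & e0 *m Q = u].
Proof.
move=> u1; pose w := u - e0; pose c := (w *m w^T) 0 0.
have wc : w *m w^T = c%:M by rewrite [LHS]mx11_scalar.
exists (1%:M - (2 / c) *: (w^T *m w)).
have [c0|c0] := eqVneq c 0.
  have w0 : w = 0.
    apply/rowP => j; rewrite [RHS]mxE.
    move: c0; rewrite /c mxE => /eqP.
    rewrite psumr_eq0; last by move=> i _; rewrite [w^T _ _]mxE -expr2 sqr_ge0.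
    by move/allP => /(_ j (mem_index_enum _)) /=; rewrite [w^T _ _]mxE -expr2 sqrf_eq0 => /eqP.
  have -> : u = e0 by apply/eqP; rewrite -subr_eq0 -/w w0.
  by rewrite w0 mulmx0 scaler0 subr0 trmx1 mulmx1 mulmx1.
have ww : (w^T *m w) *m (w^T *m w) = c *: (w^T *m w).
  by rewrite mulmxA -(mulmxA w^T) wc mul_mx_scalar -scalemxAl.
split.
- by rewrite linearB /= trmx1 linearZ /= trmx_mul trmxK.
- rewrite mulmxBr mulmx1 mulmxBl mul1mx -scalemxAl -scalemxAr ww !scalerA.
  have -> : 2 / c * (2 / c) * c = 2 / c + 2 / c by field.
  by rewrite scalerDl opprB addrK subrK.
pose b (x y : 'rV[R]_(1 + n)) := (x *m y^T) 0 0.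
have bBl x y z : b (x - y) z = b x z - b y z by rewrite /b mulmxBl !mxE.
have bC x y : b x y = b y x by rewrite /b !mxE; apply: eq_bigr => i _; rewrite !mxE mulrC.
have bBr x y z : b z (x - y) = b z x - b z y by rewrite bC bBl !(bC z).
have b1 : b u u = 1 by rewrite /b u1 mxE.
have b2 : b e0 e0 = 1.
  by rewrite /b mxE big_ord_recl big1 ?addr0 => [|i _]; rewrite !mxE/= ?mulr1// mul0r.
have cE : c = - 2 * b e0 w.
  by rewrite -[LHS]/(b w w) /w !(bBl, bBr) b1 b2 (bC u e0); ring.
rewrite mulmxBr mulmx1 -scalemxAr mulmxA [e0 *m w^T]mx11_scalar -/(b e0 w) mul_scalar_mx scalerA.
have -> : 2 / c * b e0 w = - 1.
  rewrite cE; field; apply: contraNneq c0 => h; by rewrite cE h mulr0.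
by rewrite scaleN1r opprK /w addrC subrK.
Qed.

(** Induction on the dimension, moving an eigenvector to the first basis vector by a reflection. *)
Theorem real_symmetric_diagonalization n (S : 'M[R]_n) : S^T = S ->
  exists (O : 'M[R]_n) (l : 'rV[R]_n), O *m O^T = 1%:M /\ O *m S *m O^T = diag_mx l.
Proof.
elim: n S => [|n IH] S symS.
  by exists 0, 0; split; apply/matrixP => -[].
have [x /eigenvalueP[v vS v0]] := symmetric_real_eigenvalue symS.
pose q := (v *m v^T) 0 0.
have q0 : 0 < q.
  rewrite lt_neqAle; apply/andP; split; last first.
    by rewrite /q mxE sumr_ge0// => i _; rewrite mxE -expr2 sqr_ge0.
  apply: contra v0; rewrite eq_sym /q mxE psumr_eq0 => [|i _]; last by rewrite mxE -expr2 sqr_ge0.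
  move/allP => h; apply/eqP/rowP => j; rewrite [RHS]mxE.
  by have := h j (mem_index_enum _); rewrite /= mxE -expr2 sqrf_eq0 => /eqP.
pose u := (Num.sqrt q)^-1 *: v.
have u1 : u *m u^T = 1%:M.
  rewrite /u linearZ /= -scalemxAl -scalemxAr scalerA [v *m v^T]mx11_scalar -/q.
  by rewrite -scalemx1 scalerA -expr2 exprVn sqr_sqrtr ?ltW// mulVf ?scale1r// gt_eqF.
have uS : u *m S = x *: u by rewrite /u -scalemxAl vS !scalerA mulrC.
have [Q [QT QQ eQ]] := @householder n u u1.
have [B BE0] : exists B : 'M[R]_(1 + n), B = Q *m S *m Q by eexists.
have symB : B^T = B by rewrite BE0 !trmx_mul symS QT mulmxA.
have B0 : (delta_mx 0 0 : 'rV[R]_(1 + n)) *m B = x *: delta_mx 0 0.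
  rewrite BE0 !mulmxA eQ uS -scalemxAl; congr (_ *: _).
  by rewrite -eQ -mulmxA QQ mulmx1.
have Brow j : B 0 j = x * (j == 0)%:R.
  by have := congr1 (fun M : 'rV[R]_(1 + n) => M 0 j) B0; rewrite -rowE !mxE eqxx/= => ->.
have Brow' j : B (lshift n 0) j = x * (j == lshift n 0)%:R.
  have -> : lshift n 0 = 0 :> 'I_(1 + n) by exact: val_inj.
  exact: Brow.
have BE : B = block_mx x%:M 0 0 (drsubmx B).
  rewrite -[LHS]submxK; congr block_mx; apply/matrixP => i j; rewrite !mxE ?[i]ord1 ?[j]ord1.
  - by rewrite Brow' !eqxx mulr1.
  - by rewrite Brow' eq_rlshift mulr0.
  - by rewrite -symB mxE Brow' eq_rlshift mulr0.
have symB' : (drsubmx B)^T = drsubmx B by rewrite -{2}symB trmx_drsub.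
have [Z [k [OO OSO]]] := IH _ symB'.
pose K : 'M[R]_(1 + n) := block_mx 1%:M 0 0 Z.
have KK : K *m K^T = 1%:M.
  rewrite /K tr_block_mx !trmx0 trmx1 mulmx_block !mulmx0 !mul0mx !mulmx1 !addr0 add0r OO.
  by rewrite -scalar_mx_block.
have KBK : K *m B *m K^T = diag_mx (row_mx x%:M k).
  rewrite BE /K tr_block_mx !trmx0 trmx1.
  rewrite !mulmx_block !mulmx0 !mul0mx !mulmx1 !mul1mx ?addr0 ?add0r ?mul0mx ?mulmx0 ?addr0 ?add0r OSO.
  rewrite diag_mx_row; congr block_mx.
  by apply/matrixP => i j; rewrite !ord1 !mxE.
exists (K *m Q), (row_mx x%:M k); split.
  by rewrite trmx_mul QT !mulmxA -(mulmxA K) QQ mulmx1.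
by rewrite -KBK BE0 trmx_mul QT !mulmxA.
Qed.

End spectral_theorem.

Section frames.
Context {R : realType} (H : lmodType R) (dot : {dot H for idfun}).

Definition orthonormal n (e : 'I_n -> H) := forall i j, dot (e i) (e j) = (i == j)%:R.
Definition spanned n (e : 'I_n -> H) h := h = \sum_j dot h (e j) *: e j.

Lemma parseval n (e : 'I_n -> H) h g : spanned e h -> dot h g = \sum_j dot h (e j) * dot (e j) g.
Proof. by move=> {1}->; rewrite dot_suml; apply: eq_bigr => j _; rewrite dotZl. Qed.

Lemma gram_schmidt (s : seq H) : exists n (e : 'I_n -> H), orthonormal e /\ forall h, h \in s -> spanned e h.
Proof.
elim: s => [|h s [n [e [oe se]]]].
  by exists 0%N, (fun=> 0); split => // -[].
pose r := h - \sum_j dot h (e j) *: e j.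
have re j : dot r (e j) = 0.
  rewrite /r dotDl -scaleN1r dotZl dot_suml (bigD1 j)//= big1 => [|i ij]; last first.
    by rewrite dotZl oe (negbTE ij) mulr0.
  by rewrite dotZl oe eqxx/=; ring.
have [r0|r0] := eqVneq r 0.
  exists n, e; split => // g; rewrite inE => /predU1P[->|]; last exact: se.
  by apply/eqP; rewrite -subr_eq0 -/r r0.
have q0 : 0 < dot r r by exact: neq0_dnorm_gt0.
pose c := Num.sqrt (dot r r); have c0 : c != 0 by rewrite gt_eqF// sqrtr_gt0.
have cc : dot r r = c * c by rewrite -expr2 sqr_sqrtr// ltW.
pose u := c^-1 *: r.
pose e' (i : 'I_n.+1) := if unlift ord0 i is Some j then e j else u.
have e'0 : e' ord0 = u by rewrite /e' unlift_none.
have e'S j : e' (lift ord0 j) = e j by rewrite /e' liftK.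
have uu : dot u u = 1 by rewrite /u dotZl dotZr cc; field.
have ue j : dot u (e j) = 0 by rewrite /u dotZl re mulr0.
exists n.+1, e'; split.
  move=> i j; case: (unliftP ord0 i) => [i' ->|->]; case: (unliftP ord0 j) => [j' ->|->].
  - by rewrite !e'S oe (inj_eq lift_inj).
  - by rewrite e'0 e'S dotC ue eq_sym (negbTE (neq_lift _ _)).
  - by rewrite e'0 e'S ue (negbTE (neq_lift _ _)).
  - by rewrite e'0 uu eqxx.
move=> g; rewrite inE => /predU1P[->|gs]; rewrite /spanned big_ord_recl e'0.
  under eq_bigr do rewrite e'S.
  have -> : dot h u *: u = r.
    have -> : dot h u = c.
      rewrite /u dotZr; have -> : dot h r = dot r r.
        rewrite -[in LHS](subrK (\sum_j dot h (e j) *: e j) h) -/r dotDl dot_suml big1 ?addr0//.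
        by move=> i _; rewrite dotZl (dotC _ (e i)) re mulr0.
      by rewrite cc mulrA mulVf ?mul1r.
    by rewrite /u scalerA divff// scale1r.
  by rewrite /r subrK.
under eq_bigr do rewrite e'S.
have sg := se g gs; rewrite -sg.
have -> : dot g u = 0 by rewrite (parseval _ sg) big1// => j _; rewrite (dotC _ (e j)) ue mulr0.
by rewrite scale0r add0r.
Qed.

(** Diagonalize the quadratic form [x |-> sum_k a_k <h_k, x>^2] on the span of the [h k]. *)
Lemma spectral_frame K (a : 'I_K -> R) (h : 'I_K -> H) :
  exists n (e : 'I_n -> H) (l : 'I_n -> R), [/\ orthonormal e, forall k, spanned e (h k) &
    forall i j, \sum_k a k * (dot (h k) (e i) * dot (h k) (e j)) = l i *+ (i == j)].
Proof.
have [n [f [of_ sf]]] := gram_schmidt [seq h k | k <- enum 'I_K].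
have {}sf k : spanned f (h k) by apply: sf; apply: map_f; rewrite mem_enum.
pose S : 'M[R]_n := \matrix_(i, j) \sum_k a k * (dot (h k) (f i) * dot (h k) (f j)).
have symS : S^T = S.
  by apply/matrixP => i j; rewrite !mxE; apply: eq_bigr => k _; rewrite (mulrC (dot _ _)).
have [Z [l [OO OSO]]] := real_symmetric_diagonalization symS.
have OO' : Z^T *m Z = 1%:M by exact: mulmx1C.
pose e i := \sum_j Z i j *: f j.
have de g i : dot g (e i) = \sum_j Z i j * dot g (f j).
  by rewrite dotC dot_suml; apply: eq_bigr => j _; rewrite dotZl dotC.
exists n, e, (fun i => l 0 i); split.
- move=> i j; rewrite de; have /matrixP/(_ i j) := OO; rewrite !mxE => <-.
  apply: eq_bigr => k _; rewrite mxE dotC de (bigD1 k)//= big1 => [|m mk].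
    by rewrite of_ eqxx/=; ring.
  by rewrite of_ eq_sym (negbTE mk) mulr0.
- move=> k; rewrite /spanned {1}(sf k).
  transitivity (\sum_j \sum_m \sum_i (Z i j * dot (h k) (f j)) *: (Z i m *: f m)).
    apply: eq_bigr => j _; rewrite (bigD1 j)//= [X in _ + X]big1 ?addr0 => [|m mj].
      under eq_bigr do rewrite scalerA -mulrA [X in Z _ _ * X]mulrC mulrA.
      rewrite -scaler_suml -mulr_suml; have /matrixP/(_ j j) := OO'.
      by rewrite !mxE eqxx; under eq_bigr do rewrite mxE; move=> ->; rewrite mul1r.
    under eq_bigr do rewrite scalerA -mulrA [X in Z _ _ * X]mulrC mulrA.
    rewrite -scaler_suml -mulr_suml; have /matrixP/(_ j m) := OO'.
    by rewrite !mxE eq_sym (negbTE mj); under eq_bigr do rewrite mxE; move=> ->; rewrite mul0r scale0r.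
  under eq_bigr do rewrite exchange_big.
  rewrite exchange_big; apply: eq_bigr => i _ /=.
  rewrite de scaler_suml; apply: eq_bigr => j _.
  by rewrite /e scaler_sumr.
- move=> i j; have := congr1 (fun M : 'M[R]_n => M i j) OSO; rewrite [RHS]mxE => <-.
  rewrite mxE.
  transitivity (\sum_q \sum_p \sum_k a k * (Z i p * dot (h k) (f p)) * (Z j q * dot (h k) (f q))).
    under [RHS]eq_bigr do rewrite exchange_big.
    rewrite [RHS]exchange_big/=.
    apply: eq_bigr => k _; rewrite !de mulrA mulr_sumr.
    by apply: eq_bigr => q _; rewrite mulr_sumr mulr_suml.
  apply: eq_bigr => q _; rewrite !mxE mulr_suml; apply: eq_bigr => p _.
  by rewrite !mxE mulr_sumr mulr_suml; apply: eq_bigr => k _; ring.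
Qed.

End frames.

(** * Finite elements of the second chaos *)

Lemma sum_cauchy_schwarz (R : realFieldType) (I : finType) (x y : I -> R) :
  (\sum_i x i * y i) ^+ 2 <= (\sum_i x i ^+ 2) * (\sum_i y i ^+ 2).
Proof.
set a := \sum_i x i ^+ 2; set b := \sum_i y i ^+ 2; set c := \sum_i _.
have a0 : 0 <= a by apply: sumr_ge0 => i _; exact: sqr_ge0.
have b0 : 0 <= b by apply: sumr_ge0 => i _; exact: sqr_ge0.
have key (s t : R) : 0 <= s ^+ 2 * a + 2 * s * t * c + t ^+ 2 * b.
  rewrite !mulr_sumr -!big_split /=; apply: sumr_ge0 => i _.
  by have := sqr_ge0 (s * x i + t * y i); nra.
have [a1|a1] := ltP 0 a; first by have := key c (- a); nra.
have a_eq : a = 0 by apply/eqP; rewrite eq_le a1.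
have := key (- (1 + b)) c; have := key 1 1; rewrite a_eq.
have [->|c0] := eqVneq c 0; first by rewrite mul0r expr0n.
have : 0 < c ^+ 2 by rewrite exprn_even_gt0.
nra.
Qed.

Section chaos_moments.
Context {R : realType} d {T : measurableType d} (P : probability T R).
Variables (H : lmodType R) (dot : {dot H for idfun}) (W : H -> {RV P >-> R}).
Hypothesis isoW : isonormal_gaussian_process dot W.
Implicit Types g h : H.

Let mW h : measurable_fun setT (W h). Proof. exact: measurable_W. Qed.
Hint Resolve mW : core.

(** The second Hermite polynomial at [W h]. *)
Definition wsq h w := W h w ^+ 2 - 1.

Lemma measurable_wsq h : measurable_fun setT (wsq h). Proof. by rewrite /wsq; meas. Qed.

Lemma wsq_cov g h : dot g g = 1 -> dot h h = 1 ->
  P.-intg (fun w => wsq g w * wsq h w) /\ \int[P]_w (wsq g w * wsq h w) = 2 * dot g h ^+ 2.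
Proof.
move=> g1 h1; have [I E] := W22_Ex isoW g h.
have Ig := W2_intg isoW g; have Ih := W2_intg isoW h.
have I1 : P.-intg (cst 1) := intg_cst _ _.
have e w : wsq g w * wsq h w = W g w ^+ 2 * W h w ^+ 2 + ((cst 1 w + (-1) * W g w ^+ 2) + (-1) * W h w ^+ 2).
  by rewrite /wsq /=; ring.
have i2 k : \int[P]_w (W k w ^+ 2) = dot k k.
  by rewrite -(W_cov isoW); apply: eq_Rintegral => w _; rewrite expr2.
split.
  under eq_fun do rewrite e.
  by repeat first [apply: intgD => //| apply: intgZ].
under eq_Rintegral do rewrite e.
rewrite !ExD; try by repeat first [apply: intgD => //| apply: intgZ].
rewrite !ExZ// E !i2 g1 h1 Rintegral_cst// [X in fine X]probability_setT /=; ring.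
Qed.

Section family.
Variables (K : nat) (h : 'I_K -> H).
Hypothesis h1 : forall k, dot (h k) (h k) = 1.

Definition quadW (a : 'I_K -> R) w := \sum_k a k * wsq (h k) w.

Local Notation quad := quadW.

Lemma measurable_quad a : measurable_fun setT (quad a).
Proof. by apply: measurable_sum => k; apply: measurable_funM => //; exact: measurable_wsq. Qed.
Hint Resolve measurable_quad measurable_wsq : core.

Lemma quad_wsq a g : dot g g = 1 -> P.-intg (fun w => quad a w * wsq g w) /\
  \int[P]_w (quad a w * wsq g w) = 2 * \sum_k a k * dot (h k) g ^+ 2.
Proof.
move=> g1; have e w : quad a w * wsq g w = \sum_k a k * (wsq (h k) w * wsq g w).
  by rewrite /quadW mulr_suml; apply: eq_bigr => k _; rewrite mulrA.
have I k : P.-intg (fun w => a k * (wsq (h k) w * wsq g w)).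
  by apply: intgZ; exact: (wsq_cov (h1 k) g1).1.
split; first by (under eq_fun do rewrite e); exact: intg_sum.
under eq_Rintegral do rewrite e.
rewrite Ex_sum// mulr_sumr; apply: eq_bigr => k _.
by rewrite ExZ ?(wsq_cov (h1 k) g1).2//; [ring|exact: (wsq_cov (h1 k) g1).1].
Qed.

Lemma quad_cov a b : P.-intg (fun w => quad a w * quad b w) /\
  \int[P]_w (quad a w * quad b w) = 2 * \sum_k b k * \sum_m a m * dot (h m) (h k) ^+ 2.
Proof.
have e w : quad a w * quad b w = \sum_k b k * (quad a w * wsq (h k) w).
  by rewrite [quad b w]/quadW mulr_sumr; apply: eq_bigr => k _; rewrite mulrCA.
have I k : P.-intg (fun w => b k * (quad a w * wsq (h k) w)).
  by apply: intgZ; exact: (quad_wsq a (h1 k)).1.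
split; first by (under eq_fun do rewrite e); exact: intg_sum.
under eq_Rintegral do rewrite e.
rewrite Ex_sum// mulr_sumr; apply: eq_bigr => k _.
by rewrite ExZ ?(quad_wsq a (h1 k)).2//; [ring|exact: (quad_wsq a (h1 k)).1].
Qed.

Lemma quad_sqr_intg a : P.-intg (fun w => quad a w ^+ 2).
Proof. by have := (quad_cov a a).1; under eq_fun do rewrite -expr2. Qed.

Lemma quad_intg a : P.-intg (quad a).
Proof. by apply: intg_sqr => //; exact: quad_sqr_intg. Qed.

End family.
End chaos_moments.

(** * Means against a diagonal quadratic phase *)

Section diagonal_phase.
Context {R : realType} d {T : measurableType d} (P : probability T R).
Variables (H : lmodType R) (dot : {dot H for idfun}) (W : H -> {RV P >-> R}).
Hypothesis isoW : isonormal_gaussian_process dot W.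
Variables (n : nat) (e : 'I_n -> H).
Hypothesis e_orth : orthonormal dot e.
Local Notation gam := (normal_prob (0 : R) 1).
Implicit Types (l : 'I_n -> R) (i j : 'I_n) (a : R).

Let mW h : measurable_fun setT (W h). Proof. exact: measurable_W. Qed.
Hint Resolve mW : core.

Definition phase l w := \sum_j l j * W (e j) w ^+ 2.

Lemma measurable_phase l : measurable_fun setT (phase l).
Proof. by apply: measurable_sum => j; meas. Qed.

Let phase' l i w := \sum_(j | j != i) l j * W (e j) w ^+ 2.
Let m_phase' l i : measurable_fun setT (phase' l i).
Proof. by apply: measurable_sum_cond => j; meas. Qed.
Hint Resolve measurable_phase m_phase' : core.

Let phaseE l i w : phase l w = l i * W (e i) w ^+ 2 + phase' l i w.
Proof. by rewrite /phase (bigD1 i). Qed.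

Let gcos (g : R -> R) t : measurable_fun setT g -> (forall x, `|g x| <= x ^+ 2 + 1) -> gam.-intg (fun x => g x * cos (t * x ^+ 2)).
Proof.
move=> mg gb; apply: (@intg_normal _ 1 ltr01 _ 2) => [|x]; first by meas.
rewrite normrM (le_trans (ler_piMr _ (cos_norm _)))// (le_trans (gb x))//.
by case: (x2le x) => _ [h _]; have := exprn_even_ge0 x (isT : ~~ odd 4); lra.
Qed.
Let gsin (g : R -> R) t : measurable_fun setT g -> (forall x, `|g x| <= x ^+ 2 + 1) -> gam.-intg (fun x => g x * sin (t * x ^+ 2)).
Proof.
move=> mg gb; apply: (@intg_normal _ 1 ltr01 _ 2) => [|x]; first by meas.
rewrite normrM (le_trans (ler_piMr _ (sin_norm _)))// (le_trans (gb x))//.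
by case: (x2le x) => _ [h _]; have := exprn_even_ge0 x (isT : ~~ odd 4); lra.
Qed.

(** Addition formula and independence of coordinate [i] from the other ones. *)
Let split_cos (g : R -> R) l i a : measurable_fun setT g -> (forall x, `|g x| <= x ^+ 2 + 1) ->
  P.-intg (fun w => g (W (e i) w) * cos (phase l w + a)) /\
  \int[P]_w (g (W (e i) w) * cos (phase l w + a)) =
    \int[gam]_x (g x * cos (l i * x ^+ 2)) * \int[P]_w cos (phase' l i w + a) -
    \int[gam]_x (g x * sin (l i * x ^+ 2)) * \int[P]_w sin (phase' l i w + a).
Proof.
move=> mg gb; pose p j x := l j * x ^+ 2.
have mp j : measurable_fun setT (p j) by rewrite /p; meas.
have [I1 <-] := coord_factor_cos isoW e_orth mp i a (gcos (l i) mg gb).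
have [I2 <-] := coord_factor_sin isoW e_orth mp i a (gsin (l i) mg gb).
have E w : g (W (e i) w) * cos (phase l w + a) =
   g (W (e i) w) * cos (l i * W (e i) w ^+ 2) * cos (phase' l i w + a) -
   g (W (e i) w) * sin (l i * W (e i) w ^+ 2) * sin (phase' l i w + a).
  by rewrite (phaseE l i) -addrA cosD; ring.
split; first by under eq_fun do rewrite E; exact: intgB.
by under eq_Rintegral do rewrite E; rewrite ExB.
Qed.

Let sin_cos x : sin x = cos (x - pi / 2) :> R. Proof. by rewrite cosBpihalf. Qed.

Let split_sin (g : R -> R) l i a : measurable_fun setT g -> (forall x, `|g x| <= x ^+ 2 + 1) ->
  \int[P]_w (g (W (e i) w) * sin (phase l w + a)) =
    \int[gam]_x (g x * cos (l i * x ^+ 2)) * \int[P]_w sin (phase' l i w + a) +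
    \int[gam]_x (g x * sin (l i * x ^+ 2)) * \int[P]_w cos (phase' l i w + a).
Proof.
move=> mg gb.
under eq_Rintegral do rewrite sin_cos -addrA.
rewrite (split_cos _ _ _ mg gb).2.
have -> : \int[P]_w cos (phase' l i w + (a - pi / 2)) = \int[P]_w sin (phase' l i w + a).
  by apply: eq_Rintegral => w _; rewrite sin_cos addrA.
have -> : \int[P]_w sin (phase' l i w + (a - pi / 2)) = - \int[P]_w cos (phase' l i w + a).
  rewrite -ExN; last by apply: intg_cos; meas.
  by apply: eq_Rintegral => w _; rewrite addrA sinBpihalf.
by rewrite mulrN opprK.
Qed.

(** Real part, imaginary part and squared modulus of the mean of [exp (i (phase l + a))]. *)
Definition phase_cos l a := \int[P]_w cos (phase l w + a).
Definition phase_sin l a := \int[P]_w sin (phase l w + a).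
Definition phase_sqmod l a := phase_cos l a ^+ 2 + phase_sin l a ^+ 2.

Let c1 : measurable_fun setT (cst 1 : R -> R). Proof. by []. Qed.
Let c1b x : `|(cst 1 : R -> R) x| <= x ^+ 2 + 1.
Proof. by rewrite normr1 lerDr sqr_ge0. Qed.
Let m2 : measurable_fun setT (fun x : R => x ^+ 2). Proof. by meas. Qed.
Let b2 (x : R) : `|x ^+ 2| <= x ^+ 2 + 1.
Proof. by rewrite ger0_norm ?sqr_ge0// lerDl. Qed.

Let kcs l i a (C := \int[P]_w cos (phase' l i w + a)) (S := \int[P]_w sin (phase' l i w + a)) :
  phase_cos l a = kc (l i) * C - ks (l i) * S /\ phase_sin l a = kc (l i) * S + ks (l i) * C.
Proof.
have Ec : kc (l i) = \int[gam]_x (cst 1 x * cos (l i * x ^+ 2)).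
  by apply: eq_Rintegral => x _; rewrite mul1r.
have Es : ks (l i) = \int[gam]_x (cst 1 x * sin (l i * x ^+ 2)).
  by apply: eq_Rintegral => x _; rewrite mul1r.
rewrite Ec Es /C /S -split_sin// -(split_cos _ _ _ c1 c1b).2.
by split; apply: eq_Rintegral => w _; rewrite mul1r.
Qed.

(** In complex terms, [kc2E] and [ks2E] say that [E[W_i^2 exp]] and [E[exp]] have ratio
    [1 / (1 - 2 i l_i)]: their difference carries a factor [l_i], and the former is the smaller in
    modulus. *)
Lemma phase_diag l i a : P.-intg (fun w => W (e i) w ^+ 2 * cos (phase l w + a)) /\
  exists2 B, \int[P]_w (W (e i) w ^+ 2 * cos (phase l w + a)) = phase_cos l a - 2 * l i * B &
    B ^+ 2 <= phase_sqmod l a.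
Proof.
have [I2 E2] := split_cos l i a m2 b2; split => //.
have [] := kcs l i a; move: E2.
rewrite /phase_sqmod -[\int[gam]_x _]/(kc2 (l i)) -[\int[gam]_x (_ * sin _)]/(ks2 (l i)).
set C := \int[P]_w cos _; set S := \int[P]_w sin _ => E2 -> ->.
have := kc2E (l i); have := ks2E (l i).
set u := kc2 _ in E2 *; set v := ks2 _ in E2 * => hs hc.
exists (u * S + v * C).
  have -> : kc (l i) = u + 2 * l i * v by lra.
  have -> : ks (l i) = v - 2 * l i * u by lra.
  by rewrite E2; ring.
have -> : kc (l i) = u + 2 * l i * v by lra.
have -> : ks (l i) = v - 2 * l i * u by lra.
set x := 2 * l i; rewrite -subr_ge0.
have -> : ((u + x * v) * C - (v - x * u) * S) ^+ 2 + ((u + x * v) * S + (v - x * u) * C) ^+ 2 -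
  (u * S + v * C) ^+ 2 = (u * C - v * S) ^+ 2 + x ^+ 2 * ((u ^+ 2 + v ^+ 2) * (C ^+ 2 + S ^+ 2)) by ring.
by repeat first [exact: sqr_ge0 | apply: addr_ge0 | apply: mulr_ge0].
Qed.

(** Coordinates are switched on one at a time, each contributing the factor computed in
    [kappa_modulus]; the phase [a] is a rotation and does not affect the modulus. *)
Lemma phase_sqmod_prod l a : phase_sqmod l a ^+ 2 * \prod_i (1 + 4 * l i ^+ 2) = 1.
Proof.
pose lr (r : seq 'I_n) i := if i \in r then l i else 0.
have K r : uniq r -> phase_sqmod (lr r) a ^+ 2 * \prod_(i <- r) (1 + 4 * l i ^+ 2) = 1; last first.
  have {K} := K (index_enum 'I_n) (index_enum_uniq _).
  suff -> : lr (index_enum 'I_n) = l by [].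
  by apply/funext => i; rewrite /lr mem_index_enum.
elim: r => [_|i r IH /= /andP[ir ur]].
  have E w : phase (lr [::]) w = 0 by rewrite /phase big1// => j _; rewrite mul0r.
  rewrite big_nil mulr1 /phase_sqmod /phase_cos /phase_sin.
  under eq_Rintegral do rewrite E add0r.
  under [X in _ + X ^+ 2]eq_Rintegral do rewrite E add0r.
  by rewrite !Rintegral_cst// [X in fine X]probability_setT !mulr1 cos2Dsin2 expr1n.
rewrite big_cons -[RHS](IH ur) mulrA; congr (_ * _).
have [] := kcs (lr (i :: r)) i a; have [] := kcs (lr r) i a.
have E w : phase' (lr (i :: r)) i w = phase' (lr r) i w.
  by apply: eq_bigr => j ji; rewrite /lr inE (negbTE ji).
have -> : \int[P]_w cos (phase' (lr (i :: r)) i w + a) = \int[P]_w cos (phase' (lr r) i w + a).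
  by apply: eq_Rintegral => w _; rewrite E.
have -> : \int[P]_w sin (phase' (lr (i :: r)) i w + a) = \int[P]_w sin (phase' (lr r) i w + a).
  by apply: eq_Rintegral => w _; rewrite E.
rewrite /phase_sqmod => -> -> -> ->; rewrite /lr mem_head (negbTE ir).
have := kappa_modulus (l i); have := kappa_modulus (0 : R).
set C := \int[P]_w cos _; set S := \int[P]_w sin _.
have q (x y : R) : (x * C - y * S) ^+ 2 + (x * S + y * C) ^+ 2 = (x ^+ 2 + y ^+ 2) * (C ^+ 2 + S ^+ 2) by ring.
by rewrite !q !exprMn expr0n mulr0 addr0 mulr1 => -> h; rewrite mulrAC h.
Qed.

(** The Gaussian law is symmetric, being that of both [W e] and [W (- e)]. *)
Let odd_mean i (f : R -> R) : gam.-intg f -> (forall x, f (- x) = - f x) -> \int[gam]_x f x = 0.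
Proof.
move=> If fo.
have mf : measurable_fun setT f by exact: intg_meas If.
have [I1 E1] := coord_law isoW e_orth i If.
have oe : orthonormal dot (fun j => - e j).
  by move=> j k; rewrite -[- e j]scaleN1r -[- e k]scaleN1r dotZl dotZr e_orth mulrA mulrN1 opprK mul1r.
have [I2 E2] := coord_law isoW oe i If.
have : \int[P]_w f (W (- e i) w) = \int[P]_w (- f (W (e i) w)).
  apply: Ex_eq_ae.
  - exact: measurableT_comp.
  - by apply: measurableT_comp => //; exact: measurableT_comp.
  - have := @W_comb _ _ _ _ _ _ _ isoW (e i) 0 (- e i) (-1) 0.
    rewrite scaleN1r scale0r addr0 => /(_ erefl); apply: filterS => w ->.
    by rewrite mul0r addr0 mulN1r fo.
by rewrite E2 ExN// E1; lra.
Qed.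

(** The mean of [f (W (e i)) * cos (phase' l i + xi * W (e j) + a)] vanishes for all [xi] because [f] is
    odd, and so does its derivative at [xi = 0]. *)
Let odd_factor l i j a (f : R -> R) : i != j -> measurable_fun setT f ->
  (forall x, `|f x| <= `|x|) -> (forall x, f (- x) = - f x) ->
  \int[P]_w (f (W (e i) w) * W (e j) w * sin (phase' l i w + a)) = 0.
Proof.
move=> ij mf fx fo.
have IW : P.-intg (fun w => `|W (e i) w * W (e j) w|) by apply: intg_norm; exact: (WM_intg isoW).
have If : gam.-intg f.
  apply: (@intg_normal _ 1 ltr01 _ 1) => // x; rewrite mul1r (le_trans (fx x))//.
  by case: (x2le x).
pose p xi k x := l k * x ^+ 2 + (if k == j then xi else 0) * x.
have mp xi k : measurable_fun setT (p xi k) by rewrite /p; meas.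
have pE xi w : \sum_(k | k != i) p xi k (W (e k) w) = phase' l i w + xi * W (e j) w.
  rewrite big_split/=; congr (_ + _); rewrite (bigD1 j) 1?eq_sym//= eqxx big1 ?addr0//.
  by move=> k /andP[_ kj]; rewrite (negbTE kj) mul0r.
pose F (xi : R) w := f (W (e i) w) * cos (phase' l i w + xi * W (e j) w + a).
pose dF (xi : R) w := - (f (W (e i) w) * W (e j) w * sin (phase' l i w + xi * W (e j) w + a)).
have FE xi : P.-intg (F xi) /\ \int[P]_w F xi w = 0.
  have [I E] := coord_factor_cos isoW e_orth (mp xi) i a If.
  split; first by move: I; under eq_fun do rewrite pE.
  by move: E; under eq_Rintegral do rewrite pE; rewrite (odd_mean i If fo) mul0r.
have dFP (xi : R) : is_derive xi (1 : R) (fun t => \int[P]_w F t w) (\int[P]_w dF xi w).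
  apply: Ex_derive (IW) _ _ xi => [t|t w|t w]; first exact: (FE t).1.
    by rewrite /F /dF; apply: is_derive_eq; rewrite /GRing.scale/=; ring.
  rewrite /dF normrN normrM (le_trans (ler_piMr _ (sin_norm _)))// !normrM.
  by apply: ler_wpM2r.
have F0 : (fun t => \int[P]_w F t w) = cst 0 by apply/funext => t; exact: (FE t).2.
have d0 := dFP 0; rewrite F0 in d0.
have := @derive_val _ _ _ _ _ _ _ d0; rewrite derive_cst /dF.
under [RHS]eq_Rintegral do rewrite mul0r addr0.
rewrite ExN => [/esym/eqP|]; first by rewrite oppr_eq0 => /eqP.
apply: (@intg_le _ _ _ P _ (fun w => `|W (e i) w * W (e j) w|)) => //; last move=> w.
  by apply: measurable_funM; [apply: measurable_funM => //; exact: measurableT_comp|meas].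
by rewrite normrM (le_trans (ler_piMr _ (sin_norm _)))// !normrM ler_wpM2r.
Qed.

Lemma phase_offdiag l i j a : i != j ->
  P.-intg (fun w => W (e i) w * W (e j) w * cos (phase l w + a)) /\
  \int[P]_w (W (e i) w * W (e j) w * cos (phase l w + a)) = 0.
Proof.
move=> ij; have IW := WM_intg isoW (e i) (e j).
split.
  under eq_fun do rewrite mulrC.
  by apply: (@intgMbd _ _ _ P 1) => // [|w]; [meas|exact: cos_norm].
have m1 : measurable_fun setT (fun x : R => x * cos (l i * x ^+ 2)) by meas.
have m2' : measurable_fun setT (fun x : R => x * sin (l i * x ^+ 2)) by meas.
have b1 (x : R) : `|x * cos (l i * x ^+ 2)| <= `|x| by rewrite normrM ler_piMr// cos_norm.
have b2' (x : R) : `|x * sin (l i * x ^+ 2)| <= `|x| by rewrite normrM ler_piMr// sin_norm.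
have o1 (x : R) : - x * cos (l i * (- x) ^+ 2) = - (x * cos (l i * x ^+ 2)) by rewrite sqrrN mulNr.
have o2 (x : R) : - x * sin (l i * (- x) ^+ 2) = - (x * sin (l i * x ^+ 2)) by rewrite sqrrN mulNr.
have := odd_factor l (a + pi / 2) ij m1 b1 o1.
have := odd_factor l a ij m2' b2' o2.
set X := \int[P]_w _ => X0; set Y := \int[P]_w _ => Y0.
have -> : 0 = Y - X by rewrite X0 Y0 subr0.
rewrite /X /Y -ExB.
- apply: eq_Rintegral => w _; rewrite addrA sinDpihalf (phaseE l i) -addrA cosD; ring.
- apply: (@intg_le _ _ _ P _ (fun w => `|W (e i) w * W (e j) w|)); [by meas| |exact: (intg_norm IW)] => w.
  by rewrite normrM (le_trans (ler_piMr _ (sin_norm _)))// !normrM ler_wpM2r// -normrM.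
- apply: (@intg_le _ _ _ P _ (fun w => `|W (e i) w * W (e j) w|)); [by meas| |exact: (intg_norm IW)] => w.
  by rewrite normrM (le_trans (ler_piMr _ (sin_norm _)))// !normrM ler_wpM2r// -normrM.
Qed.
End diagonal_phase.

(** * Spectral bound for elements of the second chaos *)

Section chaos_spectrum.
Context {R : realType} d {T : measurableType d} (P : probability T R).
Variables (H : lmodType R) (dot : {dot H for idfun}) (W : H -> {RV P >-> R}).
Hypothesis isoW : isonormal_gaussian_process dot W.
Variables (K : nat) (h : 'I_K -> H).
Hypothesis h1 : forall k, dot (h k) (h k) = 1.
Local Notation quad := (quadW W h).

Let mW g : measurable_fun setT (W g). Proof. exact: measurable_W. Qed.
Hint Resolve mW measurable_quad : core.

Section frame.
Variables (n : nat) (e : 'I_n -> H).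
Hypotheses (e_orth : orthonormal dot e) (e_span : forall k, spanned dot e (h k)).

Let B (b : 'I_K -> R) i j := \sum_k b k * (dot (h k) (e i) * dot (h k) (e j)).

(** The constants match because [sum_i B b i i = sum_k b_k |h_k|^2 = sum_k b_k]. *)
Lemma quad_expansion b : {ae P, forall w,
  quad b w = \sum_i \sum_j B b i j * (W (e i) w * W (e j) w - (i == j)%:R)}.
Proof.
have : {ae P, forall w, forall k, W (h k) w = \sum_j dot (h k) (e j) * W (e j) w}.
  apply: filter_forall => k; have := W_sum isoW (index_enum 'I_n) (fun j => dot (h k) (e j)) e.
  by rewrite -(e_span k).
apply: filterS => w hw.
rewrite /quadW /B.
under [RHS]eq_bigr => i _ do under eq_bigr => j _ do rewrite mulr_suml.
under [RHS]eq_bigr => i _ do rewrite exchange_big.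
rewrite [RHS]exchange_big/=; apply: eq_bigr => k _.
under eq_bigr => i _ do under eq_bigr => j _ do rewrite -!mulrA.
under eq_bigr => i _ do rewrite -mulr_sumr.
rewrite -mulr_sumr; congr (_ * _).
rewrite /wsq -[in LHS](h1 k) [in LHS](parseval _ (e_span k)) hw expr2 mulr_suml -sumrB.
apply: eq_bigr => i _.
under [RHS]eq_bigr => j _ do rewrite !mulrBr.
rewrite sumrB; congr (_ - _).
  by rewrite mulr_sumr; apply: eq_bigr => j _; ring.
rewrite (bigD1 i)//= eqxx big1 ?addr0 ?mulr1 ?(dotC _ (e i))// => j ji.
by rewrite eq_sym (negbTE ji) !mulr0.
Qed.

(** Bessel's inequality for the orthogonal variables [W (e j) ^ 2 - 1] of variance 2. *)
Lemma quad_bessel b : 2 * \sum_j B b j j ^+ 2 <= \int[P]_w (quad b w ^+ 2).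
Proof.
have e1 j : dot (e j) (e j) = 1 by rewrite e_orth eqxx.
pose c j := B b j j; pose D w := quadW W e c w.
have [IDD EDD] := quad_cov isoW e1 c c.
have ED : \int[P]_w (D w ^+ 2) = 2 * \sum_j c j ^+ 2.
  under eq_Rintegral do rewrite expr2.
  rewrite EDD; congr (_ * _); apply: eq_bigr => k _.
  rewrite (bigD1 k)//= e_orth eqxx big1 ?addr0 => [|m mk]; last by rewrite e_orth (negbTE mk) expr0n mulr0.
  by rewrite expr1n mulr1 expr2.
have EbD : \int[P]_w (quad b w * D w) = 2 * \sum_j c j ^+ 2.
  have E w : quad b w * D w = \sum_j c j * (quad b w * wsq W (e j) w).
    by rewrite /D /quadW mulr_sumr; apply: eq_bigr => j _; rewrite mulrCA.
  under eq_Rintegral do rewrite E.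
  rewrite Ex_sum => [|j]; last by apply: intgZ; exact: (quad_wsq isoW h1 b (e1 j)).1.
  rewrite mulr_sumr; apply: eq_bigr => j _.
  rewrite ExZ; last exact: (quad_wsq isoW h1 b (e1 j)).1.
  rewrite (quad_wsq isoW h1 b (e1 j)).2 [c j ^+ 2]expr2 mulrCA; congr (_ * (_ * _)).
have := cauchy_schwarz (measurable_quad _ _ b) (measurable_quad _ _ c) (quad_sqr_intg isoW h1 b) (quad_sqr_intg isoW e1 c).
rewrite -/D EbD ED; set s := 2 * _; set q := \int[P]_w _ => hs.
have s0 : 0 <= s by rewrite mulr_ge0// sumr_ge0// => j _; exact: sqr_ge0.
have q0 : 0 <= q by apply: Rintegral_ge0 => w _; exact: sqr_ge0.
by have [|s1] := leP s q => //; nra.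
Qed.

Variables (a : 'I_K -> R) (l : 'I_n -> R).
Hypothesis a_diag : forall i j, B a i j = l i *+ (i == j).

Lemma quad_energy : \int[P]_w (quad a w ^+ 2) = 2 * \sum_i l i ^+ 2.
Proof.
under eq_Rintegral do rewrite expr2.
rewrite (quad_cov isoW h1 a a).2; congr (_ * _).
have E k m : dot (h m) (h k) = \sum_i dot (h m) (e i) * dot (h k) (e i).
  by rewrite (parseval _ (e_span m)); apply: eq_bigr => i _; rewrite (dotC _ (e i)).
transitivity (\sum_k a k * \sum_i l i * dot (h k) (e i) ^+ 2).
  apply: eq_bigr => k _; congr (_ * _).
  transitivity (\sum_m \sum_i \sum_j a m * (dot (h m) (e i) * dot (h m) (e j)) * (dot (h k) (e i) * dot (h k) (e j))).
    apply: eq_bigr => m _; rewrite E expr2 mulr_suml mulr_sumr; apply: eq_bigr => i _.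
    by rewrite mulr_sumr mulr_sumr; apply: eq_bigr => j _; ring.
  rewrite exchange_big/=; apply: eq_bigr => i _.
  rewrite exchange_big/= (bigD1 i)//= [X in _ + X]big1 ?addr0 => [|j ji].
    by rewrite -mulr_suml -/(B a i i) a_diag eqxx mulr1n expr2.
  by rewrite -mulr_suml -/(B a i j) a_diag eq_sym (negbTE ji) mulr0n mul0r.
under eq_bigr do rewrite mulr_sumr.
rewrite exchange_big/=; apply: eq_bigr => i _.
have <- : B a i i = l i by rewrite a_diag eqxx.
by rewrite expr2 mulr_sumr; apply: eq_bigr => k _; rewrite a_diag eqxx mulr1n; ring.
Qed.

Variables (t c : R).
Let lt i := t * l i.
Let c' := c - \sum_i lt i.

Lemma quad_phase : {ae P, forall w, t * quad a w + c = phase W e lt w + c'}.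
Proof.
apply: filterS (quad_expansion a) => w ->.
rewrite /c' addrCA [RHS]addrC; congr (_ + _).
rewrite mulr_sumr -sumrB; apply: eq_bigr => i _.
rewrite (bigD1 i)//= a_diag eqxx big1 ?addr0 => [|j ji]; first by rewrite /lt/=; ring.
by rewrite a_diag eq_sym (negbTE ji) mul0r.
Qed.

Hint Resolve measurable_phase : core.

(** The constant [- sum_i B b i i] of the expansion compensates the main terms in [phase_diag], so that
    each diagonal coefficient comes with a factor [lt i]. *)
Lemma quad_cos_expansion b : exists2 g : 'I_n -> R,
  \int[P]_w (quad b w * cos (t * quad a w + c)) = \sum_i B b i i * (- (2 * lt i) * g i) &
  forall i, g i ^+ 2 <= phase_sqmod W e lt c'.
Proof.
have D i := phase_diag isoW e_orth lt i c'.
have /choice[g gP] : forall i, exists B,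
    \int[P]_w (W (e i) w ^+ 2 * cos (phase W e lt w + c')) = phase_cos W e lt c' - 2 * lt i * B /\
    B ^+ 2 <= phase_sqmod W e lt c'.
  by move=> i; case: (D i) => _ [x ? ?]; exists x.
exists g => [|i]; last by case: (gP i).
have mp : measurable_fun setT (fun w => cos (phase W e lt w + c')) by meas.
transitivity (\int[P]_w \sum_i \sum_j B b i j * (W (e i) w * W (e j) w * cos (phase W e lt w + c') - (i == j)%:R * cos (phase W e lt w + c'))).
  apply: Ex_eq_ae.
  - by apply: measurable_funM => //; meas; exact: measurable_quad.
  - by apply: measurable_sum => i; apply: measurable_sum => j; meas.
  - apply: filterS2 (quad_expansion b) quad_phase => w -> ->.
    rewrite mulr_suml; apply: eq_bigr => i _; rewrite mulr_suml; apply: eq_bigr => j _; ring.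
have Ic : P.-intg (fun w => cos (phase W e lt w + c')) by apply: intg_cosD; exact: measurable_phase.
have I i j : P.-intg (fun w => W (e i) w * W (e j) w * cos (phase W e lt w + c')).
  have [->|ij] := eqVneq i j; last exact: (phase_offdiag isoW e_orth lt c' ij).1.
  by have := (D j).1; under eq_fun do rewrite expr2.
have I' i j : P.-intg (fun w => B b i j * (W (e i) w * W (e j) w * cos (phase W e lt w + c') - (i == j)%:R * cos (phase W e lt w + c'))).
  by apply: intgZ; apply: intgB => //; exact: intgZ.
rewrite Ex_sum => [|i]; last exact: intg_sum.
apply: eq_bigr => i _; rewrite Ex_sum// (bigD1 i)//= big1 ?addr0 => [|j ji].
  rewrite ExZ; last by apply: intgB => //; exact: intgZ.
  rewrite ExB//; last exact: intgZ.
  rewrite ExZ// eqxx mul1r -/(phase_cos W e lt c').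
  under eq_Rintegral do rewrite -expr2.
  by rewrite (gP i).1; ring.
rewrite eq_sym in ji; rewrite ExZ; last by apply: intgB => //; exact: intgZ.
rewrite ExB//; last exact: intgZ.
by rewrite ExZ// (negbTE ji) mul0r (phase_offdiag isoW e_orth lt c' ji).2 subrr mulr0.
Qed.

End frame.

(** [D] is the squared modulus of the characteristic function of [quad a] at [t].  The estimate is the
    Cauchy-Schwarz inequality for [quad_cos_expansion], combined with [quad_bessel] and
    [quad_energy]. *)
Lemma chaos_spectrum a : exists n (l : 'I_n -> R), \int[P]_w (quad a w ^+ 2) = 2 * \sum_i l i ^+ 2 /\
  forall t c (D := (\int[P]_w cos (t * quad a w + c)) ^+ 2 + (\int[P]_w sin (t * quad a w + c)) ^+ 2),
    D ^+ 2 * \prod_i (1 + 4 * (t * l i) ^+ 2) = 1 /\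
    forall b, (\int[P]_w (quad b w * cos (t * quad a w + c))) ^+ 2 <=
      t ^+ 2 * D * \int[P]_w (quad b w ^+ 2) * \int[P]_w (quad a w ^+ 2).
Proof.
have [n [e [l [oe se ad]]]] := spectral_frame dot a h.
exists n, l; have E2 := quad_energy se ad; split => // t c.
have ph := quad_phase se ad t c; have := @measurable_phase _ _ _ _ _ W n e.
set lt := fun i => t * l i in ph; set c' := (c - _) in ph; move=> mph; have {}mph := mph lt.
have -> : \int[P]_w cos (t * quad a w + c) = phase_cos W e lt c'.
  apply: Ex_eq_ae; [|by meas|by apply: filterS ph => w ->].
  by meas; exact: measurable_quad.
have -> : \int[P]_w sin (t * quad a w + c) = phase_sin W e lt c'.
  apply: Ex_eq_ae; [|by meas|by apply: filterS ph => w ->].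
  by meas; exact: measurable_quad.
rewrite -/(phase_sqmod W e lt c') => D; split; first exact: (phase_sqmod_prod isoW oe lt c').
move=> b; have [g -> gD] := quad_cos_expansion oe se ad t c b.
have := quad_bessel oe b; set beta := fun j => \sum_k b k * (dot (h k) (e j) * dot (h k) (e j)).
rewrite -/(\sum_j beta j ^+ 2) => hb.
apply: (le_trans (sum_cauchy_schwarz beta _)).
have h2 : \sum_i (- (2 * (t * l i)) * g i) ^+ 2 <= 4 * t ^+ 2 * D * \sum_i l i ^+ 2.
  rewrite mulr_sumr; apply: ler_sum => i _.
  rewrite exprMn sqrrN !exprMn -!mulrA mulrCA.
  have := gD i; rewrite -/lt -/D => gi.
  have := mulr_ge0 (sqr_ge0 t) (sqr_ge0 (l i)); nra.
rewrite E2; set q := \int[P]_w _ in hb *.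
set s := \sum_i l i ^+ 2 in h2 *; set u := \sum_i beta i ^+ 2 in hb *.
have u0 : 0 <= u by apply: sumr_ge0 => i _; exact: sqr_ge0.
have s0 : 0 <= s by apply: sumr_ge0 => i _; exact: sqr_ge0.
have D0 : 0 <= D by rewrite addr_ge0// sqr_ge0.
apply: (le_trans (ler_wpM2l u0 h2)).
have X0 : 0 <= t ^+ 2 * D * s by repeat first [done | exact: sqr_ge0 | apply: mulr_ge0].
nra.
Qed.
End chaos_spectrum.

(** * Size of the eigenvalues *)

Section eigenvalues.
Context {R : realType}.

(** The exponential lies above its tangent at [th * L]; average the inequalities at [0] and [L]. *)
Lemma expR_chord (th L : R) : 0 <= th <= 1 -> expR (th * L) <= 1 + th * (expR L - 1).
Proof.
move=> /andP[t0 t1]; set z := th * L.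
have h0 : expR z * (1 - z) <= 1.
  by have := expR_ge1Dx (- z); rewrite expRN => h; rewrite mulrC -ler_pdivlMr ?expR_gt0// div1r.
have h1 : expR z * (1 + (L - z)) <= expR L.
  have := expR_ge1Dx (L - z); rewrite expRD expRN => h.
  by rewrite mulrC -ler_pdivlMr ?expR_gt0.
have e : expR z = th * (expR z * (1 + (L - z))) + (1 - th) * (expR z * (1 - z)).
  by rewrite /z; ring.
by rewrite e; nra.
Qed.

(** By concavity of [x |-> ln (1 + c * x)], a product of factors [1 + c * x_i] with prescribed
    sum of the [x_i] is smallest when the [x_i] are as unequal as the constraint allows. *)
Lemma prod_flat_ge n (x : 'I_n -> R) (c m : R) k : 0 <= c -> (forall i, 0 <= x i <= m) ->
  \sum_i x i = k%:R * m -> (1 + c * m) ^+ k <= \prod_i (1 + c * x i).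
Proof.
move=> c0 xm xs; have xp i : 0 <= x i by case/andP: (xm i).
have [m0|m0] := leP m 0.
  have x0 i : x i = 0 by apply/eqP; rewrite eq_le xp andbT; case/andP: (xm i) => _ /le_trans; exact.
  rewrite big1 => [|i _]; last by rewrite x0 mulr0 addr0.
  have : k%:R * m = 0 by rewrite -xs big1.
  move=> /eqP; rewrite mulf_eq0 => /orP[/eqP k0|/eqP->]; last by rewrite mulr0 addr0 expr1n.
  by move/eqP: k0; rewrite pnatr_eq0 => /eqP->; rewrite expr0.
have cm : 0 < 1 + c * m by rewrite ltr_pwDl// mulr_ge0// ltW.
set L := ln (1 + c * m).
have eL : expR L = 1 + c * m by rewrite /L lnK.
have -> : (1 + c * m) ^+ k = expR (\sum_i (x i / m * L)).
  rewrite -mulr_suml -mulr_suml xs mulfK ?gt_eqF// -eL -expRM_natl; congr expR; ring.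
rewrite expR_sum; apply: ler_prod => i _; rewrite expR_ge0/=.
have hth : 0 <= x i / m <= 1.
  by rewrite divr_ge0 ?(ltW m0)//= ler_pdivrMr// mul1r; case/andP: (xm i).
apply: (le_trans (expR_chord L hth)); rewrite eL.
by rewrite le_eqVlt; apply/orP; left; apply/eqP; field; rewrite gt_eqF.
Qed.

(** If the squared modulus [c^2 + s^2] of a characteristic function at [1] is close enough to its
    Gaussian value, no single eigenvalue carries a large part of the variance: a large one would
    replace a factor [expR (- y)] by the larger [(1 + y)^-1]. *)
Lemma eigenvalues_small n (l : 'I_n -> R) (v c s eta : R) : 1000 * eta <= 1 ->
  2 * \sum_i l i ^+ 2 = v -> `|v - 1| <= eta ->
  (c ^+ 2 + s ^+ 2) ^+ 2 * \prod_i (1 + 4 * l i ^+ 2) = 1 ->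
  `|c - expR (- 2^-1)| <= eta -> `|s| <= eta ->
  forall i, l i ^+ 2 <= v / 12.
Proof.
move=> eta1 lv v1 D1 hc hs i; rewrite leNgt; apply/negP => li.
have eta0 : 0 <= eta by exact: le_trans v1.
have := v1; rewrite ler_norml => /andP[v1l v1r].
(* [y] is the contribution of the large eigenvalue; the variance being almost 1, it exceeds 1/3
   up to [eta]. *)
pose y := 4 * l i ^+ 2.
have y0 : 333 / 1000 <= y by rewrite /y; lra.
have yp : 0 < y by lra.
have yp0 : 0 <= y by exact: ltW.
have pi_le : \prod_i (1 + 4 * l i ^+ 2) <= (1 + y) * expR (2 * v - y).
  rewrite (bigD1 i)//=; apply: ler_wpM2l; first by rewrite addr_ge0// ltW.
  have -> : 2 * v - y = \sum_(j | j != i) 4 * l j ^+ 2.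
    by rewrite -lv (bigD1 i)//= -mulr_sumr /y; ring.
  rewrite expR_sum; apply: ler_prod => j _; rewrite expR_ge1Dx andbT.
  by rewrite addr_ge0// mulr_ge0// sqr_ge0.
have ey : 1 + y + 3 / 8 * y ^+ 2 <= expR y.
  have -> : expR y = expR (y / 4) ^+ 4 by rewrite -expRM_natl; congr expR; field.
  have h := expR_ge1Dx (y / 4).
  have [z zE] : exists z, z = y / 4 by exists (y / 4).
  have z0 : 0 <= z by rewrite zE; lra.
  rewrite -zE in h *; have -> : y = 4 * z by rewrite zE; field.
  have z1 : 0 <= 1 + z by rewrite addr_ge0.
  apply: (@le_trans _ _ ((1 + z) ^+ 4)); last by rewrite lerXn2r// nnegrE (expR_ge0, z1).
  have z3 := exprn_ge0 3 z0; have z4 := exprn_ge0 4 z0.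
  have -> : (1 + z) ^+ 4 = 1 + 4 * z + 3 / 8 * (4 * z) ^+ 2 + (4 * z ^+ 3 + z ^+ 4) by field.
  by rewrite lerDl addr_ge0// mulr_ge0.
(* At [y = 1/3] the left-hand side is about 0.955; this margin of 3 percent is what the errors of
   order [eta] below have to fit in. *)
have ratio : (1 + y) * expR (- y) <= 97 / 100.
  by rewrite expRN ler_pdivrMr ?expR_gt0//; clear - ey y0 yp; nra.
set E := expR (- 2^-1) in hc.
have E0 : 0 < E by exact: expR_gt0.
have E1 : E <= 1 by rewrite expR_le1 oppr_le0.
have EE : E ^+ 2 = expR (-1) by rewrite /E -expRM_natl; congr expR; field.
have E2 : 3 / 10 <= E ^+ 2.
  have -> : E ^+ 2 = expR (- 4^-1) ^+ 4 by rewrite EE -expRM_natl; congr expR; field.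
  have h := expR_ge1Dx (- 4^-1 : R).
  have q : (3 / 4) ^+ 4 <= expR (- 4^-1 : R) ^+ 4.
    by rewrite lerXn2r// ?nnegrE ?expR_ge0//; lra.
  by apply: le_trans q; lra.
set D := c ^+ 2 + s ^+ 2 in D1.
have D0 : 0 <= D by rewrite addr_ge0// sqr_ge0.
have ee : 1000 * eta ^+ 2 <= eta by rewrite expr2 mulrA ler_piMl.
have DE : D <= E ^+ 2 * (1 + 10 * eta).
  have s2 : s ^+ 2 <= eta ^+ 2 by rewrite -real_normK ?num_real// lerXn2r// nnegrE.
  have c2 : (c - E) ^+ 2 <= eta ^+ 2 by rewrite -real_normK ?num_real// lerXn2r// nnegrE.
  have hE : (c - E) * E <= eta.
    apply: (le_trans (ler_norm _)); rewrite normrM (gtr0_norm E0).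
    by apply: (le_trans (ler_piMr _ E1)).
  have -> : D = E ^+ 2 + (2 * ((c - E) * E) + (c - E) ^+ 2 + s ^+ 2) by rewrite /D; ring.
  rewrite mulrDr mulr1 lerD2l.
  by apply: (@le_trans _ _ (3 * eta)); [lra|rewrite mulrCA mulrA; apply: ler_wpM2r => //; lra].
have ev : E ^+ 2 * expR v <= 1 + 2 * eta.
  rewrite EE -expRD; have := expR_ge1Dx (- (- 1 + v)); rewrite expRN => h.
  have e0 := expR_gt0 (- 1 + v).
  have h1 : (1 - (-1 + v)) * expR (-1 + v) <= 1 by rewrite -ler_pdivlMr// div1r.
  have h2 : (1 - eta) * expR (-1 + v) <= 1.
    by apply: le_trans h1; apply: ler_wpM2r; [exact: ltW|lra].
  have h3 : 1 <= (1 - eta) * (1 + 2 * eta).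
    have -> : (1 - eta) * (1 + 2 * eta) = 1 + (eta - 2 * eta ^+ 2) by ring.
    by rewrite lerDl; have := sqr_ge0 eta; lra.
  by rewrite -(@ler_pM2l _ (1 - eta)) ?(le_trans h2)//; lra.
have De : D * expR v <= 1 + 13 * eta.
  have g0 : 0 <= 1 + 10 * eta by rewrite addr_ge0// mulr_ge0.
  apply: (le_trans (ler_wpM2r (expR_ge0 v) DE)).
  rewrite mulrAC; apply: (le_trans (ler_wpM2r g0 ev)).
  have -> : (1 + 2 * eta) * (1 + 10 * eta) = 1 + (12 * eta + 20 * eta ^+ 2) by ring.
  by rewrite lerD2l; have := sqr_ge0 eta; lra.
have q0 : 0 <= D * expR v by rewrite mulr_ge0// expR_ge0.
have De2 : (D * expR v) ^+ 2 <= 1 + 27 * eta.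
  apply: (@le_trans _ _ ((1 + 13 * eta) ^+ 2)).
    by rewrite lerXn2r// nnegrE (le_trans q0).
  have -> : (1 + 13 * eta) ^+ 2 = 1 + (26 * eta + 169 * eta ^+ 2) by ring.
  by rewrite lerD2l; have := sqr_ge0 eta; lra.
have r0 : 0 <= (1 + y) * expR (- y) by rewrite mulr_ge0 ?expR_ge0// addr_ge0.
have : 1 <= (D * expR v) ^+ 2 * ((1 + y) * expR (- y)).
  rewrite -[leLHS]D1; apply: (le_trans (ler_wpM2l (sqr_ge0 D) pi_le)).
  have -> : expR (2 * v - y) = expR v ^+ 2 * expR (- y) by rewrite -expRM_natl -expRD.
  by rewrite le_eqVlt; apply/orP; left; apply/eqP; ring.
apply/negP; rewrite -ltNge.
have h1 : (D * expR v) ^+ 2 * ((1 + y) * expR (- y)) <= (1 + 27 * eta) * (97 / 100).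
  by apply: ler_pM => //; exact: sqr_ge0.
by apply: (le_lt_trans h1); lra.
Qed.

End eigenvalues.

(** * Perturbation in mean square *)

Section l2.
Context {R : realType} d {T : measurableType d} (P : probability T R).
Implicit Types f g X Y : T -> R.

Definition l2 f := Num.sqrt (\int[P]_x (f x ^+ 2)).

Let sq0 f : 0 <= \int[P]_x (f x ^+ 2).
Proof. by apply: Rintegral_ge0 => x _; exact: sqr_ge0. Qed.

Lemma l2_ge0 f : 0 <= l2 f. Proof. exact: sqrtr_ge0. Qed.
Lemma l2_sqr f : l2 f ^+ 2 = \int[P]_x (f x ^+ 2). Proof. by rewrite sqr_sqrtr. Qed.

Lemma l2_holder f g : measurable_fun setT f -> measurable_fun setT g ->
  P.-intg (fun x => f x ^+ 2) -> P.-intg (fun x => g x ^+ 2) ->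
  `|\int[P]_x (f x * g x)| <= l2 f * l2 g.
Proof.
move=> mf mg hf hg; rewrite -(ler_pXn2r (isT : (0 < 2)%N)) ?nnegrE ?mulr_ge0 ?l2_ge0//.
by rewrite real_normK ?num_real// exprMn !l2_sqr; exact: cauchy_schwarz.
Qed.

Lemma l2_triangle f g : measurable_fun setT f -> measurable_fun setT g ->
  P.-intg (fun x => f x ^+ 2) -> P.-intg (fun x => g x ^+ 2) ->
  l2 (fun x => f x + g x) <= l2 f + l2 g.
Proof.
move=> mf mg hf hg; rewrite -(ler_pXn2r (isT : (0 < 2)%N)) ?nnegrE ?addr_ge0 ?l2_ge0//.
rewrite l2_sqr; have E x : (f x + g x) ^+ 2 = f x ^+ 2 + (2 * (f x * g x) + g x ^+ 2) by ring.
have Ifg := intg_mul mf mg hf hg.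
under eq_Rintegral do rewrite E.
rewrite ExD//; last by apply: intgD => //; exact: intgZ.
rewrite ExD//; last exact: intgZ.
rewrite ExZ// -!l2_sqr.
have := le_trans (ler_norm _) (l2_holder mf mg hf hg); set q := \int[P]_x _.
by move=> ?; rewrite sqrrD; lra.
Qed.

Lemma l2Z c f : P.-intg (fun x => f x ^+ 2) -> l2 (fun x => c * f x) = `|c| * l2 f.
Proof.
move=> If; rewrite /l2; under eq_Rintegral do rewrite exprMn.
by rewrite ExZ// sqrtrM ?sqr_ge0// sqrtr_sqr.
Qed.

Lemma Ex_norm_l2 f : measurable_fun setT f -> P.-intg (fun x => f x ^+ 2) ->
  \int[P]_x `|f x| <= l2 f.
Proof.
move=> mf If; have := @l2_holder (fun x => `|f x|) (cst 1).
have E x : `|f x| ^+ 2 = f x ^+ 2 by rewrite real_normK// num_real.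
rewrite {2}/l2 -/(l2 _); under [X in Num.sqrt X * _]eq_Rintegral do rewrite E.
rewrite -/(l2 f) (_ : l2 (cst 1) = 1); last first.
  rewrite /l2; under eq_Rintegral do rewrite expr1n.
  by rewrite Rintegral_cst// [X in fine X]probability_setT mulr1 sqrtr1.
rewrite mulr1; under eq_Rintegral do rewrite mulr1.
under [X in integrable _ _ X]eq_fun do rewrite /= E.
move=> H; apply: (le_trans (ler_norm _)); apply: H => //; first exact: measurableT_comp.
by under eq_fun do rewrite expr1n; exact: intg_cst.
Qed.

Lemma lipschitz_derive (f df : R -> R) L : (forall x : R, is_derive x (1 : R) f (df x)) ->
  (forall x, `|df x| <= L) -> forall x y, `|f y - f x| <= L * `|y - x|.
Proof.
move=> h hL; have cf := is_derive_continuous h.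
have K x y : x <= y -> `|f y - f x| <= L * `|y - x|.
  move=> xy; have [c _ ->] := @MVT_segment R f df x y xy (fun z _ => h z) (continuous_subspaceT cf).
  by rewrite normrM ler_wpM2r.
by move=> x y; have [/K//|/ltW/K] := leP x y; rewrite distrC (distrC x).
Qed.

Lemma Ex_lipschitz (f : R -> R) L X Y : measurable_fun setT f -> 0 <= L ->
  (forall x y, `|f y - f x| <= L * `|y - x|) ->
  measurable_fun setT X -> measurable_fun setT Y ->
  P.-intg (fun w => f (X w)) -> P.-intg (fun w => f (Y w)) ->
  P.-intg (fun w => (Y w - X w) ^+ 2) ->
  `|\int[P]_w f (Y w) - \int[P]_w f (X w)| <= L * l2 (fun w => Y w - X w).
Proof.
move=> mf L0 hL mX mY IX IY ID; rewrite -ExB//.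
have mD : measurable_fun setT (fun w => Y w - X w) by meas.
have ID1 := intg_sqr mD ID.
apply: (le_trans (Ex_norm (intgB IY IX))).
apply: (@le_trans _ _ (\int[P]_w (L * `|Y w - X w|))).
  by apply: Ex_le => //; [exact/intg_norm/intgB|exact/intgZ/intg_norm].
by rewrite ExZ; [apply: ler_wpM2l => //; exact: Ex_norm_l2|exact: intg_norm].
Qed.

Lemma cos_lipschitz (x y : R) : `|cos y - cos x| <= 1 * `|y - x|.
Proof.
by apply: (@lipschitz_derive _ (fun x => - sin x)) => z; rewrite normrN sin_norm.
Qed.

Lemma sin_lipschitz (x y : R) : `|sin y - sin x| <= 1 * `|y - x|.
Proof. by apply: (@lipschitz_derive _ cos) => z; rewrite cos_norm. Qed.

Lemma atan_lipschitz (e b x y : R) : 0 < e ->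
  `|atan ((b - y) / e) - atan ((b - x) / e)| <= e^-1 * `|y - x|.
Proof.
move=> e0; have := @lipschitz_derive (fun z => atan (z / e)) (poisson e) e^-1
  (fun z => is_derive_atan_scale z e0) _ (b - x) (b - y).
rewrite (_ : b - y - (b - x) = - (y - x)) ?normrN; last by ring.
by apply=> z; rewrite ger0_norm ?poisson_ge0// poisson_le.
Qed.

(** The centers are the values at a standard Gaussian variable.  These three statistics are
    what the bound on eigenvalues uses of the closeness to the Gaussian law, and they are stable
    under small perturbations in mean square. *)
Definition near_gaussian (eta : R) X := [/\ `|\int[P]_w (X w ^+ 2) - 1| <= eta,
  `|\int[P]_w cos (X w) - expR (- 2^-1)| <= eta & `|\int[P]_w sin (X w)| <= eta].

Lemma near_gaussian_perturb (eta del : R) X Y : measurable_fun setT X -> measurable_fun setT Y ->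
  P.-intg (fun w => X w ^+ 2) -> P.-intg (fun w => Y w ^+ 2) ->
  l2 (fun w => Y w - X w) <= del -> del <= 1 -> eta <= 1 ->
  near_gaussian eta X -> near_gaussian (eta + 4 * del) Y.
Proof.
move=> mX mY IX IY ld d1 eta1 [hv hc hs].
have mD : measurable_fun setT (fun w => Y w - X w) by meas.
have ID : P.-intg (fun w => (Y w - X w) ^+ 2).
  have := @intg_sqrD _ _ _ P Y (fun w => (-1) * X w) mY ltac:(meas) IY.
  under [X in integrable _ _ X]eq_fun do rewrite /= exprMn sqrrN expr1n mul1r.
  by move=> /(_ IX); under eq_fun do rewrite mulN1r.
have d0 : 0 <= del by exact: le_trans (l2_ge0 _) ld.
have lip (f : R -> R) : measurable_fun setT f -> (forall x, `|f x| <= 1) ->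
    (forall x y, `|f y - f x| <= 1 * `|y - x|) ->
    `|\int[P]_w f (Y w) - \int[P]_w f (X w)| <= del.
  move=> mf f1 fl; apply: (le_trans _ ld); rewrite -[leRHS]mul1r.
  by apply: Ex_lipschitz => //; apply: (@intg_bd _ _ _ P 1) => //; exact: measurableT_comp.
have tri (p q r e' : R) : `|p - q| <= del -> `|q - r| <= e' -> `|p - r| <= e' + 4 * del.
  by rewrite !ler_norml => /andP[? ?] /andP[? ?]; apply/andP; split; lra.
split.
- have E w : Y w ^+ 2 = X w ^+ 2 + (2 * (X w * (Y w - X w)) + (Y w - X w) ^+ 2) by ring.
  have IXD := intg_mul mX mD IX ID.
  under eq_Rintegral do rewrite E.
  rewrite ExD//; last by apply: intgD => //; exact: intgZ.
  rewrite ExD//; last exact: intgZ.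
  rewrite ExZ// -!l2_sqr; have := l2_holder mX mD IX ID.
  have := hv; rewrite -l2_sqr; set q := \int[P]_w _; set x := l2 X; set y := l2 _ in ld *.
  have x0 : 0 <= x by exact: l2_ge0. have y0 : 0 <= y by exact: l2_ge0.
  rewrite !ler_norml => /andP[h1 h2] /andP[h3 h4].
  have x2 : x <= 3 / 2 by rewrite leNgt; apply/negP => ?; nra.
  have xy : x * y <= 3 / 2 * del by apply: ler_pM.
  have yy : 0 <= y ^+ 2 <= del by rewrite sqr_ge0/= expr2; nra.
  by case/andP: yy => ? ?; apply/andP; split; lra.
- by apply: tri hc; apply: (lip cos); [meas|exact: cos_norm|exact: cos_lipschitz].
- rewrite -[X in `|X|]subr0; rewrite -[X in `|X|]subr0 in hs; apply: tri hs.
  by apply: (lip sin); [meas|exact: sin_norm|exact: sin_lipschitz].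
Qed.

End l2.

(** * Increments of smoothed distribution functions *)

Section smoothing.
Context {R : realType} d {T : measurableType d} (P : probability T R).
Variables (H : lmodType R) (dot : {dot H for idfun}) (W : H -> {RV P >-> R}).
Hypothesis isoW : isonormal_gaussian_process dot W.
Variables (K : nat) (h : 'I_K -> H).
Hypothesis h1 : forall k, dot (h k) (h k) = 1.
Local Notation quad := (quadW W h).
Local Notation leb := (@lebesgue_measure R).
Implicit Types a b : 'I_K -> R.

(** With [v] the variance and [z = 1 + t^2 v / 3], the modulus of the characteristic function is at most
    [z^(-3/2)], and [|t| z^(-3/2)] is of the order of [1 / z]. *)
Lemma near_gaussian_decay (eta : R) a b t c : 1000 * eta <= 1 -> near_gaussian P eta (quad a) ->
  `|\int[P]_w (quad b w * cos (t * quad a w + c))| <=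
    7 * l2 P (quad b) * (oneDsqr t)^-1.
Proof.
move=> eta1 [hv hc hs].
have [n [l [Ev sp]]] := chaos_spectrum isoW h1 a.
set v := \int[P]_w (quad a w ^+ 2) in Ev hv sp *.
have lsmall : forall i, l i ^+ 2 <= v / 12.
  apply: (@eigenvalues_small _ _ l v _ _ eta eta1 (esym Ev) hv _ hc hs).
  have [] := sp 1 0.
  under eq_Rintegral do rewrite mul1r addr0.
  under [X in _ + X ^+ 2]eq_Rintegral do rewrite mul1r addr0.
  by under eq_bigr do rewrite mul1r.
have [] := sp t c; set D := _ + _ => D1 /(_ b).
set J := \int[P]_w _; set q := \int[P]_w _ => Jq.
have D0 : 0 <= D by rewrite addr_ge0// sqr_ge0.
have q0 : 0 <= q by apply: Rintegral_ge0 => w _; exact: sqr_ge0.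
have := hv; rewrite ler_norml => /andP[hv1 hv2].
have v1 : 3 / 4 <= v by lra.
pose x := t ^+ 2.
have x0 : 0 <= x by exact: sqr_ge0.
(* The bound [v / 12] on the eigenvalues is a sixth of their sum [v / 2]. *)
have pg : (1 + 4 * x * (v / 12)) ^+ 6 <= \prod_i (1 + 4 * (t * l i) ^+ 2).
  have := @prod_flat_ge _ _ (fun i => l i ^+ 2) (4 * x) (v / 12) 6 (mulr_ge0 (ler0n _ 4) x0).
  move=> -/(_ (fun i => ltac:(by rewrite sqr_ge0 lsmall))) H6.
  apply: (le_trans (H6 _)); first by rewrite Ev; field.
  by rewrite le_eqVlt; apply/orP; left; apply/eqP; apply: eq_bigr => i _; rewrite /x; ring.
set z := 1 + 4 * x * (v / 12) in pg.
have z1 : 1 <= z by rewrite lerDl; apply: mulr_ge0; [exact: mulr_ge0|lra].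
have z0 : 0 <= z by exact: le_trans z1.
have Dz : D * z ^+ 3 <= 1.
  rewrite -(ler_pXn2r (isT : (0 < 2)%N)) ?nnegrE ?mulr_ge0 ?exprn_ge0// expr1n exprMn -exprM -D1.
  by apply: ler_wpM2l pg; exact: sqr_ge0.
have key : x * D * v * z ^+ 2 <= 3.
  have -> : x * D * v * z ^+ 2 = 3 * ((z - 1) * z ^+ 2 * D) by rewrite /z; field.
  rewrite -[leRHS]mulr1; apply: ler_wpM2l => //.
  apply: le_trans Dz; rewrite mulrC [in leRHS]exprS; apply: ler_wpM2l => //.
  by apply: ler_wpM2r; [exact: exprn_ge0|rewrite lerBlDr lerDl].
have zt : oneDsqr t <= 4 * z by rewrite /oneDsqr -/x /z; nra.
have o0 : 0 < oneDsqr t by rewrite (lt_le_trans ltr01)// oneDsqr_ge1.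
rewrite ler_pdivlMr// -[in leLHS](gtr0_norm o0) -normrM.
rewrite -(ler_pXn2r (isT : (0 < 2)%N)) ?nnegrE ?mulr_ge0 ?l2_ge0// real_normK ?num_real//.
rewrite [leRHS]exprMn l2_sqr -/q exprMn.
have o2 : oneDsqr t ^+ 2 <= 16 * z ^+ 2.
  have -> : 16 * z ^+ 2 = (4 * z) ^+ 2 by ring.
  by rewrite lerXn2r// nnegrE ?(ltW o0)// mulr_ge0.
apply: (le_trans (ler_wpM2r (sqr_ge0 _) Jq)).
have v0 : 0 <= v by lra.
have w0 : 0 <= x * D * q * v by repeat first [assumption | apply: mulr_ge0].
apply: (le_trans (ler_wpM2l w0 o2)).
have -> : x * D * q * v * (16 * z ^+ 2) = 16 * q * (x * D * v * z ^+ 2) by ring.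
have q16 : 0 <= 16 * q by rewrite mulr_ge0.
apply: (le_trans (ler_wpM2l q16 key)); lra.
Qed.

Let mq a : measurable_fun setT (quad a). Proof. exact: measurable_quad. Qed.
Hint Resolve mq : core.

Lemma quad_poisson_bound (eta : R) a b e x : 1000 * eta <= 1 -> near_gaussian P eta (quad a) -> 0 < e ->
  `|\int[P]_w (poisson e (x - quad a w) * quad b w)| <=
    pi * (7 / 2 * l2 P (quad b)).
Proof.
move=> eta1 ng e0; set q := l2 _ _.
have Ikey : leb.-integrable `[0, +oo[ (EFin \o (fun t : R => (oneDsqr t)^-1)).
  apply/integrableP; split.
    apply/measurable_EFinP; apply: measurable_funTS.
    by apply: continuous_measurable_fun; exact: continuous_oneDsqrV.
  under eq_integral => t _ do rewrite /= ger0_norm ?invr_ge0 ?(le_trans ler01) ?oneDsqr_ge1//.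
  by rewrite integral0y_oneDsqr ltry.
apply: (@Ex_poisson_bound _ _ _ P e x (quad a) (quad b) (fun t => 7 * q * (oneDsqr t)^-1)) => //.
- exact: (quad_intg isoW h1).
- move=> t c _; under eq_Rintegral do rewrite mulrC.
  exact: near_gaussian_decay eta1 ng.
- have := integrableZl _ (7 * q) Ikey => /(_ ltac:(by [])).
  by apply: eq_integrable.
- rewrite RintegralZl//.
  rewrite {1}/Rintegral integral0y_oneDsqr /=.
  by rewrite le_eqVlt; apply/orP; left; apply/eqP; field.
Qed.

Lemma quadD a b w : quad (fun k => a k + b k) w = quad a w + quad b w.
Proof. by rewrite /quadW -big_split; apply: eq_bigr => k _; rewrite mulrDl. Qed.

Lemma quadZ s a w : quad (fun k => s * a k) w = s * quad a w.
Proof. by rewrite /quadW mulr_sumr; apply: eq_bigr => k _; rewrite mulrA. Qed.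

Lemma quad_atan_increment (eta : R) a b e x : 2000 * eta <= 1 -> 4 * l2 P (quad b) <= eta ->
  near_gaussian P eta (quad a) -> 0 < e ->
  `|\int[P]_w atan ((x - (quad a w + quad b w)) / e) - \int[P]_w atan ((x - quad a w) / e)| <=
    pi * (7 / 2 * l2 P (quad b)).
Proof.
move=> eta1 beta ng e0; have b0 := l2_ge0 P (quad b).
apply: atan_increment => //; first exact: (quad_intg isoW h1).
move=> s /andP[s0 s1]; pose c k := a k + s * b k.
have E w : quad a w + s * quad b w = quad c w by rewrite quadD quadZ.
under eq_Rintegral do rewrite E.
have [I1 I2] := (quad_sqr_intg isoW h1 a, quad_sqr_intg isoW h1 b).
suff ng' : near_gaussian P (eta + 4 * l2 P (quad b)) (quad c).
  by apply: quad_poisson_bound ng' e0; lra.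
apply: (@near_gaussian_perturb _ _ _ P eta _ (quad a)) ng; [exact: mq|exact: mq|by []| | |lra|lra].
  exact: (quad_sqr_intg isoW h1).
have -> : (fun w => quad c w - quad a w) = (fun w => s * quad b w).
  by apply/funext => w; rewrite -E; ring.
by rewrite l2Z// ger0_norm// ler_piMl.
Qed.

End smoothing.

(** Two finite sums along different directions are sums along a common family, with zero weights. *)
Section concatenation.
Context {R : realType} d {T : measurableType d} (P : probability T R).
Variables (H : lmodType R) (W : H -> {RV P >-> R}).
Variables (K L : nat) (h : 'I_K -> H) (g : 'I_L -> H) (a : 'I_K -> R) (b : 'I_L -> R).

Definition cat_family (X : Type) (x : 'I_K -> X) (y : 'I_L -> X) (i : 'I_(K + L)) :=
  match fintype.split i with inl j => x j | inr k => y k end.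

Lemma cat_familyl X (x : 'I_K -> X) y j : cat_family x y (lshift L j) = x j.
Proof. by rewrite /cat_family (unsplitK (inl j)). Qed.
Lemma cat_familyr X (x : 'I_K -> X) y j : cat_family x y (rshift K j) = y j.
Proof. by rewrite /cat_family (unsplitK (inr j)). Qed.

Lemma quad_catl w : quadW W (cat_family h g) (cat_family a (fun=> 0)) w = quadW W h a w.
Proof.
rewrite /quadW big_split_ord/= [X in _ + X]big1 ?addr0 => [|i _].
  by apply: eq_bigr => i _; rewrite !cat_familyl.
by rewrite cat_familyr mul0r.
Qed.

Lemma quad_catr w : quadW W (cat_family h g) (cat_family (fun=> 0) b) w = quadW W g b w.
Proof.
rewrite /quadW big_split_ord/= big1 ?add0r => [|i _].
  by apply: eq_bigr => i _; rewrite !cat_familyr.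
by rewrite cat_familyl mul0r.
Qed.

End concatenation.

(** * Passage to the limit in the second chaos *)

Section chaos_limit.
Context {R : realType} d {T : measurableType d} (P : probability T R).

Lemma Lnorm_l2 (f : T -> R) : P.-intg (fun w => f w ^+ 2) -> 'N[P]_2%:E[EFin \o f]%E = (l2 P f)%:E.
Proof.
move=> If; have E w : (`|(EFin \o f) w| `^ 2)%E = (f w ^+ 2)%:E.
  rewrite -[(`|_|)%E]/(`|f w|%:E).
  by rewrite poweR_EFin (powR_mulrn 2) ?normr_ge0// real_normK// num_real.
rewrite unlock; under eq_integral => w _ do rewrite E.
by rewrite EFin_Ex// poweR_EFin powR12_sqrt// Rintegral_ge0// => w _; exact: sqr_ge0.
Qed.

Lemma hermite2E (x : R) : (hermite R 2).[x] = x ^+ 2 - 1.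
Proof. by rewrite /hermite derivC subr0 mulr1 derivX !hornerE expr2. Qed.

Variables (H : normedModType R) (dot : {dot H for idfun}) (W : H -> {RV P >-> R}).
Hypothesis norm_dot : forall h : H, `|h| ^+ 2 = dot h h.
Hypothesis isoW : isonormal_gaussian_process dot W.

Lemma intg_sqrB (X Y : T -> R) : measurable_fun setT X -> measurable_fun setT Y ->
  P.-intg (fun w => X w ^+ 2) -> P.-intg (fun w => Y w ^+ 2) -> P.-intg (fun w => (X w - Y w) ^+ 2).
Proof.
move=> mX mY IX IY; have := @intg_sqrD _ _ _ P X (fun w => (-1) * Y w) mX ltac:(meas) IX.
under [X in integrable _ _ X]eq_fun do rewrite /= exprMn sqrrN expr1n mul1r.
by move=> /(_ IY); under eq_fun do rewrite mulN1r.
Qed.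

(** The chaos condition in terms of real valued norms, for which stability under linear
    combinations is a triangle inequality. *)
Definition chaos2 (X : {RV P >-> R}) := P.-intg (fun w => X w ^+ 2) /\
  forall e : R, 0 < e -> exists (K : nat) (a : 'I_K -> R) (h : 'I_K -> H),
    (forall k, dot (h k) (h k) = 1) /\ l2 P (fun w => X w - quadW W h a w) < e.

Lemma chaos2_wiener (X : {RV P >-> R}) : wiener_chaos W 2 X -> chaos2 X.
Proof.
case=> X2 HX; have IX : P.-intg (fun w => X w ^+ 2) by exact: Lfun2_integrable_sqr.
split => // e /HX[K [a [h [h1 ahe]]]].
have hd k : dot (h k) (h k) = 1 by rewrite -norm_dot h1 expr1n.
exists K, a, h; split => //; rewrite -lte_fin -Lnorm_l2.
  apply: le_lt_trans ahe; rewrite le_eqVlt; apply/orP; left; apply/eqP; congr Lnorm.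
  apply/funext => w /=; congr (_ - _)%:E; apply: eq_bigr => k _.
  by rewrite hermite2E.
by apply: intg_sqrB => //; [exact: measurable_quad|exact: (quad_sqr_intg isoW hd a)].
Qed.

Lemma chaos2_lin (X Y Z : {RV P >-> R}) (s t : R) : (forall w, Z w = s * X w + t * Y w) ->
  chaos2 X -> chaos2 Y -> chaos2 Z.
Proof.
move=> ZE [IX HX] [IY HY].
have mX : measurable_fun setT X by exact: measurable_funPT.
have mY : measurable_fun setT Y by exact: measurable_funPT.
have sqZ (c : R) (f : T -> R) : P.-intg (fun w => f w ^+ 2) -> P.-intg (fun w => (c * f w) ^+ 2).
  by move=> If; under eq_fun do rewrite exprMn; exact: intgZ.
have mZ (c : R) (f : T -> R) : measurable_fun setT f -> measurable_fun setT (fun w => c * f w).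
  by move=> mf; meas.
split.
  under eq_fun do rewrite ZE.
  by apply: (@intg_sqrD _ _ _ P (fun w => s * X w) (fun w => t * Y w)); [exact: mZ|exact: mZ|exact: sqZ|exact: sqZ].
move=> e e0; pose c := 1 + `|s| + `|t|; have c0 : 0 < c by rewrite !ltr_pwDl.
have ec0 : 0 < e / c by exact: divr_gt0.
have [K [a [h [h1 ha]]]] := HX _ ec0; have [L [b [g [g1 gb]]]] := HY _ ec0.
exists (K + L)%N, (fun k => s * cat_family a (fun=> 0) k + t * cat_family (fun=> 0) b k), (cat_family h g).
split; first by move=> k; rewrite /cat_family; case: fintype.split.
have mqa := measurable_quad W h a; have mqb := measurable_quad W g b.
have IXa := intg_sqrB mX mqa IX (quad_sqr_intg isoW h1 a).
have IYb := intg_sqrB mY mqb IY (quad_sqr_intg isoW g1 b).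
have -> : (fun w => Z w - quadW W (cat_family h g) (fun k => s * cat_family a (fun=> 0) k + t * cat_family (fun=> 0) b k) w) =
    (fun w => s * (X w - quadW W h a w) + t * (Y w - quadW W g b w)).
  by apply/funext => w; rewrite ZE quadD !quadZ quad_catl quad_catr; ring.
have m1 : measurable_fun setT (fun w => X w - quadW W h a w) by meas.
have m2 : measurable_fun setT (fun w => Y w - quadW W g b w) by meas.
apply: (le_lt_trans (l2_triangle (mZ s _ m1) (mZ t _ m2) (sqZ s _ IXa) (sqZ t _ IYb))).
rewrite !l2Z//.
have h2 := ler_wpM2l (normr_ge0 s) (ltW ha); have h3 := ler_wpM2l (normr_ge0 t) (ltW gb).
apply: (le_lt_trans (lerD h2 h3)).
rewrite -mulrDl mulrC -mulrA gtr_pMr// mulrC ltr_pdivrMr// mul1r /c.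
by rewrite -addrA ltrDr.
Qed.

(** For fixed [e] the smoothed distribution function is Lipschitz in mean square, with a constant
    depending on [e].  This is harmless: the approximation error [del] goes to zero first, and
    the bound for finite sums does not depend on [e]. *)
Lemma chaos2_atan_increment (U V : {RV P >-> R}) (eta e b : R) :
  chaos2 U -> chaos2 V -> 0 < eta -> 4000 * eta <= 1 ->
  near_gaussian P eta U -> 8 * l2 P (fun w => V w - U w) <= eta -> 0 < e ->
  `|\int[P]_w atan ((b - V w) / e) - \int[P]_w atan ((b - U w) / e)| <=
    pi * (7 / 2 * l2 P (fun w => V w - U w)).
Proof.
move=> HU HV eta0 eta1 ng gl e0.
set L := l2 P _ in gl *; set A := `|_|.
have pi0 := pi_gt0 R; have L0 : 0 <= L := l2_ge0 _ _.
have mU : measurable_fun setT U by exact: measurable_funPT.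
have mV : measurable_fun setT V by exact: measurable_funPT.
have IU := HU.1; have IV := HV.1.
have key (del : R) : 0 < del -> 16 * del <= eta -> A <= pi * (7 / 2 * L) + (2 * e^-1 + 7 * pi) * del.
  move=> d0 de.
  have [K [a [h [h1 ha]]]] := HU.2 _ d0.
  have [K' [a' [h' [h1' ha']]]] := HV.2 _ d0.
  pose g := cat_family h h'; pose u := cat_family a (fun _ : 'I_K' => 0).
  pose v := cat_family (fun _ : 'I_K => 0) a'.
  have g1 k : dot (g k) (g k) = 1.
    by rewrite /g /cat_family; case: fintype.split.
  have quE : quadW W g u = quadW W h a by apply/funext => w; exact: quad_catl.
  have qvE : quadW W g v = quadW W h' a' by apply/funext => w; exact: quad_catr.
  rewrite -quE in ha; rewrite -qvE in ha'.
  have mu' := measurable_quad W g u; have mv' := measurable_quad W g v.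
  have Iu' := quad_sqr_intg isoW g1 u; have Iv' := quad_sqr_intg isoW g1 v.
  set u' := quadW W g u in ha mu' Iu'; set v' := quadW W g v in ha' mv' Iv'.
  pose x k := v k + (-1) * u k.
  have xE w : quadW W g x w = v' w - u' w by rewrite quadD quadZ mulN1r.
  have lx : l2 P (quadW W g x) <= L + 2 * del.
    have -> : quadW W g x = (fun w => ((V w - U w) + (U w - u' w)) + (-1) * (V w - v' w)).
      by apply/funext => w; rewrite xE; ring.
    have I1 := intg_sqrB mV mU IV IU; have I2 := intg_sqrB mU mu' IU Iu'.
    have I3 := intg_sqrB mV mv' IV Iv'.
    have m1 : measurable_fun setT (fun w => V w - U w) by meas.
    have m2 : measurable_fun setT (fun w => U w - u' w) by meas.
    have m3 : measurable_fun setT (fun w => V w - v' w) by meas.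
    have m4 : measurable_fun setT (fun w => (-1) * (V w - v' w)) by meas.
    have m12 : measurable_fun setT (fun w => (V w - U w) + (U w - u' w)) by meas.
    have I12 := intg_sqrD m1 m2 I1 I2.
    have I4 : P.-intg (fun w => ((-1) * (V w - v' w)) ^+ 2).
      by under eq_fun do rewrite exprMn sqrrN expr1n mul1r.
    apply: (le_trans (l2_triangle m12 m4 I12 I4)).
    have := l2_triangle m1 m2 I1 I2; rewrite (l2Z _ I3) normrN1 mul1r -/L => t1.
    by lra.
  have dist (f' : T -> R) (f : {RV P >-> R}) : measurable_fun setT f' -> P.-intg (fun w => f' w ^+ 2) ->
      P.-intg (fun w => f w ^+ 2) -> l2 P (fun w => f w - f' w) < del ->
      `|\int[P]_w atan ((b - f w) / e) - \int[P]_w atan ((b - f' w) / e)| <= e^-1 * del.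
    move=> mf' If' If lf; have mf : measurable_fun setT f by exact: measurable_funPT.
    have ei : 0 <= e^-1 by rewrite invr_ge0 ltW.
    apply: (le_trans _ (ler_wpM2l ei (ltW lf))).
    apply: (@Ex_lipschitz _ _ _ P (fun z => atan ((b - z) / e))) => //.
    - by apply: measurable_atan; meas.
    - by move=> y z; exact: atan_lipschitz.
    - exact: intg_atan.
    - exact: intg_atan.
    - exact: intg_sqrB.
  have ngu : near_gaussian P (eta + 4 * del) u'.
    apply: (@near_gaussian_perturb _ _ _ P eta del U) ng => //; [|lra|lra].
    have -> : (fun w => u' w - U w) = (fun w => (-1) * (U w - u' w)) by apply/funext => w; ring.
    by rewrite l2Z ?normrN1 ?mul1r ?(ltW ha)//; exact: intg_sqrB.
  have := @quad_atan_increment _ _ _ P _ _ _ isoW _ _ g1 (eta + 4 * del) u x e b.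
  move=> /(_ ltac:(lra) ltac:(lra) ngu e0).
  have E w : quadW W g u w + quadW W g x w = v' w by rewrite xE addrC subrK.
  under eq_Rintegral do rewrite E.
  have /ler_normlP[? ?] := dist _ _ mu' Iu' IU ha.
  have /ler_normlP[? ?] := dist _ _ mv' Iv' IV ha'.
  have lx' : pi * (7 / 2 * l2 P (quadW W g x)) <= pi * (7 / 2 * L) + 7 * pi * del.
    have -> : pi * (7 / 2 * L) + 7 * pi * del = pi * (7 / 2 * (L + 2 * del)) by field.
    by apply: ler_wpM2l; [exact: ltW|lra].
  move=> /ler_normlP[h3 h4].
  have -> : pi * (7 / 2 * L) + (2 * e^-1 + 7 * pi) * del =
    pi * (7 / 2 * L) + 7 * pi * del + (e^-1 * del + e^-1 * del) by ring.
  rewrite /A ler_norml; apply/andP.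
  split; lra.
rewrite leNgt; apply/negP => BA.
set B := pi * _ in key BA; set c := 2 * _ + _ in key.
have c0 : 0 < c by rewrite /c addr_gt0// mulr_gt0// invr_gt0.
pose del := Num.min (eta / 16) ((A - B) / (2 * c)).
have d0 : 0 < del by rewrite lt_min !divr_gt0 ?mulr_gt0// subr_gt0.
have d1 : del <= eta / 16 by rewrite ge_min lexx.
have d2 : del <= (A - B) / (2 * c) by rewrite ge_min lexx orbT.
have := key del d0 ltac:(lra).
have : c * del <= (A - B) / 2.
  have -> : (A - B) / 2 = c * ((A - B) / (2 * c)) by field; rewrite gt_eqF.
  by apply: ler_wpM2l => //; exact: ltW.
lra.
Qed.

Lemma chaos2_cdf_increment (U V : {RV P >-> R}) (eta z : R) :
  chaos2 U -> chaos2 V -> 0 < eta -> 4000 * eta <= 1 ->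
  near_gaussian P eta U -> 8 * l2 P (fun w => V w - U w) <= eta ->
  `|fine (cdf V z) - fine (cdf U z)| <= 7 / 2 * l2 P (fun w => V w - U w).
Proof.
move=> HU HV eta0 eta1 ng gl; apply: (@cdf_from_atan _ _ _ _ _ P P V U z (7 / 2 * l2 P (fun w => V w - U w))); [exact: measurable_funPT|exact: measurable_funPT|by []|].
by move=> e b e0; exact: (chaos2_atan_increment b HU HV eta0 eta1 ng gl e0).
Qed.

End chaos_limit.

(** * From distribution functions to characteristic functions *)

Section kolmogorov_to_characteristic.
Context {R : realType}.

Lemma Ex_indicator d (T : measurableType d) (P : probability T R) (X : T -> R) (z : R) :
  measurable_fun setT X ->
  P.-intg (fun w => ((X w <= z)%R : bool)%:R : R) /\ \int[P]_w ((X w <= z)%R : bool)%:R = fine (P (X @^-1` `]-oo, z])).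
Proof.
move=> mX.
have mA : measurable (X @^-1` `]-oo, z]) by rewrite -[_ @^-1` _]setTI; exact: mX.
have E w : ((X w <= z)%R : bool)%:R = \1_(X @^-1` `]-oo, z]) w :> R.
  rewrite indicE (_ : (w \in _) = (X w <= z))//.
  by apply/idP/idP => [|h]; [rewrite inE/= in_itv|rewrite inE/= in_itv/=].
split.
  under eq_fun do rewrite E; apply: (@intg_bd _ _ _ P 1) => [|w]; first exact: measurable_indic.
  by rewrite indicE; case: (_ \in _); rewrite ?normr1 ?normr0.
under eq_Rintegral do rewrite E.
by rewrite {1}/Rintegral integral_indic// setIT.
Qed.

(** A bounded Lipschitz function is approximated by a step function on the [n] intervals of length [h]
    that subdivide [[-K, K]]; outside of it Chebyshev's inequality applies.  Means of the step
    function only involve distribution functions. *)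
Section step.
Variables (f : R -> R) (K h : R) (n : nat).
Hypotheses (K0 : 0 < K) (h0 : 0 <= h) (f1 : forall x, `|f x| <= 1)
  (f_lip : forall x y, `|f y - f x| <= 1 * `|y - x|) (mf : measurable_fun setT f).
Hypothesis nh : n%:R * h = 2 * K.

Let z (i : nat) : R := - K + i%:R * h.
Let b (i : nat) x : R := ((x <= z i)%R : bool)%:R.
Let step x := \sum_(i < n) f (z i) * (b i.+1 x - b i x).

Let b_incr i x : 0 <= b i.+1 x - b i x.
Proof.
rewrite subr_ge0 /b ler_nat; case: (leP x (z i)) => // xi.
by rewrite (le_trans xi)// /z lerD2l ler_wpM2r// ler_nat.
Qed.

Let b_sum x : \sum_(i < n) (b i.+1 x - b i x) = b n x - b 0 x.
Proof. by rewrite -(big_mkord xpredT (fun i => b i.+1 x - b i x)) telescope_sumr. Qed.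

Let step_approx x : `|f x - step x| <= h + x ^+ 2 / K ^+ 2.
Proof.
have r0 : 0 <= x ^+ 2 / K ^+ 2 by rewrite divr_ge0// sqr_ge0.
have b01 i y : b i y = 0 \/ b i y = 1 by rewrite /b; case: (_ <= _); [right|left].
have out : b n x - b 0 x = 0 -> `|f x - step x| <= h + x ^+ 2 / K ^+ 2.
  move=> bb; have -> : step x = 0.
    have := b_sum x; rewrite bb => /eqP; rewrite psumr_eq0// => /allP zz.
    rewrite /step big1// => i _; have /implyP/(_ isT)/eqP -> := zz i (mem_index_enum i).
    by rewrite mulr0.
  rewrite subr0 (le_trans (f1 x))// -[leLHS]add0r; apply: lerD => //.
  suff Kx : K <= `|x|.
    by rewrite ler_pdivlMr ?exprn_gt0// mul1r -[leRHS]real_normK ?num_real// lerXn2r// nnegrE ltW.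
  rewrite leNgt; apply/negP; rewrite ltr_norml => /andP[x1 x2]; move: bb.
  have z0 : z 0%N = - K by rewrite /z mul0r addr0.
  have zn : z n = K by rewrite /z nh; ring.
  rewrite /b z0 zn (ltW x2) (leNgt x) x1 subr0 => /eqP.
  by rewrite oner_eq0.
have [b0|b0] := b01 0%N x; have [bn|bn] := b01 n x; try by apply: out; rewrite b0 bn; lra.
- have sum1 : \sum_(i < n) (b i.+1 x - b i x) = 1 by rewrite b_sum b0 bn subr0.
  have -> : f x - step x = \sum_(i < n) (f x - f (z i)) * (b i.+1 x - b i x).
    rewrite -[f x in LHS]mulr1 -sum1 mulr_sumr -sumrB.
    by apply: eq_bigr => i _; rewrite mulrBl.
  apply: (le_trans (ler_norm_sum _ _ _)).
  apply: (@le_trans _ _ (\sum_(i < n) h * (b i.+1 x - b i x))); last by rewrite -mulr_sumr sum1 mulr1 lerDl.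
  apply: ler_sum => i _; rewrite normrM (ger0_norm (b_incr _ _)).
  have [->|] := eqVneq (b i.+1 x - b i x) 0; first by rewrite !mulr0.
  rewrite /b; case: (leP x (z i)) => xi; case: (leP x (z i.+1)) => xi1; rewrite ?subrr ?subr0 ?eqxx// => _.
    by have := b_incr i x; rewrite /b xi (leNgt x (z i.+1)) xi1/= sub0r oppr_ge0 ler10.
  apply: ler_wpM2r => //; rewrite distrC (le_trans (f_lip _ _))// mul1r ltr0_norm ?subr_lt0//.
  by move: xi xi1; rewrite /z -natr1 => ? ?; lra.
- have : 0 <= \sum_(i < n) (b i.+1 x - b i x) by apply: sumr_ge0 => i _; exact: b_incr.
  by rewrite b_sum b0 bn sub0r oppr_ge0 ler10.
Qed.

Let step_mean d (T : measurableType d) (P : probability T R) (X : T -> R) :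
  measurable_fun setT X -> P.-intg (fun w => X w ^+ 2) ->
  `|\int[P]_w f (X w) - \sum_(i < n) f (z i) * (fine (P (X @^-1` `]-oo, z i.+1])) - fine (P (X @^-1` `]-oo, z i])))| <=
  h + \int[P]_w (X w ^+ 2) / K ^+ 2.
Proof.
move=> mX IX.
have Ib i : P.-intg (fun w => b i (X w)) by exact: (Ex_indicator P (z i) mX).1.
have Eb i : \int[P]_w b i (X w) = fine (P (X @^-1` `]-oo, z i])) by exact: (Ex_indicator P (z i) mX).2.
have Is : P.-intg (fun w => step (X w)).
  by apply: intg_sum => i; apply: intgZ; exact: intgB.
have -> : \sum_(i < n) f (z i) * (fine (P (X @^-1` `]-oo, z i.+1])) - fine (P (X @^-1` `]-oo, z i]))) = \int[P]_w step (X w).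
  rewrite Ex_sum => [|i]; last by apply: intgZ; exact: intgB.
  apply: eq_bigr => i _.
  by rewrite ExZ; [rewrite ExB// !Eb|exact: intgB].
have If : P.-intg (fun w => f (X w)).
  by apply: (@intg_bd _ _ _ P 1) => //; exact: measurableT_comp.
have I1 : P.-intg (cst h) := intg_cst _ _.
have I2 : P.-intg (fun w => (K ^+ 2)^-1 * X w ^+ 2) by exact: intgZ.
rewrite -ExB//; apply: (le_trans (Ex_norm (intgB If Is))).
apply: (@le_trans _ _ (\int[P]_w (cst h w + (K ^+ 2)^-1 * X w ^+ 2))).
  apply: Ex_le; [exact/intg_norm/intgB|exact: intgD|].
  by move=> w; rewrite (mulrC (K ^+ 2)^-1); exact: step_approx.
by rewrite ExD// ExZ// mulrC Rintegral_cst// [X in fine X]probability_setT mulr1.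
Qed.

Lemma kolmogorov_step d1 d2 (T1 : measurableType d1) (T2 : measurableType d2)
  (P : probability T1 R) (Q : probability T2 R) (X : T1 -> R) (Y : T2 -> R) del :
  measurable_fun setT X -> measurable_fun setT Y ->
  P.-intg (fun w => X w ^+ 2) -> Q.-intg (fun w => Y w ^+ 2) ->
  \int[P]_w (X w ^+ 2) = 1 -> \int[Q]_w (Y w ^+ 2) = 1 ->
  (forall t, `|fine (P (X @^-1` `]-oo, t])) - fine (Q (Y @^-1` `]-oo, t]))| <= del) ->
  `|\int[P]_w f (X w) - \int[Q]_w f (Y w)| <= 2 * h + 2 / K ^+ 2 + 2 * n%:R * del.
Proof.
move=> mX mY IX IY X1 Y1 hd.
have := step_mean mX IX; have := step_mean mY IY; rewrite X1 Y1.
set sX := \sum_(i < n) _; set sY := \sum_(i < n) _ => hY hX.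
have ds : `|sX - sY| <= 2 * n%:R * del.
  rewrite -sumrB; apply: (le_trans (ler_norm_sum _ _ _)).
  have -> : 2 * n%:R * del = \sum_(i < n) (2 * del) by rewrite sumr_const card_ord -mulr_natl; ring.
  apply: ler_sum => i _; rewrite -mulrBr normrM.
  apply: (le_trans (ler_piMl _ (f1 _))) => //.
  have /ler_normlP[? ?] := hd (z i.+1); have /ler_normlP[? ?] := hd (z i).
  by rewrite ler_norml; apply/andP; split; lra.
move: hX hY ds; rewrite !ler_norml => /andP[? ?] /andP[? ?] /andP[? ?].
by apply/andP; split; lra.
Qed.

End step.

Variables (d1 d2 : measure_display) (T1 : measurableType d1) (T2 : measurableType d2).
Variables (P : probability T1 R) (Q : probability T2 R).

Lemma kolmogorov_lipschitz (Y : T2 -> R) (eta : R) : 0 < eta -> measurable_fun setT Y ->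
  Q.-intg (fun w => Y w ^+ 2) -> \int[Q]_w (Y w ^+ 2) = 1 ->
  exists2 del : R, 0 < del & forall (X : T1 -> R) (f : R -> R), measurable_fun setT X ->
  P.-intg (fun w => X w ^+ 2) -> \int[P]_w (X w ^+ 2) = 1 ->
  (forall t, `|fine (P (X @^-1` `]-oo, t])) - fine (Q (Y @^-1` `]-oo, t]))| <= del) ->
  measurable_fun setT f -> (forall x, `|f x| <= 1) ->
  (forall x y, `|f y - f x| <= 1 * `|y - x|) ->
  `|\int[P]_w f (X w) - \int[Q]_w f (Y w)| <= eta.
Proof.
move=> eta0 mY IY Y1; pose K := 1 + 6 / eta.
have e6 : 0 < 6 / eta by rewrite divr_gt0.
have K1 : 1 <= K by rewrite lerDl ltW.
have K0 : 0 < K by exact: lt_le_trans K1.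
have KK : 2 / K ^+ 2 <= eta / 3.
  rewrite ler_pdivrMr ?exprn_gt0//.
  have : 6 / eta <= K ^+ 2 by rewrite (@le_trans _ _ K)// ?lerDr// expr2 ler_peMl// ltW.
  by rewrite ler_pdivrMr//; lra.
pose n := (Num.truncn (12 * K / eta)).+1.
have n0 : 0 < n%:R :> R by rewrite ltr0n.
have nK : 12 * K / eta <= n%:R by rewrite ltW// truncnS_gt.
pose h := 2 * K / n%:R.
have h0 : 0 <= h by rewrite divr_ge0// mulr_ge0// ltW.
have nh : n%:R * h = 2 * K by rewrite /h; field; rewrite gt_eqF.
have h2 : 2 * h <= eta / 3.
  rewrite -(ler_pM2l n0) mulrCA nh.
  by move: nK; rewrite ler_pdivrMr//; lra.
pose del := eta / 3 / (2 * n%:R).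
exists del => [|X f mX IX X1 hd mf f1 fl]; first by rewrite !divr_gt0// mulr_gt0.
apply: (le_trans (kolmogorov_step K0 h0 f1 fl mf nh mX mY IX IY X1 Y1 hd)).
have -> : 2 * n%:R * del = eta / 3 by rewrite /del; field; rewrite gt_eqF.
lra.
Qed.

Lemma near_gaussian_of_kolmogorov (N : {RV Q >-> R}) (eta : R) : standard_normal N -> 0 < eta ->
  exists2 del : R, 0 < del & forall X : {RV P >-> R}, P.-intg (fun w => X w ^+ 2) ->
  \int[P]_w (X w ^+ 2) = 1 -> (forall t, `|fine (cdf X t) - fine (cdf N t)| <= del) ->
  near_gaussian P eta X.
Proof.
move=> lawN eta0; pose gam := normal_prob (0 : R) 1.
have mN : measurable_fun setT N by exact: measurable_funPT.
have one0 : 0 < 1 :> R := ltr01.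
have [I2 E2] : Q.-intg (fun w => N w ^+ 2) /\ \int[Q]_w (N w ^+ 2) = 1.
  have I : gam.-intg (fun x => x ^+ 2).
    apply: (@intg_normal _ 1 one0 _ 1) => [|x]; first by meas.
    by rewrite mul1r ger0_norm ?sqr_ge0//; case: (x2le x) => _ [].
  have [J ->] := Ex_law lawN I; split => //.
  by rewrite (@normal_moment2 _ 1 one0) expr1n.
have Ec a : \int[Q]_w cos (1 * N w + a) = expR (- 2^-1) * cos a.
  have I : gam.-intg (fun x => cos (1 * x + a)).
    apply: (@intg_normal _ 1 one0 _ 1) => [|x]; first by meas.
    by rewrite [leRHS]mul1r (le_trans (cos_norm _))// lerDl exprn_even_ge0.
  have [_ ->] := Ex_law lawN I.
  by rewrite (@normal_cos _ 1 one0) !expr1n mul1r mul1r.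
have Ecos : \int[Q]_w cos (N w) = expR (- 2^-1).
  have := Ec 0; rewrite cos0 mulr1 => <-.
  by apply: eq_Rintegral => w _; rewrite addr0 mul1r.
have Esin : \int[Q]_w sin (N w) = 0.
  have := Ec (- (pi / 2)); rewrite cosN cos_pihalf mulr0 => <-.
  by apply: eq_Rintegral => w _; rewrite mul1r cosBpihalf.
have [del del0 H] := kolmogorov_lipschitz eta0 mN I2 E2.
exists del => // X IX X1 hd; have mX : measurable_fun setT X by exact: measurable_funPT.
split.
- by rewrite X1 subrr normr0 ltW.
- rewrite -Ecos; apply: H => //; [by meas|exact: cos_norm|exact: cos_lipschitz].
- rewrite -[X in `|X|]subr0 -Esin; apply: H => //; [by meas|exact: sin_norm|exact: sin_lipschitz].
Qed.

End kolmogorov_to_characteristic.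

(** * The Kolmogorov distance and normalization *)

Section kolmogorov.
Context {R : realType} d d' {T : measurableType d} {T' : measurableType d'}
  (P : probability T R) (Q : probability T' R).
Implicit Types (U : {RV P >-> R}) (N : {RV Q >-> R}).

Let cdf_diff U N z : (`|cdf U z - cdf N z| = `|fine (cdf U z) - fine (cdf N z)|%:E)%E.
Proof.
have fU : cdf U z \is a fin_num by rewrite /cdf; exact: fin_num_measure.
have fN : cdf N z \is a fin_num by rewrite /cdf; exact: fin_num_measure.
by rewrite -[in LHS](fineK fU) -[in LHS](fineK fN).
Qed.

Lemma cdf_diff_le1 U N z : `|fine (cdf U z) - fine (cdf N z)| <= 1.
Proof.
have h d0 (S : measurableType d0) (mu : probability S R) (X : {RV mu >-> R}) : 0 <= fine (cdf X z) <= 1.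
  rewrite fine_ge0 ?measure_ge0//= -lee_fin fineK ?probability_le1//.
  by rewrite /cdf; exact: fin_num_measure.
by have /andP[? ?] := h _ _ _ U; have /andP[? ?] := h _ _ _ N; rewrite ler_norml; apply/andP; split; lra.
Qed.

Lemma kolmogorov_dist_le U N (M : R) :
  (forall z, `|fine (cdf U z) - fine (cdf N z)| <= M) -> (kolmogorov_dist U N <= M%:E)%E.
Proof.
by move=> h; apply: ge_ereal_sup => _ [z _ <-]; rewrite cdf_diff lee_fin.
Qed.

Lemma kolmogorov_dist_fin U N : exists r : R, [/\ kolmogorov_dist U N = r%:E, 0 <= r &
  forall z, `|fine (cdf U z) - fine (cdf N z)| <= r].
Proof.
have ub z : (`|fine (cdf U z) - fine (cdf N z)|%:E <= kolmogorov_dist U N)%E.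
  by rewrite -cdf_diff; apply: ereal_sup_ubound; exists z.
have le1 := kolmogorov_dist_le (cdf_diff_le1 U N).
move: le1 ub; case: (kolmogorov_dist U N) => [r _ ub| |].
- exists r; split => //; first by apply: le_trans (_ : `|_| <= r); [|exact: (ub 0)].
- by rewrite leye_eq.
- by move=> _ /(_ 0); rewrite leeNy_eq.
Qed.

End kolmogorov.

Section normalization.
Context {R : realType} d {T : measurableType d} (P : probability T R).

Lemma Ex_sqrE (X : {RV P >-> R}) : fine 'E_P[fun w => (X w ^+ 2)%R]%E = \int[P]_w (X w ^+ 2).
Proof. by rewrite unlock. Qed.

Lemma normalizedE (X : {RV P >-> R}) w : normalized X w = (l2 P X)^-1 * X w.
Proof. by rewrite /normalized Ex_sqrE. Qed.

Lemma l2_normalized (X : {RV P >-> R}) : P.-intg (fun w => X w ^+ 2) -> 0 < l2 P X ->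
  \int[P]_w (normalized X w ^+ 2) = 1.
Proof.
move=> IX X0; under eq_Rintegral do rewrite normalizedE exprMn.
by rewrite ExZ// -l2_sqr exprVn mulVf// expf_neq0// gt_eqF.
Qed.

(** The difference is [G / |M| + (1 / |M| - 1 / |F|) F], and [| |F| - |M| |] is at most [|G|]. *)
Lemma normalized_dist (F G M : {RV P >-> R}) (s : R) : (forall w, M w = F w + G w) ->
  P.-intg (fun w => F w ^+ 2) -> P.-intg (fun w => G w ^+ 2) ->
  0 < s -> 2 * s <= l2 P F -> l2 P G <= s ->
  0 < l2 P M /\ l2 P (fun w => normalized M w - normalized F w) <= 2 / s * l2 P G.
Proof.
move=> ME IF IG s0 sF Gs.
have mF : measurable_fun setT F by exact: measurable_funPT.
have mG : measurable_fun setT G by exact: measurable_funPT.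
have mM : measurable_fun setT M by exact: measurable_funPT.
have IM : P.-intg (fun w => M w ^+ 2) by under eq_fun do rewrite ME; exact: intg_sqrD.
have mG' : measurable_fun setT (fun w => (-1) * G w) by meas.
have IG' : P.-intg (fun w => ((-1) * G w) ^+ 2) by under eq_fun do rewrite exprMn sqrrN expr1n mul1r.
have t1 : l2 P M <= l2 P F + l2 P G.
  have -> : (M : T -> R) = (fun w => F w + G w) by apply/funext.
  exact: l2_triangle.
have t2 : l2 P F <= l2 P M + l2 P G.
  have -> : (F : T -> R) = (fun w => M w + (-1) * G w) by apply/funext => w; rewrite ME; ring.
  by rewrite (le_trans (l2_triangle mM mG' IM IG'))// l2Z// normrN1 mul1r.
have sM : s <= l2 P M by lra.
have M0 : 0 < l2 P M by exact: lt_le_trans sM.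
have F0 : 0 < l2 P F by lra.
split => //; set m := l2 P M in t1 t2 sM M0 *; set f := l2 P F in t1 t2 sF F0 *; set g := l2 P G in t1 t2 Gs *.
have -> : (fun w => normalized M w - normalized F w) = (fun w => m^-1 * G w + (m^-1 - f^-1) * F w).
  by apply/funext => w; rewrite !normalizedE ME -/m -/f; ring.
have m1 c (X : {RV P >-> R}) : measurable_fun setT (fun w => c * X w) by apply: measurable_funM.
have I1 c (X : {RV P >-> R}) : P.-intg (fun w => X w ^+ 2) -> P.-intg (fun w => (c * X w) ^+ 2).
  by move=> IX; under eq_fun do rewrite exprMn; exact: intgZ.
apply: (le_trans (l2_triangle (m1 _ G) (m1 _ F) (I1 _ _ IG) (I1 _ _ IF))).
rewrite !l2Z// -/f -/g.
have -> : m^-1 - f^-1 = (f - m) * m^-1 * f^-1 by field; rewrite !gt_eqF.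
rewrite !normrM !normfV (gtr0_norm M0) (gtr0_norm F0) divfK ?gt_eqF//.
have fm : `|f - m| <= g by rewrite ler_norml; apply/andP; split; lra.
have g0 : 0 <= g by exact: l2_ge0.
have im : m^-1 <= s^-1 by rewrite lef_pV2.
have im0 : 0 <= m^-1 by rewrite invr_ge0 ltW.
apply: (@le_trans _ _ (2 * g * m^-1)).
  by have := ler_wpM2r im0 fm; lra.
by have := ler_wpM2l g0 im; lra.
Qed.

End normalization.

Theorem lemma3p5 (R : realType)
    (d : measure_display) (Omega : measurableType d) (P : probability Omega R)
    (H : completeNormedModType R) (dot : {dot H for idfun})
    (norm_dot : forall h : H, `|h| ^+ 2 = dot h h)
    (W : H -> {RV P >-> R})
    (isoW : isonormal_gaussian_process dot W)
    (d' : measure_display) (Omega' : measurableType d')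
    (Q : probability Omega' R) (N : {RV Q >-> R})
    (normalN : standard_normal N)
    (F G M : R -> {RV P >-> R})
    (chaosF : forall t : R, 0 < t -> wiener_chaos W 2 (F t))
    (chaosG : forall t : R, 0 < t -> wiener_chaos W 2 (G t))
    (M_def : forall t : R, 0 < t ->
      forall w : Omega, M t w = F t w + G t w)
    (c : R) (c_gt0 : 0 < c)
    (cvgF : 'E_P[fun w => (F t w ^+ 2)%R]%E @[t --> +oo] --> c%:E)
    (cvgG : 'E_P[fun w => (G t w ^+ 2)%R]%E @[t --> +oo] --> 0%E) :
  exists2 C : R, 0 < C &
    \forall t \near +oo,
      (kolmogorov_dist (normalized (M t)) N <=
       C%:E * kolmogorov_dist (normalized (F t)) N +
       C%:E * 'N[P]_2%:E[EFin \o G t])%E.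
Proof.
have [eta eta0 eta1] : exists2 eta : R, 0 < eta & 4000 * eta <= 1.
  by exists 4000^-1; lra.
have [del del0 Hdel] := near_gaussian_of_kolmogorov P normalN eta0.
(* Eventually the norm of [F t] is at least [2 s] and that of [G t] at most [eps]. *)
pose s := Num.sqrt (c / 2) / 2.
have s0 : 0 < s by rewrite divr_gt0// sqrtr_gt0 divr_gt0.
pose eps := Num.min s (eta * s / 16).
have eps0 : 0 < eps by rewrite lt_min s0 divr_gt0// mulr_gt0.
(* The three terms serve the triangle inequality, the increment from [F t] to [M t], and the case
   where the distance for [F t] exceeds [del]. *)
pose C := 1 + 7 / s + del^-1.
have s7 : 0 < 7 / s by rewrite divr_gt0.
have d7 : 0 < del^-1 by rewrite invr_gt0.
have C0 : 0 < C by rewrite !addr_gt0.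
exists C => //.
have /fine_cvgP[_ cF] := cvgF; have /fine_cvgP[_ cG] := cvgG.
have nearF : \forall t \near +oo, c / 2 < fine 'E_P[fun w => (F t w ^+ 2)%R]%E.
  by apply: (cvgr_gt _ cF); lra.
have nearG : \forall t \near +oo, fine 'E_P[fun w => (G t w ^+ 2)%R]%E < eps ^+ 2.
  by apply: (cvgr_lt _ cG); rewrite exprn_gt0.
near=> t.
have t0 : 0 < t by near: t; exact: nbhs_pinfty_gt.
have cFt : c / 2 < \int[P]_w (F t w ^+ 2) by rewrite -Ex_sqrE; near: t.
have cGt : \int[P]_w (G t w ^+ 2) < eps ^+ 2 by rewrite -Ex_sqrE; near: t.
have HF := chaos2_wiener norm_dot isoW (chaosF t t0).
have HG := chaos2_wiener norm_dot isoW (chaosG t t0).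
have sF : 2 * s <= l2 P (F t).
  by rewrite /s mulrC divfK// /l2 ler_wsqrtr// ltW.
have Ge : l2 P (G t) <= eps.
  by rewrite -[leRHS](ger0_norm (ltW eps0)) -sqrtr_sqr /l2 ler_wsqrtr// ltW.
have Gs : l2 P (G t) <= s by rewrite (le_trans Ge)// ge_min lexx.
have Ge' : l2 P (G t) <= eta * s / 16 by rewrite (le_trans Ge)// ge_min lexx orbT.
have [M0 dist] := normalized_dist (M_def t t0) HF.1 HG.1 s0 sF Gs.
have HM : chaos2 dot W (M t).
  apply: (chaos2_lin isoW (s := 1) (t := 1) _ HF HG) => w.
  by rewrite !mul1r M_def.
have HU : chaos2 dot W (normalized (F t)).
  apply: (chaos2_lin isoW (s := (l2 P (F t))^-1) (t := 0) _ HF HF) => w.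
  by rewrite normalizedE mul0r addr0.
have HV : chaos2 dot W (normalized (M t)).
  apply: (chaos2_lin isoW (s := (l2 P (M t))^-1) (t := 0) _ HM HM) => w.
  by rewrite normalizedE mul0r addr0.
have [r [-> r0 rz]] := kolmogorov_dist_fin (normalized (F t)) N.
rewrite (Lnorm_l2 HG.1) -!EFinM -EFinD.
have g0 := l2_ge0 P (G t).
apply: kolmogorov_dist_le => z.
have [rd|rd] := leP r del; last first.
  apply: (le_trans (cdf_diff_le1 _ _ _)).
  have : 1 <= C * r.
    have h1 : del^-1 * del <= del^-1 * r by apply: ler_wpM2l; exact: ltW.
    rewrite mulVf ?gt_eqF// in h1; apply: (le_trans h1); apply: ler_wpM2r => //.
    by rewrite /C lerDr addr_ge0// ltW.
  by have := mulr_ge0 (ltW C0) g0; lra.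
have F0 : 0 < l2 P (F t) by apply: lt_le_trans sF; exact: mulr_gt0.
have ng : near_gaussian P eta (normalized (F t)).
  apply: Hdel; [exact: HU.1|exact: l2_normalized HF.1 F0|].
  by move=> u; exact: le_trans (rz u) rd.
have small : 8 * l2 P (fun w => normalized (M t) w - normalized (F t) w) <= eta.
  have h1 := ler_wpM2l (ltW s0) dist.
  rewrite -(ler_pM2l s0).
  have e1 : s * (2 / s * l2 P (G t)) = 2 * l2 P (G t) by field; rewrite gt_eqF.
  by rewrite e1 in h1; lra.
have incr := chaos2_cdf_increment isoW z HU HV eta0 eta1 ng small.
have h1 : `|fine (cdf (normalized (M t)) z) - fine (cdf (normalized (F t)) z)| <= 7 / s * l2 P (G t).
  apply: (le_trans incr).
  have -> : 7 / s * l2 P (G t) = 7 / 2 * (2 / s * l2 P (G t)) by field; rewrite gt_eqF.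
  by apply: ler_wpM2l.
have h2 : 7 / s * l2 P (G t) <= C * l2 P (G t) by apply: ler_wpM2r => //; rewrite /C; lra.
have h3 : r <= C * r by rewrite ler_peMl// /C; lra.
have /ler_normlP[? ?] := h1; have /ler_normlP[? ?] := rz z.
by rewrite ler_norml; apply/andP; split; lra.
Unshelve. all: by end_near. Qed.
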